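(* Let $Q$ be the source-sink quiver of type $A_{2m+1}$ (type II), with vertices $s_1,\dots,s_{2m+1}$ and arrows $a_{2i-1}:s_{2i}\to s_{2i-1}$ and $a_{2i}:s_{2i}\to s_{2i+1}$ for $1\le i\le m$. Let $V_1,\dots,V_{2m+1}$ be complex vector spaces of dimensions $d_1,\dots,d_{2m+1}$ and let $\mathcal R_d$ be the space of representations of $Q$ on them. Let $r=(r_1,\dots,r_{2m})$, $p=(p_1,\dots,p_{m-1})$, $q=(q_1,\dots,q_m)$ be integer vectors, and let $\overline{\mathcal O}_{r,p,q}$ be the closure of the set $\mathcal O_{r,p,q}$ of $\phi\in\mathcal R_d$ with $$\dim\mathrm{Im}\,\phi_{a_i}=r_i\ (1\le i\le 2m),\quad \dim(\mathrm{Im}\,\phi_{a_{2i}}+\mathrm{Im}\,\phi_{a_{2i+1}})=p_i\ (1\le i\le m-1),$$ $$\dim(\ker\phi_{a_{2i}}\cap\ker\phi_{a_{2i-1}})=q_i\ (1\le i\le m).$$ Assume $p_i\neq r_{2i+1},r_{2i}$ for $1\le i\le m-1$ and $q_i\neq d_{2i}-r_{2i-1},\,d_{2i}-r_{2i}$ for $1\le i\le m$. Then the resolution of singularities of $\overline{\mathcal O}_{r,p,q}$ defined by $W,F$ (see the context) is crepant if and only if $$d_1=d_{2m+1}=p_i\ (1\le i\le m-1),\qquad q_i=d_{2i}-d_1\ (1\le i\le m),\qquad r_i=d_{i+1}-r_{i+1}\ (1\le i\le 2m-1).$$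
   Context: $\mathrm{Gr}(\alpha,V_i)$ is the Grassmannian of $\alpha$-dimensional subspaces of $V_i$, and $F(\alpha_1,\alpha_2,V_i)$ is the flag variety in $V_i$ with tautological bundles $\mathcal U_{i,1}\subset\mathcal U_{i,2}$ of ranks $\alpha_1,\alpha_2$. On $\mathrm{Gr}(r_1,V_1)$ the tautological bundle is denoted $\mathcal U_{1,1}$. Bundles are pulled back to products. $\mathcal R_d=\bigoplus_a\mathrm{Hom}(V_{a(0)},V_{a(1)})$, the sum being over the arrows $a$, with $a(0)$ the source and $a(1)$ the target of $a$. The resolution of $\overline{\mathcal O}_{r,p,q}$ is the total space of $$W=\bigoplus_{i=1}^{m-1}\Big(((V_{2i}/\mathcal U_{2i,1})^*\otimes\mathcal U_{2i-1,1})\oplus((V_{2i}/\mathcal U_{2i,2})^*\otimes\mathcal U_{2i+1,2})\Big)\oplus((V_{2m}/\mathcal U_{2m,1})^*\otimes\mathcal U_{2m-1,1})\oplus((V_{2m}/\mathcal U_{2m,2})^*\otimes V_{2m+1})$$ over $$F=\mathrm{Gr}(r_1,V_1)\times F(q_m,d_{2m}-r_{2m},V_{2m})\times\prod_{i=1}^{m-1}\big(F(q_i,d_{2i}-r_{2i},V_{2i})\times F(r_{2i+1},p_i,V_{2i+1})\big),$$ viewed as a subbundle of the trivial bundle $\mathcal R_d\times F$ and mapped to $\mathcal R_d$ by projection. The set $\mathcal O_{r,p,q}$ is assumed nonempty, and the subspaces parametrized by the Grassmannian and flag factors of $F$ are assumed nonzero and proper, with strict inclusions in the flags. The resolution is crepant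 if $\det(W)\cong K_F$ as line bundles on $F$ (equivalently, the total space of $W$ has trivial canonical bundle). *)

(* Defs.v *)
From HB Require Import structures.
From mathcomp Require Import all_boot all_order all_algebra.
From mathcomp Require Import mpoly complex reals.
Set Implicit Arguments.
Unset Strict Implicit.
Unset Printing Implicit Defensive.
Import Order.TTheory GRing.Theory Num.Theory.
Local Open Scope ring_scope.

(** * Line bundles on a variety glued from affine spaces

    A smooth variety of dimension [N] is presented by a family of charts,
    indexed by [I], each an open subset isomorphic to the affine space of
    points ['rV[K]_N]; [glue i x j y] says that the point of coordinates [x] in
    chart [i] is the point of coordinates [y] in chart [j].  A line bundle
    trivialised on the charts is given by its transition functions
    [g i j x y c]: at that common point, the trivialising section of chart [j]
    is [c] times the one of chart [i]. *)

Section GluedVariety.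
Variables (K : fieldType) (I : Type) (N : nat).
Variable glue : I -> 'rV[K]_N -> I -> 'rV[K]_N -> Prop.

Definition regular_fun (f : 'rV[K]_N -> K) : Prop :=
  exists P : {mpoly K[N]}, forall x, f x = P.@[x 0].

(** Near [x], the change of coordinates from chart [i] to chart [j] is the
    rational map of components [P l / Q]; [J l k] is the derivative of its
    [l]-th component along the [k]-th coordinate, by the quotient rule. *)
Definition jacobian (i j : I) (x : 'rV[K]_N) (J : 'M[K]_N) : Prop :=
  exists (P : 'I_N -> {mpoly K[N]}) (Q : {mpoly K[N]}),
    [/\ Q.@[x 0] != 0,
        forall x' : 'rV[K]_N, Q.@[x' 0] != 0 ->
          glue i x' j (\row_l ((P l).@[x' 0] / Q.@[x' 0]))
      & forall l k : 'I_N,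
          J l k = ((P l)^`M(k).@[x 0] * Q.@[x 0]
                   - (P l).@[x 0] * Q^`M(k).@[x 0]) / Q.@[x 0] ^+ 2].

Definition transition : Type := I -> I -> 'rV[K]_N -> 'rV[K]_N -> K -> Prop.

(** [dy_1 /\ .. /\ dy_N = det (dy_l / dx_k) dx_1 /\ .. /\ dx_N]. *)
Definition canonical_bundle : transition :=
  fun i j x _ c => exists2 J, jacobian i j x J & c = \det J.

(** The isomorphism sends the trivialising section of the first bundle on
    chart [i] to [h i] times that of the second one. *)
Definition line_bundle_iso (g g' : transition) : Prop :=
  exists h : I -> 'rV[K]_N -> K,
    [/\ forall i, regular_fun (h i),
        forall i x, h i x != 0
      & forall i j x y c c', glue i x j y -> g i j x y c -> g' i j x y c' ->
          h j y * c' = c * h i x].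

End GluedVariety.

(** * Products of flag varieties

    [F] is the product, over [1 <= v <= M], of the varieties of flags
    [U_{v,1} <= U_{v,2} <= V v] of ranks [alpha v] and [beta v].  Its charts
    are the products of big cells, one for every family of bases. *)

Section FlagVarieties.
Variables (K : fieldType) (V : nat -> vectType K) (M : nat).
Variables alpha beta : nat -> nat.

Definition flags : Type := forall v : nat, {vspace V v} * {vspace V v}.

Definition in_F (U : flags) : Prop :=
  forall v, (0 < v <= M)%N ->
    [&& \dim (U v).1 == alpha v, \dim (U v).2 == beta v
      & ((U v).1 <= (U v).2)%VS].

(** Components outside [1 .. M] carry no information. *)
Definition same_flags (U U' : flags) : Prop :=
  forall v, (0 < v <= M)%N -> U v = U' v.

Record bases : Type := Bases {
  basis_at :> forall v, (\dim {:V v}).-tuple (V v);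
  basis_atP : forall v, basis_of fullv (basis_at v) }.

(** The coordinates of a big cell: triples [(v, k, l)] for the entry [(k, l)]
    of a unipotent matrix at [v], strictly above the diagonal blocks of the
    decomposition [alpha v, beta v - alpha v, \dim (V v) - beta v]. *)
Definition slots : seq (nat * nat * nat) :=
  [seq s <- [seq (vk, l) | vk <- [seq (v, k) | v <- iota 1 M,
                                               k <- iota 0 (\dim {:V v})],
                           l <- iota 0 (\dim {:V vk.1})]
         | (s.1.2 < alpha s.1.1 <= s.2)%N || (s.1.2 < beta s.1.1 <= s.2)%N].

Definition dimF : nat := size slots.

Definition slot_entry (x : 'rV[K]_dimF) (s : nat * nat * nat) : K :=
  \sum_(a < dimF | nth (0, 0, 0)%N slots a == s) x 0 a.

Definition moving_basis (B : bases) (x : 'rV[K]_dimF) (v k : nat) : V v :=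
  (B v)`_k + \sum_(l < \dim {:V v}) slot_entry x (v, k, val l) *: (B v)`_l.

Definition cell (B : bases) (x : 'rV[K]_dimF) : flags := fun v =>
  (<<mkseq (moving_basis B x v) (alpha v)>>%VS,
   <<mkseq (moving_basis B x v) (beta v)>>%VS).

Definition glueF (B : bases) (x : 'rV[K]_dimF) (B' : bases) (y : 'rV[K]_dimF) :
  Prop := same_flags (cell B x) (cell B' y).

Lemma slot_entry_ltn x v k l :
  ~~ (k < l)%N -> slot_entry x (v, k, l) = 0.
Proof.
move=> nkl; rewrite /slot_entry big1 // => a /eqP sa.
have: nth (0, 0, 0)%N slots a \in slots by rewrite mem_nth.
rewrite {}sa /slots mem_filter /= => /andP[/orP[]/andP[h1 h2] _];
by rewrite (leq_trans h1 h2) in nkl.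
Qed.

Lemma moving_basisP B x v :
  basis_of fullv (mkseq (moving_basis B x v) (\dim {:V v})).
Proof.
set n := \dim _; set S := mkseq _ _.
have sS : size S = n by rewrite size_mkseq.
have inS k : (k < n)%N -> moving_basis B x v k \in <<S>>%VS.
  move=> kn; apply: memv_span; apply/mapP; exists k => //.
  by rewrite mem_iota.
have BS j k : (n - j <= k < n)%N -> (B v)`_k \in <<S>>%VS.
  elim: j k => [|j IH] k; first by rewrite subn0; case: ltngtP.
  case/andP=> jk kn.
  have -> : (B v)`_k = moving_basis B x v k
      - \sum_(l < n) slot_entry x (v, k, val l) *: (B v)`_l.
    by rewrite /moving_basis addrK.
  apply: rpredB; first exact: inS.
  apply: rpred_sum => l _; have [kl|/negbTE kl] := boolP (k < l)%N.
    apply: rpredZ; apply: IH; rewrite ltn_ord andbT.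
    by move: jk; rewrite !leq_subLR addSnnS => /leq_trans; apply; rewrite leq_add2l.
  by rewrite slot_entry_ltn ?kl // scale0r rpred0.
rewrite basisEdim sS leqnn andbT.
rewrite -[X in (X <= _)%VS](span_basis (basis_atP B v)).
apply/span_subvP => w /(nthP 0)[k]; rewrite size_tuple => kn <-.
by apply: (BS n); rewrite subnn.
Qed.

Lemma cell_in_F B x :
    (forall v, (0 < v <= M)%N -> (alpha v <= beta v <= \dim {:V v})%N) ->
  in_F (cell B x).
Proof.
move=> ab v vM; have /andP[le_ab le_bn] := ab v vM.
have fr a : (a <= \dim {:V v})%N -> free (mkseq (moving_basis B x v) a).
  move=> an; have := basis_free (moving_basisP B x v).
  rewrite /mkseq -{1}(subnKC an) iotaD map_cat; exact: catl_free.
have dm a : (a <= \dim {:V v})%N -> \dim <<mkseq (moving_basis B x v) a>> = a.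
  by move=> an; have /eqP -> := fr a an; rewrite size_mkseq.
rewrite /cell /= !dm ?eqxx ?(leq_trans le_ab) //=.
by rewrite /mkseq -(subnKC le_ab) iotaD map_cat span_cat addvSl.
Qed.

Lemma cells_cover_F U : in_F U -> exists B : bases, same_flags U (cell B 0).
Proof.
move=> UF.
have bas v : {B : (\dim {:V v}).-tuple (V v) | basis_of fullv B &
   (0 < v <= M)%N ->
   U v = (<<take (alpha v) B>>%VS, <<take (beta v) B>>%VS)}.
  case vM: (0 < v <= M)%N; last by exists (vbasis fullv); rewrite ?vbasisP.
  have /and3P[/eqP d1 /eqP d2 sU] := UF v vM.
  pose B1 := vbasis (U v).1; pose B2 := vbasis ((U v).2 :\: (U v).1).
  pose B3 := vbasis (U v).2^C.
  have s12 : <<B1 ++ B2>>%VS = (U v).2.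
    rewrite span_cat !(span_basis (vbasisP _)).
    by rewrite -[RHS](addv_diff_cap (U v).2 (U v).1) (capv_idPr sU) addvC.
  have s123 : <<(B1 ++ B2) ++ B3>>%VS = fullv.
    by rewrite span_cat s12 (span_basis (vbasisP _)) addv_complf.
  have sz2 : size (B1 ++ B2) = beta v.
    rewrite size_cat !size_tuple -d2 -(dimv_cap_compl (U v).2 (U v).1).
    by rewrite (capv_idPr sU).
  have sz : size ((B1 ++ B2) ++ B3) == \dim {:V v}.
    by rewrite size_cat sz2 size_tuple -d2 dimv_compl subnKC // dimvS ?subvf.
  exists (Tuple sz) => [|_ /=].
    by rewrite basisEdim /= s123 subvv (eqP sz) leqnn.
  have T1 : take (alpha v) ((B1 ++ B2) ++ B3) = B1.
    by rewrite -catA take_size_cat // size_tuple d1.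
  have T2 : take (beta v) ((B1 ++ B2) ++ B3) = B1 ++ B2.
    by rewrite take_size_cat.
  by rewrite T1 T2 s12 (span_basis (vbasisP _)); case: (U v).
pose B := Bases (fun v => s2valP (bas v)).
have mvE v a : (a <= \dim {:V v})%N ->
    mkseq (moving_basis B 0 v) a = take a (s2val (bas v)).
  move=> an; apply: (@eq_from_nth _ 0) => [|k].
    by rewrite size_mkseq size_take_min size_tuple (minn_idPl an).
  rewrite size_mkseq => ka; rewrite nth_mkseq // nth_take //.
  rewrite /moving_basis big1 ?addr0 // => l _.
  by rewrite /slot_entry big1 ?scale0r // => b _; rewrite mxE.
exists B => v vM; rewrite /cell (s2valP' (bas v) vM).
have /and3P[/eqP d1 /eqP d2 _] := UF v vM.
by rewrite !mvE // -?d1 -?d2 dimvS ?subvf.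
Qed.

End FlagVarieties.

(** * The quiver

    Vertices are numbered [1 .. 2m+1].  A representation is given by the maps
    [phi_odd i] of the arrow [a_{2i-1} : s_{2i} -> s_{2i-1}] and [phi_even i]
    of the arrow [a_{2i} : s_{2i} -> s_{2i+1}], for [1 <= i <= m]; the
    components at other [i] carry no information. *)

Section SourceSinkQuiver.
Variables (K : fieldType) (V : nat -> vectType K) (m : nat).

Record rep : Type := Rep {
  phi_odd : forall i, 'Hom(V i.*2, V i.*2.-1);
  phi_even : forall i, 'Hom(V i.*2, V i.*2.+1) }.

Definition in_O_rpq (r p q : nat -> nat) (phi : rep) : Prop :=
  [/\ forall i, (1 <= i <= m)%N ->
        \dim (limg (phi_odd phi i)) = r i.*2.-1
        /\ \dim (limg (phi_even phi i)) = r i.*2,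
      forall i, (1 <= i <= m.-1)%N ->
        \dim (limg (phi_even phi i) + limg (phi_odd phi i.+1))%VS = p i
    & forall i, (1 <= i <= m)%N ->
        \dim (lker (phi_even phi i) :&: lker (phi_odd phi i))%VS = q i].

(** The fibre of [W] at [U], as a subspace of the space of representations:
    the summand [(V / A)^* (x) B] consists of the maps that vanish on [A] and
    have their image in [B]. *)
Definition in_W (U : flags V) (phi : rep) : Prop :=
  forall i, (1 <= i <= m)%N ->
    [/\ ((U i.*2).1 <= lker (phi_odd phi i))%VS,
        (limg (phi_odd phi i) <= (U i.*2.-1).1)%VS,
        ((U i.*2).2 <= lker (phi_even phi i))%VS
      & (i < m)%N -> (limg (phi_even phi i) <= (U i.*2.+1).2)%VS].

Definition lin_comb k (c : 'rV[K]_k) (e : 'I_k -> rep) (phi : rep) : Prop :=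
  forall i, (1 <= i <= m)%N ->
    phi_odd phi i = \sum_a c 0 a *: phi_odd (e a) i
    /\ phi_even phi i = \sum_a c 0 a *: phi_even (e a) i.

Definition is_basis_of (S : rep -> Prop) k (e : 'I_k -> rep) : Prop :=
  (forall a, S (e a))
  /\ forall phi, S phi -> exists! c : 'rV[K]_k, lin_comb c e phi.

Definition regular_rep N (f : 'rV[K]_N -> rep) : Prop :=
  forall i, (1 <= i <= m)%N -> forall u : V i.*2,
    (forall l : 'Hom(V i.*2.-1, K^o), regular_fun (fun x => l (phi_odd (f x) i u)))
    /\ (forall l : 'Hom(V i.*2.+1, K^o),
          regular_fun (fun x => l (phi_even (f x) i u))).

(** The variety [F], for [1 <= v <= 2m].  The factor [Gr(r_1, V_1)] is the
    variety of the flags [U_{1,1} <= V_1]. *)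
Variables (d r p q : nat -> nat).

Definition flag_rank1 (v : nat) : nat := if odd v then r v else q v./2.
Definition flag_rank2 (v : nat) : nat :=
  if odd v then (if v == 1%N then d v else p v./2) else (d v - r v)%N.

Let chart : bases V -> 'rV[K]_(dimF V m.*2 flag_rank1 flag_rank2) -> flags V :=
  @cell K V m.*2 flag_rank1 flag_rank2.
Let glue := @glueF K V m.*2 flag_rank1 flag_rank2.

Definition W_frame k (e : bases V -> 'rV[K]_(dimF V m.*2 flag_rank1 flag_rank2) ->
                          'I_k -> rep) : Prop :=
  forall B, (forall x, is_basis_of (in_W (chart B x)) (e B x))
            /\ forall a, regular_rep (fun x => e B x a).

Definition det_bundle k (e : bases V -> 'rV[K]_(dimF V m.*2 flag_rank1 flag_rank2) ->
                             'I_k -> rep) :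
    transition K (bases V) (dimF V m.*2 flag_rank1 flag_rank2) :=
  fun B B' x y c =>
    exists2 A : 'M[K]_k, (forall a, lin_comb (row a A) (e B x) (e B' y a))
                         & c = \det A.

(** [det W] is isomorphic to [K_F]. *)
Definition crepant : Prop :=
  exists k (e : bases V -> 'rV[K]_(dimF V m.*2 flag_rank1 flag_rank2) -> 'I_k -> rep),
    W_frame e
    /\ line_bundle_iso glue (det_bundle e) (canonical_bundle glue).

End SourceSinkQuiver.

(* Main.v *)
(** At a point common to two charts the two moving bases differ by an invertible
    matrix [T] that preserves the flags.  The tangent space of [F] and the fibre of
    [W] both have coordinates indexed by pairs [(s, t)] of positions in the moving
    bases, on which the change of chart acts by [X |-> T^-1 X T].  Once the diagonal
    blocks of [T] are triangularised, with eigenvalues [tau i], the transition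
    functions of [K_F] and of [det W] are both monomials in the [tau i], of
    exponents the differences of the numbers of pairs ending and starting at [i].
    If the difference of the two exponents only depends on the vertex of [i], the
    quotient of the transition functions is a product of powers of the
    determinants of [T] at the vertices, which is a coboundary.  Conversely, the
    exchange of two basis vectors in different blocks produces a projective line
    on which this quotient is [u ^ n] up to sign, [n] being the variation of the
    difference of the exponents; nowhere vanishing regular functions being
    constant, [n = 0].  Counting the pairs gives the numerical conditions. *)

From HB Require Import structures.
Require Import Defs.
From mathcomp Require Import all_boot all_order all_algebra all_fingroup.
From mathcomp Require Import mpoly complex reals ring zify.
Set Implicit Arguments.
Unset Strict Implicit.
Unset Printing Implicit Defensive.
Import Order.TTheory GRing.Theory Num.Theory.
Local Open Scope ring_scope.

(** * Determinants of tensor products on closed sets of indices *)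

(** Both bundles are given by relations: a frame of [W] is arbitrary, and a Jacobian may come from
    any rational expression of the change of chart. Exponents can be compared only once three points
    are settled: the determinant of a Jacobian does not depend on the expression; a Jacobian exists
    at every common point, for otherwise the isomorphism condition would be void there; and the
    determinant of a frame relative to a standard one is a constant on each chart, being regular and
    nowhere zero on an affine space. Derivatives are handled by restriction to lines, where
    vanishing at infinitely many points replaces continuity.

    The action on selected pairs of positions composes only if the pairs that are left out
    contribute zero. The closed index sets are those for which this holds for all block triangular
    matrices; the coordinates of [F] and those of [W] both form such sets.

    The vertex [2m+1] has no flag, but its basis also varies with the chart and enters [W]; it is
    treated as a vertex with a single block. *)

Lemma det_rank (K : comNzRingType) n (A : 'M[K]_n) (rho : 'I_n -> nat) :
  (forall i j, A i j != 0 -> i = j \/ (rho i < rho j)%N) ->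
  \det A = \prod_i A i i.
Proof.
move=> trA; rewrite /determinant (bigD1 1%g) //= odd_perm1 expr0 mul1r.
rewrite [X in _ + X]big1 ?addr0 => [|s s_neq1].
  by apply: eq_bigr => i _; rewrite perm1.
have [/forallP s_nz|] := boolP [forall i, A i (s i) != 0]; last first.
  case/forallPn => i; rewrite negbK => /eqP Ai0.
  by rewrite (bigD1 i) //= Ai0 mul0r mulr0.
have le_s i : (rho i <= rho (s i))%N.
  by case: (trA _ _ (s_nz i)) => [<-//|/ltnW].
have [i si] : exists i, s i != i.
  apply/existsP; apply: contraNT s_neq1 => /existsPn s1.
  by apply/eqP/permP => i; rewrite perm1; apply/eqP; have := s1 i; rewrite negbK.
have lt_i : (rho i < rho (s i))%N.
  by case: (trA _ _ (s_nz i)) => // e; rewrite -e eqxx in si.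
(* A permutation that meets only nonzero entries never lowers [rho] and, unless it is the identity,
   raises it somewhere; yet reindexing preserves the sum of [rho]. *)
have: (\sum_i rho i < \sum_i rho (s i))%N.
  rewrite (bigD1 i) //= [ltnRHS](bigD1 i) //= -addSn leq_add //.
  by apply: leq_sum => j _.
by rewrite [ltnLHS](reindex_inj (@perm_inj _ s)) ltnn.
Qed.

Lemma mulmx_nz (K : fieldType) m n q (A : 'M[K]_(m, n)) (B : 'M[K]_(n, q)) i j :
  (A *m B) i j != 0 ->
  exists2 k, A i k != 0 & B k j != 0.
Proof.
move=> nz; suff /existsP[k /andP[]]: [exists k, (A i k != 0) && (B k j != 0)].
  by move=> h1 h2; exists k.
apply: contraNT nz; move/existsPn => z0.
rewrite mxE big1 // => k _; have := z0 k; rewrite negb_and !negbK.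
by case/orP => /eqP->; rewrite ?mul0r ?mulr0.
Qed.

Lemma big_inj_codom (R : Type) (x : R) (op : Monoid.com_law x) (Y : finType) n
    (z : 'I_n -> Y) (F : Y -> R) : injective z ->
  \big[op/x]_(a < n) F (z a) = \big[op/x]_(y in codom z) F y.
Proof.
move=> z_inj; rewrite -big_uniq; first by rewrite big_image.
exact/injectiveP.
Qed.
Arguments big_inj_codom {R x op Y n z} F.

Section TensorDeterminants.
Variables (K : fieldType) (p : nat).

(** The matrices of [1 (x) T^T] and of [X |-> S X T] in the coordinates selected by [z]. *)
Definition one_sided (X : eqType) n (z : 'I_n -> X * 'I_p) (T : 'M[K]_p) :
  'M[K]_n := \matrix_(a, b) (((z a).1 == (z b).1)%:R * T (z b).2 (z a).2).

Definition two_sided n (z : 'I_n -> 'I_p * 'I_p) (S T : 'M[K]_p) : 'M[K]_n :=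
  \matrix_(a, b) (S (z a).1 (z b).1 * T (z b).2 (z a).2).

Definition swap_pair (u : 'I_p * 'I_p) := (u.2, u.1).

(** The entries of [T2 *m T1] are sums over all intermediate indices, the product on the right only
    sums over selected ones: the closure hypothesis kills the difference. The order is reversed
    because [one_sided] transposes. *)
Lemma one_sidedM (X : finType) n (z : 'I_n -> X * 'I_p) (T1 T2 : 'M[K]_p) :
    injective z ->
    (forall x t t', (x, t) \in codom z -> T1 t' t != 0 -> (x, t') \in codom z) ->
  one_sided z (T2 *m T1) = one_sided z T1 *m one_sided z T2.
Proof.
move=> z_inj cl; apply/matrixP => a c; rewrite !mxE.
pose F (y : X * 'I_p) := ((z a).1 == y.1)%:R * T1 y.2 (z a).2 *
  ((y.1 == (z c).1)%:R * T2 (z c).2 y.2).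
under [RHS]eq_bigr => b _ do rewrite !mxE -/(F (z b)).
rewrite (big_inj_codom F z_inj) [RHS]big_mkcond /=.
transitivity (\sum_(y : X * 'I_p) F y).
  rewrite -(pair_bigA _ (fun x t => F (x, t))) (bigD1 (z a).1) //=.
  rewrite [X in _ + X]big1 ?addr0 => [|x /negbTE nx]; last first.
    by rewrite big1 // => t _; rewrite /F /= eq_sym nx !mul0r.
  rewrite mulr_sumr; apply: eq_bigr => t _; rewrite /F eqxx /=; ring.
apply: eq_bigr => -[x t] _; case: ifPn => // nin; rewrite /F /=.
have [e|] := eqVneq (z a).1 x; last by rewrite !mul0r.
have [->|nz] := eqVneq (T1 t (z a).2) 0; first by rewrite mulr0 mul0r.
case/negP: nin; apply: cl nz; rewrite -e -surjective_pairing.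
exact: codom_f.
Qed.

Lemma one_sided1 (X : eqType) n (z : 'I_n -> X * 'I_p) :
  injective z -> one_sided z 1%:M = 1%:M.
Proof.
move=> z_inj; apply/matrixP => a b; rewrite !mxE.
rewrite -natrM mulnb; congr (_%:R); rewrite -(inj_eq z_inj) [in RHS]eq_sym.
case: (z a) (z b) => [? ?] [? ?]; rewrite xpair_eqE /=; congr (nat_of_bool (_ && _)).
by rewrite eq_sym.
Qed.

Lemma det_one_sided_rank (X : eqType) n (z : 'I_n -> X * 'I_p) (T : 'M[K]_p)
    (rho : 'I_p -> nat) : injective z ->
    (forall t t', T t' t != 0 -> t' = t \/ (rho t < rho t')%N) ->
  \det (one_sided z T) = \prod_a T (z a).2 (z a).2.
Proof.
move=> z_inj trT; rewrite (det_rank (rho := fun a => rho (z a).2)).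
  by apply: eq_bigr => a _; rewrite mxE eqxx mul1r.
move=> a b; rewrite mxE; have [e|] := eqVneq (z a).1; last by rewrite mul0r eqxx.
rewrite mul1r => /trT[e'|]; last by right.
by left; apply: z_inj; rewrite [z a]surjective_pairing e -e' -surjective_pairing.
Qed.

Lemma swap_pair_inj n (z : 'I_n -> 'I_p * 'I_p) :
  injective z -> injective (swap_pair \o z).
Proof.
move=> z_inj a b [e1 e2]; apply: z_inj.
by rewrite [z a]surjective_pairing e1 e2 -surjective_pairing.
Qed.

Lemma codom_swap n (z : 'I_n -> 'I_p * 'I_p) s t :
  ((s, t) \in codom (swap_pair \o z)) = ((t, s) \in codom z).
Proof.
apply/codomP/codomP => -[a e]; exists a; last by rewrite /= -e.
by case: e => -> ->; rewrite -surjective_pairing.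
Qed.

(** A left multiplication becomes one-sided once the members of each pair are exchanged. The
    intermediate pair only has its first member replaced, hence a closure condition on [S]. *)
Lemma two_sidedE n (z : 'I_n -> 'I_p * 'I_p) (S T : 'M[K]_p) : injective z ->
    (forall s s' t, (s, t) \in codom z -> S s s' != 0 -> (s', t) \in codom z) ->
  two_sided z S T = one_sided (swap_pair \o z) S^T *m one_sided z T.
Proof.
move=> z_inj cl; apply/matrixP => a c; rewrite !mxE /=.
pose F (y : 'I_p * 'I_p) := ((z a).2 == y.2)%:R * S (z a).1 y.1 *
  ((y.1 == (z c).1)%:R * T (z c).2 y.2).
under [RHS]eq_bigr => b _ do rewrite !mxE /= -/(F (z b)).
rewrite (big_inj_codom F z_inj) [RHS]big_mkcond /=.
transitivity (\sum_(y : 'I_p * 'I_p) F y).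
  rewrite (bigD1 ((z c).1, (z a).2)) //= big1 ?addr0 => [|[s t]].
    by rewrite /F /= !eqxx !mul1r.
  rewrite xpair_eqE negb_and /F /= => /orP[/negbTE->|/negbTE nt].
    by rewrite mul0r mulr0.
  by rewrite eq_sym nt !mul0r.
apply: eq_bigr => -[s t] _; case: ifPn => // nin; rewrite /F /=.
have [e|] := eqVneq (z a).2 t; last by rewrite !mul0r.
have [->|nz] := eqVneq (S (z a).1 s) 0; first by rewrite mulr0 mul0r.
case/negP: nin; apply: cl nz; rewrite -e -surjective_pairing.
exact: codom_f.
Qed.

End TensorDeterminants.
Arguments swap_pair {p} u.

(** * Block triangular matrices and the sets of pairs stable under them *)

Section Parabolic.
Variables (K : fieldType) (p : nat) (vtx blk : 'I_p -> nat).

(** The rows are the images of the basis vectors: preserving the flags means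
    being block lower triangular at every vertex. *)
Definition parabolic (A : 'M[K]_p) :=
  forall i j, A i j != 0 -> vtx i = vtx j /\ (blk j <= blk i)%N.

Definition levi (A : 'M[K]_p) :=
  forall i j, A i j != 0 -> vtx i = vtx j /\ blk i = blk j.

Lemma levi_parabolic A : levi A -> parabolic A.
Proof. by move=> lA i j /lA[-> ->]. Qed.

Lemma parabolicM A B : parabolic A -> parabolic B -> parabolic (A *m B).
Proof.
move=> pA pB i j /mulmx_nz[k /pA[e1 l1] /pB[e2 l2]].
by rewrite e1 e2; split=> //; apply: leq_trans l1.
Qed.

(** Lowering the block of the first member and raising that of the second are exactly the moves made
    by the nonzero coefficients of [X |-> S X T] for parabolic [S] and [T]. *)
Definition closed_index n (z : 'I_n -> 'I_p * 'I_p) :=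
  forall s t s' t', (s, t) \in codom z -> vtx s = vtx s' -> vtx t = vtx t' ->
    (blk s' <= blk s)%N -> (blk t <= blk t')%N -> (s', t') \in codom z.

End Parabolic.

Section ClosedIndexSets.
Variables (K : numClosedFieldType) (p : nat) (vtx blk : 'I_p -> nat).
Local Notation parabolic := (@parabolic K p vtx blk).
Local Notation levi := (@levi K p vtx blk).
Local Notation closed_index := (@closed_index p vtx blk).

(** Each diagonal block of [T] is triangularised by a Schur decomposition of its own, so that [g]
    and [g'] mix only positions of one vertex and one block and the conjugate remains parabolic.
    Ranking by block, then inside the block, makes the whole conjugate triangular. *)
Lemma levi_triangularization (T : 'M[K]_p) : parabolic T ->
  exists (g g' : 'M[K]_p) (rho : 'I_p -> nat),
    [/\ g *m g' = 1%:M, levi g, levi g'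
      & forall i j, (g *m T *m g') i j != 0 -> i = j \/ (rho j < rho i)%N].
Proof.
move=> pT.
pose cls i := [set j | (vtx j == vtx i) && (blk j == blk i)].
have clsP i j : (cls i == cls j) = (vtx i == vtx j) && (blk i == blk j).
  apply/eqP/andP => [e|[/eqP e1 /eqP e2]]; last by apply/setP => k; rewrite !inE e1 e2.
  have: i \in cls i by rewrite inE !eqxx.
  by rewrite e inE => /andP.
pose A c := [set i | cls i == c].
pose io c : 'M[K]_(#|A c|, p) := \matrix_(a, i) (enum_val a == i)%:R.
have ioA c a i : io c a i != 0 -> cls i = c.
  rewrite mxE; have [<- _|] := eqVneq (enum_val a) i; last by rewrite eqxx.
  by have := enum_valP a; rewrite inE => /eqP.
have io_id c : io c *m (io c)^T = 1%:M.
  apply/matrixP => a b; rewrite !mxE (bigD1 (enum_val a)) //= !mxE eqxx mul1r.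
  rewrite big1 ?addr0 => [|i ni]; last by rewrite !mxE eq_sym (negbTE ni) mul0r.
  by rewrite (inj_eq enum_val_inj) eq_sym.
have io_orth c d : c != d -> io c *m (io d)^T = 0.
  move=> cd; apply/matrixP => a b; rewrite [RHS]mxE; apply/eqP.
  by apply: contraNT cd => /mulmx_nz[k /ioA <-]; rewrite mxE => /ioA->.
have io_cover : \sum_c (io c)^T *m io c = 1%:M.
  apply/matrixP => i j; rewrite summxE (bigD1 (cls i)) //=.
  rewrite [X in _ + X]big1 ?addr0 => [|c nc]; last first.
    apply/eqP; apply: contraNT nc => /mulmx_nz[k].
    by rewrite mxE => /ioA->.
  have iA : i \in A (cls i) by rewrite inE.
  rewrite !mxE (bigD1 (enum_rank_in iA i)) //= !mxE enum_rankK_in // eqxx mul1r.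
  rewrite big1 ?addr0 // => a na; rewrite !mxE.
  have [e|] := eqVneq (enum_val a) i; last by rewrite mul0r.
  by case/eqP: na; have := enum_valK_in iA a; rewrite e.
have /fin_all_exists[P P_] c : exists P : 'M[K]_#|A c|,
    P \in unitmx /\ is_trig_mx (P *m (io c *m T *m (io c)^T) *m invmx P).
  (* The Schur decomposition wants a positive size; a class without positions receives the
     identity. *)
  have [e|n0] := posnP #|A c|.
    exists 1%:M; rewrite unitmx1; split=> //; apply/is_trig_mxP => i.
    by have := ltn_ord i; rewrite [X in (_ < X)%N]e.
  have [P /unitarymx_unit Pu tr] := Schur (io c *m T *m (io c)^T) n0.
  by exists P; split=> //; rewrite -conjumx.
pose g := \sum_c (io c)^T *m P c *m io c.
pose g' := \sum_c (io c)^T *m invmx (P c) *m io c.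
have io_sum c Q : io c *m (\sum_d (io d)^T *m Q d *m io d) = Q c *m io c.
  rewrite mulmx_sumr (bigD1 c) //= !mulmxA io_id mul1mx big1 ?addr0 // => d nd.
  by rewrite !mulmxA io_orth ?mul0mx // eq_sym.
have g'_io c : g' *m (io c)^T = (io c)^T *m invmx (P c).
  rewrite mulmx_suml (bigD1 c) //= -!mulmxA io_id mulmx1 big1 ?addr0 // => d nd.
  by rewrite -!mulmxA io_orth ?mulmx0.
have io_levi Q : levi (\sum_c (io c)^T *m Q c *m io c).
  move=> i j; rewrite summxE => nz.
  have [c] : exists c, ((io c)^T *m Q c *m io c) i j != 0.
    apply/existsP; apply: contraNT nz; move/existsPn => z0.
    by rewrite big1 // => c _; apply/eqP; have := z0 c; rewrite negbK.
  case/mulmx_nz => a /mulmx_nz[b]; rewrite mxE => /ioA ci _ /ioA cj.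
  by move/eqP: ci; rewrite -cj clsP => /andP[/eqP-> /eqP->].
have gg' : g *m g' = 1%:M.
  rewrite -[RHS]io_cover mulmx_suml; apply: eq_bigr => c _.
  by rewrite -!mulmxA io_sum (mulmxA (P c)) mulmxV ?(P_ c).1 // mul1mx.
(* A lexicographic rank: the factor [p.+1] exceeds every index inside a class. *)
exists g, g', (fun i => (blk i * p.+1 + index i (enum (A (cls i))))%N); split=> //;
  try exact: io_levi.
move=> i j nz.
have pg : parabolic (g *m T *m g').
  by apply: parabolicM; [apply: parabolicM|] => //; exact/levi_parabolic/io_levi.
have [ev lb] := pg i j nz.
have ix k : (index k (enum (A (cls k))) < p.+1)%N.
  apply: (leq_ltn_trans (index_size _ _)); rewrite -cardE ltnS.
  by apply: leq_trans (max_card _) _; rewrite card_ord.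
have [eb|nb] := eqVneq (blk i) (blk j); last first.
  right; have {}lb : (blk j < blk i)%N by rewrite ltn_neqAle eq_sym nb.
  apply: (@leq_trans ((blk j).+1 * p.+1)).
    by rewrite mulSn addnC ltn_add2r.
  by apply: leq_trans (leq_addr _ _); rewrite leq_mul2r lb orbT.
have /eqP ec : cls i == cls j by rewrite clsP ev eb !eqxx.
have iA : i \in A (cls i) by rewrite inE.
have jA : j \in A (cls i) by rewrite inE ec.
have pick k : k \in A (cls i) -> exists a : 'I_#|A (cls i)|, enum_val a = k.
  by move=> kA; exists (enum_rank_in kA k); rewrite enum_rankK_in.
have [a ai] := pick i iA; have [b bj] := pick j jA.
have: (io (cls i) *m (g *m T *m g') *m (io (cls i))^T) a b != 0.
  rewrite mxE (bigD1 j) //= big1 ?addr0 => [|k nk]; last first.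
    by rewrite [X in _ * X]mxE [X in _ * X]mxE bj eq_sym (negbTE nk) mulr0.
  rewrite mulf_neq0 //; last by rewrite !mxE bj eqxx oner_neq0.
  rewrite mxE (bigD1 i) //= big1 ?addr0 => [|k nk]; last first.
    by rewrite [X in X * _]mxE ai eq_sym (negbTE nk) mul0r.
  by rewrite mulf_neq0 // !mxE ai eqxx oner_neq0.
rewrite !mulmxA io_sum -!mulmxA g'_io !mulmxA.
have [_ /is_trig_mxP tr] := P_ (cls i); rewrite -!mulmxA in tr.
have [ab|ba|/ord_inj ab _] := ltngtP a b; last first.
- by left; rewrite -ai -bj ab.
- right; rewrite eb ltn_add2l -ec.
  have ie (q : 'I_#|A (cls i)|) : index (enum_val q) (enum (A (cls i))) = q.
    by rewrite (enum_val_nth i) index_uniq ?enum_uniq // -cardE.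
  by have := ie a; have := ie b; rewrite ai bj => -> ->.
by rewrite -!mulmxA tr // eqxx.
Qed.

(** The triangular shape is known for [T] only. The determinant of the left multiplication by [S] is
    therefore obtained as the inverse of that of the left multiplication by [T]. *)
Lemma det_two_sided_rank n (z : 'I_n -> 'I_p * 'I_p) (S T : 'M[K]_p)
    (rho : 'I_p -> nat) : injective z -> closed_index z ->
    parabolic S -> parabolic T -> S *m T = 1%:M ->
    (forall i j, T i j != 0 -> i = j \/ (rho j < rho i)%N) ->
  \det (two_sided z S T) = \prod_(u in codom z) (T u.2 u.2 / T u.1 u.1).
Proof.
move=> z_inj z_cl pS pT ST trT; have zs_inj := swap_pair_inj z_inj.
rewrite two_sidedE // => [|s s' t st /pS[e l]]; last exact: z_cl st _ _ _ _.
rewrite det_mulmx (det_one_sided_rank (rho := rho) z_inj) => [|t t' /trT //].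
have trT' : \det (one_sided (swap_pair \o z) T^T) = \prod_a T (z a).1 (z a).1.
  rewrite -det_tr (det_rank (rho := fun a => rho (z a).1)).
    by apply: eq_bigr => a _; rewrite !mxE eqxx mul1r.
  move=> a b; rewrite !mxE /=; have [e|] := eqVneq (z b).2; last by rewrite mul0r eqxx.
  rewrite mul1r => /trT[e'|].
    by left; apply: z_inj; rewrite [z a]surjective_pairing -e -e' -surjective_pairing.
  by right.
have [uS uT] := mulmx1_unit ST.
have detS : \det (one_sided (swap_pair \o z) S^T) *
    \det (one_sided (swap_pair \o z) T^T) = 1.
  rewrite -det_mulmx -one_sidedM //.
    by rewrite -trmx_mul ST trmx1 one_sided1 // det1.
  move=> t s s'; rewrite !codom_swap mxE => st /pS[e l].
  exact: z_cl st _ _ _ _.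
have T_nz i : T i i != 0.
  suff : \prod_i T i i != 0 by move/prodf_neq0; apply.
  rewrite (eq_bigr (fun i => T^T i i)) => [|j _]; last by rewrite mxE.
  rewrite -(det_rank (rho := rho)) ?det_tr -?unitfE -?unitmxE // => j k.
  by rewrite mxE => /trT[]; [left|right].
rewrite -(big_inj_codom (fun u => T u.2 u.2 / T u.1 u.1) z_inj) big_split /= mulrC.
congr (_ * _); rewrite prodfV -trT'.
apply: (mulIf (x := \det (one_sided (swap_pair \o z) T^T))).
  by rewrite trT'; apply/prodf_neq0.
by rewrite detS mulVf // trT'; apply/prodf_neq0.
Qed.

(** The family [tau] is read on a triangular conjugate of [T] before any set of pairs is chosen, and
    the conjugating matrices contribute mutually inverse determinants. So a single [tau] serves for
    the canonical bundle, for [W] and for the determinants at the vertices. *)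
Lemma det_two_sided (S T : 'M[K]_p) :
    parabolic S -> parabolic T -> S *m T = 1%:M ->
  exists tau : 'I_p -> K,
   [/\ forall i, tau i != 0,
       forall n (z : 'I_n -> 'I_p * 'I_p), injective z -> closed_index z ->
         \det (two_sided z S T) = \prod_(u in codom z) (tau u.2 / tau u.1)
     & forall (X : finType) n (z : 'I_n -> X * 'I_p), injective z ->
         (forall x t t', (x, t) \in codom z -> vtx t = vtx t' -> (x, t') \in codom z) ->
         \det (one_sided z T) = \prod_(u in codom z) tau u.2].
Proof.
move=> pS pT ST; have [g [g' [rho [gg' lg lg' trT]]]] := levi_triangularization pT.
have g'g := mulmx1C gg'; have TS := mulmx1C ST.
have [pg pg'] := (levi_parabolic lg, levi_parabolic lg').
pose T1 := g *m T *m g'; pose S1 := g *m S *m g'.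
have pT1 : parabolic T1 := parabolicM (parabolicM pg pT) pg'.
have pS1 : parabolic S1 := parabolicM (parabolicM pg pS) pg'.
have ST1 : S1 *m T1 = 1%:M.
  rewrite /S1 /T1 -!mulmxA (mulmxA g') g'g mul1mx (mulmxA S) ST mul1mx.
  exact: gg'.
exists (fun i => T1 i i); split=> [i|n z z_inj z_cl|X n z z_inj z_cl].
- suff : \prod_i T1 i i != 0 by move/prodf_neq0; apply.
  rewrite (eq_bigr (fun i => T1^T i i)) => [|j _]; last by rewrite [RHS]mxE.
  have [_ uT] := mulmx1_unit ST1.
  rewrite -(det_rank (rho := rho)) ?det_tr -?unitfE -?unitmxE // => j k.
  by rewrite [in X in X -> _]mxE => /trT[]; [left|right].
- rewrite -(det_two_sided_rank z_inj z_cl pS1 pT1 ST1 trT).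
  have cl A : parabolic A -> forall x t t', (x, t) \in codom z -> A t' t != 0 ->
      (x, t') \in codom z.
    by move=> pA x t t' xt /pA[e l]; apply: z_cl xt _ _ _ l.
  have cl' A : parabolic A -> forall x t t', (x, t) \in codom (swap_pair \o z) ->
      A^T t' t != 0 -> (x, t') \in codom (swap_pair \o z).
    move=> pA x t t' xt; rewrite mxE => /pA[e l]; rewrite !codom_swap in xt *.
    exact: z_cl xt _ _ _ _.
  have cl2 A : parabolic A ->
      forall s s' t, (s, t) \in codom z -> A s s' != 0 -> (s', t) \in codom z.
    by move=> pA s s' t st /pA[e l]; apply: z_cl st _ _ _ _.
  have zs_inj := swap_pair_inj z_inj.
  rewrite !two_sidedE //; try exact: cl2.
  rewrite !det_mulmx; congr (_ * _).
    rewrite /S1 !trmx_mul !one_sidedM //; try exact: cl'; last first.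
      by rewrite -trmx_mul; exact/cl'/parabolicM.
    rewrite !det_mulmx mulrAC -det_mulmx -one_sidedM //; last exact: cl'.
    by rewrite -trmx_mul gg' trmx1 one_sided1 // det1 mul1r.
  rewrite /T1 !one_sidedM //; try exact: cl.
  rewrite !det_mulmx mulrCA -det_mulmx -one_sidedM //; last exact: cl.
  by rewrite gg' one_sided1 // det1 mulr1.
have cl A : parabolic A -> forall x t t', (x, t) \in codom z -> A t' t != 0 ->
    (x, t') \in codom z.
  by move=> pA x t t' xt /pA[e l]; apply: z_cl xt _.
rewrite -(big_inj_codom (fun u => T1 u.2 u.2) z_inj).
rewrite -(det_one_sided_rank (rho := rho) z_inj) => [|t t' /trT //].
rewrite /T1 !one_sidedM //; try exact: cl.
rewrite !det_mulmx mulrCA -det_mulmx -one_sidedM //; last exact: cl.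
by rewrite gg' one_sided1 // det1 mulr1.
Qed.

End ClosedIndexSets.

(** * Moving bases *)

Section Positions.
Variables (K : fieldType) (V : nat -> vectType K) (M : nat).
Variables alpha beta : nat -> nat.
Hypothesis le_ab : forall v, (0 < v <= M)%N -> (alpha v <= beta v)%N.

(** The last vertex [M.+1] carries no flag, only a basis. *)
Definition pos : seq (nat * nat) :=
  [seq (v, k) | v <- iota 1 M.+1, k <- iota 0 (\dim {:V v})].
Definition npos := size pos.
Definition vtx (i : 'I_npos) := (nth (0, 0)%N pos i).1.
Definition loc (i : 'I_npos) := (nth (0, 0)%N pos i).2.
(** Block 0 spans the smaller subspace of the flag, block 1 completes it to the larger one, block 2
    completes that to the whole space. *)
Definition blk (i : 'I_npos) : nat :=
  if (vtx i <= M)%N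
  then ((alpha (vtx i) <= loc i) + (beta (vtx i) <= loc i))%N else 0%N.

Lemma pos_uniq : uniq pos.
Proof.
apply: allpairs_uniq_dep => [|v _|u u' _ _ e]; rewrite ?iota_uniq //.
by case: u u' e => v k [v' k'] /= [-> ->].
Qed.

Lemma mem_pos v k : ((v, k) \in pos) = (0 < v <= M.+1)%N && (k < \dim {:V v})%N.
Proof.
apply/allpairsPdep/andP => [[v' [k' []]]|[v_le k_lt]].
  by rewrite !mem_iota add1n ltnS => v_le /= k_lt [-> ->].
by exists v, k; rewrite !mem_iota add1n ltnS.
Qed.

Lemma nth_pos (i : 'I_npos) : nth (0, 0)%N pos i = (vtx i, loc i).
Proof. by rewrite /vtx /loc -surjective_pairing. Qed.

Lemma vtx_bound i : (0 < vtx i <= M.+1)%N.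
Proof.
by have := mem_nth (0, 0)%N (ltn_ord i); rewrite nth_pos mem_pos => /andP[].
Qed.

Lemma loc_lt i : (loc i < \dim {:V (vtx i)})%N.
Proof.
by have := mem_nth (0, 0)%N (ltn_ord i); rewrite nth_pos mem_pos => /andP[].
Qed.

Lemma pos_inj i j : vtx i = vtx j -> loc i = loc j -> i = j.
Proof.
move=> ev el; apply/val_inj/eqP.
by rewrite -(nth_uniq (0, 0)%N _ _ pos_uniq) ?ltn_ord // !nth_pos ev el.
Qed.

Lemma pos_ex v k : (0 < v <= M.+1)%N -> (k < \dim {:V v})%N ->
  exists2 i, vtx i = v & loc i = k.
Proof.
move=> v_le k_lt; have vk : (v, k) \in pos by rewrite mem_pos v_le k_lt.
have lt : (index (v, k) pos < npos)%N by rewrite index_mem.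
by exists (Ordinal lt); rewrite /vtx /loc nth_index.
Qed.

Lemma big_pos (R : Type) (x : R) (op : Monoid.com_law x) w (Q : pred nat)
    (F : nat -> R) : (0 < w <= M.+1)%N ->
  \big[op/x]_(i | (vtx i == w) && Q (loc i)) F (loc i) =
  \big[op/x]_(0 <= l < \dim {:V w} | Q l) F l.
Proof.
move=> w_le.
transitivity (\big[op/x]_(u <- pos | (u.1 == w) && Q u.2) F u.2).
  by rewrite [RHS](big_nth (0, 0)%N) big_mkord.
rewrite -big_filter_cond.
rewrite (perm_big [seq (w, l) | l <- iota 0 (\dim {:V w})]).
  by rewrite big_map /index_iota subn0.
apply: uniq_perm; first by rewrite filter_uniq ?pos_uniq.
  by rewrite map_inj_uniq ?iota_uniq // => k k' [].
move=> [v k]; rewrite mem_filter mem_pos /=.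
apply/andP/mapP => [[/eqP-> /andP[_ k_lt]]|[k' + [-> ->]]].
  by exists k; rewrite ?mem_iota.
by rewrite mem_iota /= add0n => ->; rewrite eqxx w_le.
Qed.

Lemma slots_uniq : uniq (slots V M alpha beta).
Proof.
rewrite filter_uniq //; apply: allpairs_uniq_dep => [|u _|u u' _ _ e].
- apply: allpairs_uniq_dep => [|v _|u u' _ _ e]; rewrite ?iota_uniq //.
  by case: u u' e => v k [v' k'] /= [-> ->].
- exact: iota_uniq.
by case: u u' e => v k [v' k'] /= [-> ->].
Qed.

Lemma mem_slots v k l : ((v, k, l) \in slots V M alpha beta) =
  [&& (0 < v <= M)%N, (k < \dim {:V v})%N, (l < \dim {:V v})%N
    & (k < alpha v <= l)%N || (k < beta v <= l)%N].
Proof.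
rewrite mem_filter /= andbC; apply/andP/and4P => [[]|[v_le k_lt l_lt kl]].
  case/allpairsPdep => -[v' k'] [l' [vk l_lt [-> -> ->]]]; move: vk l_lt.
  case/allpairsPdep => v'' [k'' [v_lt k_lt [-> ->]]]; move: v_lt k_lt.
  by rewrite !mem_iota !add0n add1n ltnS /= => -> -> -> ->.
split=> //; apply/allpairsPdep; exists (v, k), l; split=> //=; last by rewrite mem_iota.
by apply/allpairsPdep; exists v, k; rewrite !mem_iota add1n ltnS.
Qed.

Local Notation N := (dimF V M alpha beta).
Local Notation slot_of u := (vtx u.1, loc u.1, loc u.2).

Lemma slot_pos_ex (a : 'I_N) : exists u : 'I_npos * 'I_npos,
  (nth (0, 0, 0)%N (slots V M alpha beta) a == slot_of u) && (vtx u.1 == vtx u.2).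
Proof.
have : nth (0, 0, 0)%N (slots V M alpha beta) a \in slots V M alpha beta.
  by rewrite mem_nth.
case: (nth _ _ _) => -[v k] l; rewrite mem_slots => /and4P[/andP[v0 vM] kv lv _].
have v_le : (0 < v <= M.+1)%N by rewrite v0 leqW.
have [[i iv ik] [j jv jl]] := (pos_ex v_le kv, pos_ex v_le lv).
by exists (i, j); rewrite /= iv ik jv jl !eqxx.
Qed.

Definition slot_pos a := sval (sigW (slot_pos_ex a)).

Lemma slot_posE (a : 'I_N) :
  nth (0, 0, 0)%N (slots V M alpha beta) a = slot_of (slot_pos a).
Proof. by rewrite /slot_pos; case: sigW => u /= /andP[/eqP]. Qed.

Lemma slot_pos_vtx a : vtx (slot_pos a).1 = vtx (slot_pos a).2.
Proof. by rewrite /slot_pos; case: sigW => u /= /andP[_ /eqP]. Qed.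

Lemma slot_pos_inj : injective slot_pos.
Proof.
move=> a b e; apply/val_inj/eqP.
by rewrite -(nth_uniq (0, 0, 0)%N _ _ slots_uniq) ?ltn_ord // !slot_posE e.
Qed.

Lemma blk_le2 i : (blk i <= 2)%N.
Proof. by rewrite /blk; case: ifP => // _; rewrite (@leq_add _ _ 1 1) ?leq_b1. Qed.

Lemma blkE i : (vtx i <= M)%N ->
  blk i = ((alpha (vtx i) <= loc i) + (beta (vtx i) <= loc i))%N.
Proof. by rewrite /blk => ->. Qed.

Lemma blk_last i : (M < vtx i)%N -> blk i = 0%N.
Proof. by rewrite ltnNge /blk => /negbTE->. Qed.

Lemma blk_ltE i j : vtx i = vtx j -> (blk i < blk j)%N =
  (vtx i <= M)%N && ((loc i < alpha (vtx i) <= loc j)%N ||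
                    (loc i < beta (vtx i) <= loc j)%N).
Proof.
move=> e; rewrite /blk -e; case: ifPn => //= vM.
have /le_ab : (0 < vtx i <= M)%N by rewrite vM andbT; case/andP: (vtx_bound i).
by lia.
Qed.

(** A tangent vector of a flag variety moves each piece of the flag towards later pieces, so a
    coordinate amounts to two positions at one vertex in strictly increasing blocks. In this form
    the index set is visibly closed. *)
Lemma mem_codom_slot_pos i j : ((i, j) \in codom slot_pos) =
  (vtx i == vtx j) && (blk i < blk j)%N.
Proof.
apply/codomP/andP => [[a e]|[/eqP ev]].
  have ev := slot_pos_vtx a; have sa := slot_posE a; rewrite -e /= in ev sa.
  rewrite ev eqxx; split=> //; rewrite blk_ltE //.
  have : nth (0, 0, 0)%N (slots V M alpha beta) a \in slots V M alpha beta.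
    by rewrite mem_nth.
  by rewrite sa mem_slots => /and4P[/andP[_ ->] _ _ ->].
rewrite blk_ltE // => /andP[vM kl].
have s : (vtx i, loc i, loc j) \in slots V M alpha beta.
  rewrite mem_slots kl vM loc_lt ev loc_lt !andbT -ev.
  by case/andP: (vtx_bound i).
have lt : (index (vtx i, loc i, loc j) (slots V M alpha beta) < N)%N.
  by rewrite index_mem.
exists (Ordinal lt); have := slot_posE (Ordinal lt); rewrite nth_index //= => -[e1 e2 e3].
have := slot_pos_vtx (Ordinal lt); case: (slot_pos _) e1 e2 e3 => i' j' /= e1 e2 e3 e4.
by congr pair; apply: pos_inj; rewrite // -?e4 -?e1 -?ev.
Qed.

Lemma slot_pos_closed : closed_index vtx blk slot_pos.
Proof.
move=> s t s' t'; rewrite !mem_codom_slot_pos => /andP[/eqP e lt] es et ls lt'.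
by rewrite -es -et e eqxx /= (leq_ltn_trans ls) // (leq_trans lt).
Qed.

Definition nmx (x : 'rV[K]_N) : 'M[K]_npos :=
  \sum_a x 0 a *: delta_mx (slot_pos a).1 (slot_pos a).2.

Lemma nmx_slot x a : nmx x (slot_pos a).1 (slot_pos a).2 = x 0 a.
Proof.
rewrite summxE (bigD1 a) //= !mxE !eqxx mulr1 big1 ?addr0 // => b nb.
rewrite !mxE -xpair_eqE -!surjective_pairing (inj_eq slot_pos_inj).
by rewrite eq_sym (negbTE nb) mulr0.
Qed.

Lemma nmx_delta a : nmx (delta_mx 0 a) = delta_mx (slot_pos a).1 (slot_pos a).2.
Proof.
rewrite /nmx (bigD1 a) //= mxE !eqxx scale1r big1 ?addr0 // => c nc.
by rewrite mxE (negbTE nc) andbF scale0r.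
Qed.

Lemma nmx_nz x i j : nmx x i j != 0 -> vtx i = vtx j /\ (blk i < blk j)%N.
Proof.
move=> nz; suff : (vtx i == vtx j) && (blk i < blk j)%N by case/andP => /eqP.
rewrite -mem_codom_slot_pos; apply: contraNT nz => nin; rewrite summxE big1 // => a _.
rewrite !mxE -xpair_eqE -surjective_pairing; case: eqP => [e|]; rewrite ?mulr0 //.
by case/negP: nin; rewrite e codom_f.
Qed.

Lemma nmxE x i j : vtx i = vtx j -> nmx x i j = slot_entry x (vtx i, loc i, loc j).
Proof.
move=> e; rewrite summxE /slot_entry [RHS]big_mkcond /=.
apply: eq_bigr => a _; rewrite !mxE -xpair_eqE -surjective_pairing slot_posE.
have := slot_pos_vtx a; case: (slot_pos a) => i' j' /= e'.
rewrite !xpair_eqE.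
case: eqVneq e => [->|ni] e /=; last first.
  rewrite mulr0; case: ifP => // /andP[/andP[/eqP e1 /eqP e2] _].
  by case/eqP: ni; apply: pos_inj.
rewrite !eqxx /=; case: eqVneq => [->|nj]; first by rewrite eqxx mulr1.
rewrite mulr0; case: ifP => // /eqP e1.
by case/eqP: nj; apply: pos_inj; rewrite // -e -e'.
Qed.

Lemma nmxD x y : nmx (x + y) = nmx x + nmx y.
Proof. by rewrite -big_split; apply: eq_bigr => a _; rewrite mxE scalerDl. Qed.

Lemma nmxZ c x : nmx (c *: x) = c *: nmx x.
Proof. by rewrite scaler_sumr; apply: eq_bigr => a _; rewrite mxE scalerA. Qed.

Lemma nmx3 x y z : nmx x *m nmx y *m nmx z = 0.
Proof.
apply/matrixP => i j; rewrite [RHS]mxE; apply/eqP.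
apply/negPn/negP => /mulmx_nz[k /mulmx_nz[l /nmx_nz[_ h1] /nmx_nz[_ h2]] /nmx_nz[_ h3]].
suff : (2 < 2)%N by []; apply: leq_trans (blk_le2 j).
by rewrite (leq_ltn_trans _ h3) // (leq_ltn_trans _ h2) // (leq_ltn_trans _ h1).
Qed.

End Positions.
Arguments big_pos {K V M R x op w} Q F _.

Section MovingBases.
Variables (K : fieldType) (V : nat -> vectType K) (M : nat).
Variables alpha beta : nat -> nat.
Hypothesis le_ab : forall v, (0 < v <= M)%N -> (alpha v <= beta v)%N.
Hypothesis le_bn : forall v, (0 < v <= M)%N -> (beta v <= \dim {:V v})%N.

Local Notation N := (dimF V M alpha beta).
Local Notation npos := (npos V M).
Local Notation nmx := (@nmx K V M alpha beta).
Local Notation blk := (@blk K V M alpha beta).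
Local Notation moving := (@moving_basis K V M alpha beta).

Let nmx_nz := @nmx_nz K V M alpha beta le_ab.
Let nmx3 := @nmx3 K V M alpha beta le_ab.
Let blk_ltE := @blk_ltE K V M alpha beta le_ab.

Definition mmx (x : 'rV[K]_N) : 'M[K]_npos := 1%:M + nmx x.
(** The geometric series for the inverse of [mmx x]. It stops at the square because [nmx x] raises
    the block and there are three blocks. *)
Definition wmx (x : 'rV[K]_N) : 'M[K]_npos := 1%:M - nmx x + nmx x *m nmx x.

Lemma mmxK x : mmx x *m wmx x = 1%:M.
Proof.
rewrite /mmx /wmx mulmxDl mul1mx !mulmxDr mulmx1 mulmxN mulmxA nmx3 addr0.
by rewrite addrACA subrK subrr addr0.
Qed.

Lemma wmxK x : wmx x *m mmx x = 1%:M.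
Proof. exact/mulmx1C/mmxK. Qed.

Lemma mmx_nz x i j : mmx x i j != 0 -> vtx i = vtx j /\ (blk i <= blk j)%N.
Proof.
rewrite !mxE; have [->|_] := eqVneq i j; first by [].
by rewrite add0r => /nmx_nz[-> /ltnW].
Qed.

Lemma wmx_nz x i j : wmx x i j != 0 ->
  i = j \/ vtx i = vtx j /\ (blk i < blk j)%N.
Proof.
rewrite mxE; have [->|nz _] := eqVneq ((nmx x *m nmx x) i j) 0.
  rewrite addr0 !mxE; have [->|_] := eqVneq i j; first by left.
  by rewrite add0r oppr_eq0 => /nmx_nz; right.
right; case/mulmx_nz: nz => k /nmx_nz[-> l1] /nmx_nz[-> l2]; split=> //.
exact: ltn_trans l2.
Qed.

Lemma wmx_diag (y : 'rV_N) i : wmx y i i = 1.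
Proof.
rewrite mxE [X in X + _]mxE mxE eqxx mxE.
have -> : nmx y i i = 0.
  by apply: contraTeq isT => /nmx_nz[_]; rewrite ltnn.
rewrite subr0; have -> : (nmx y *m nmx y) i i = 0; last by rewrite addr0.
apply: contraTeq isT => /mulmx_nz[k /nmx_nz[_ l1] /nmx_nz[_ l2]].
by have := ltn_trans l1 l2; rewrite ltnn.
Qed.

(** The index is a natural number, with value zero out of range: positions at varying vertices can
    then be used without ordinals whose bound depends on the vertex. *)
Definition coordn (B : bases V) w l (u : V w) : K :=
  \sum_(j < \dim {:V w} | j == l :> nat) coord (B w) j u.

Fact coordn_is_scalar B w l : scalar (coordn B l : V w -> K).
Proof.
move=> c u v; rewrite /coordn mulr_sumr -big_split.
by apply: eq_bigr => j _; rewrite linearP.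
Qed.
HB.instance Definition _ B w l :=
  GRing.isLinear.Build K (V w) K *%R (coordn B l : V w -> K) (coordn_is_scalar B l).

Lemma coordn_basis (B : bases V) w k l : (k < \dim {:V w})%N ->
  coordn B l (B w)`_k = (k == l)%:R.
Proof.
move=> kn; have e j := coord_free (Ordinal kn) j (basis_free (basis_atP B w)).
rewrite /coordn big_mkcond (bigD1 (Ordinal kn)) //= e eqxx big1 ?addr0 => [|j nj].
  by case: ifP.
by rewrite e [_ == j]eq_sym (negbTE nj); case: ifP.
Qed.

Lemma coordn_sum (B : bases V) w (u : V w) : (0 < w <= M.+1)%N ->
  u = \sum_(i : 'I_npos | vtx i == w) coordn B (loc i) u *: (B w)`_(loc i).
Proof.
move=> w_le; under eq_bigl => i do rewrite -[vtx i == w]andbT.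
rewrite (big_pos xpredT (fun l => coordn B l u *: (B w)`_l)) // big_mkord.
rewrite {1}(coord_basis (basis_atP B w) (memvf u)); apply: eq_bigr => j _.
by rewrite /coordn (big_pred1 j).
Qed.

Definition gmx (B B' : bases V) : 'M[K]_npos := \matrix_(i, j)
  if vtx i == vtx j then coordn B' (loc j) (B (vtx i))`_(loc i) else 0.

Lemma gmxE (B B' : bases V) w i j : vtx i = w -> vtx j = w ->
  gmx B B' i j = coordn B' (loc j) (B w)`_(loc i).
Proof. by move=> <- e; rewrite mxE e eqxx. Qed.

Lemma gmx_vtx B B' i j : gmx B B' i j != 0 -> vtx i = vtx j.
Proof. by rewrite mxE; case: ifP => [/eqP //|]; rewrite eqxx. Qed.

Lemma gmx1 B : gmx B B = 1%:M.
Proof.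
apply/matrixP => i j; rewrite !mxE; case: ifP => [/eqP e|ne].
  rewrite coordn_basis ?loc_lt //; congr (_%:R); congr nat_of_bool.
  by apply/eqP/eqP => [|->//]; exact: pos_inj.
by case: eqP => // e; rewrite e eqxx in ne.
Qed.

Lemma basis_gmx (B B' : bases V) w (i : 'I_npos) : vtx i = w ->
  (B w)`_(loc i) = \sum_(j | vtx j == w) gmx B B' i j *: (B' w)`_(loc j).
Proof.
move=> iw; rewrite {1}(coordn_sum B' (B w)`_(loc i)); last first.
  by rewrite -iw vtx_bound.
by apply: eq_bigr => j /eqP jw; rewrite (gmxE _ _ iw).
Qed.

Lemma gmxM B B' B'' : gmx B B' *m gmx B' B'' = gmx B B''.
Proof.
apply/matrixP => i j; rewrite mxE.
have [e|ne] := eqVneq (vtx i) (vtx j); last first.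
  rewrite [RHS]mxE (negbTE ne) big1 // => k _; rewrite mxE.
  case: eqP => [e|]; rewrite ?mul0r // [X in _ * X]mxE -e (negbTE ne) mulr0 //.
rewrite (gmxE _ _ e (erefl _)) (basis_gmx B B' e) linear_sum /=.
rewrite [RHS]big_mkcond; apply: eq_bigr => k _.
case: eqP => [ek|nk]; last by rewrite [X in X * _]mxE e; case: eqP nk => [->|]; rewrite ?mul0r.
by rewrite linearZ /= (gmxE B' B'' ek).
Qed.

Lemma movingE (B : bases V) x w i : vtx i = w ->
  moving B x w (loc i) = \sum_(j | vtx j == w) mmx x i j *: (B w)`_(loc j).
Proof.
move=> iw; rewrite /moving_basis.
have w_le : (0 < w <= M.+1)%N by rewrite -iw vtx_bound.
under [RHS]eq_bigr => j _ do rewrite mxE scalerDl.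
rewrite big_split /= (bigD1 i) ?iw //= mxE eqxx scale1r [X in _ = _ + X + _]big1 ?addr0.
  congr (_ + _); under [RHS]eq_bigr => j /eqP jw do rewrite nmxE ?iw ?jw //.
  under [RHS]eq_bigl => j do rewrite -[vtx j == w]andbT.
  by rewrite (big_pos xpredT (fun l => slot_entry x (w, loc i, l) *: (B w)`_l)) // big_mkord.
by move=> j /andP[_ nj]; rewrite mxE eq_sym (negbTE nj) scale0r.
Qed.

Definition mcoord (B : bases V) x w (j : 'I_npos) (u : V w) : K :=
  \sum_(i | vtx i == w) coordn B (loc i) u * wmx x i j.

Fact mcoord_is_scalar B x w j : scalar (mcoord B x j : V w -> K).
Proof.
move=> c u v; rewrite /mcoord mulr_sumr -big_split.
by apply: eq_bigr => i _; rewrite linearP mulrDl mulrA.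
Qed.
HB.instance Definition _ B x w j :=
  GRing.isLinear.Build K (V w) K *%R (mcoord B x j : V w -> K) (mcoord_is_scalar B x j).

(** Row [i] holds the coordinates of a vector of the first moving basis in the second one, so
    changes of chart compose from left to right. *)
Definition trans B x B' y : 'M[K]_npos := mmx x *m gmx B B' *m wmx y.

Lemma trans_vtx (B : bases V) x (B' : bases V) y i j : trans B x B' y i j != 0 -> vtx i = vtx j.
Proof.
case/mulmx_nz => k /mulmx_nz[l /mmx_nz[-> _] /gmx_vtx->].
by case/wmx_nz => [->|[]].
Qed.

Lemma trans1 (B : bases V) x : trans B x B x = 1%:M.
Proof. by rewrite /trans gmx1 mulmx1 mmxK. Qed.

Lemma transM (B : bases V) x (B' : bases V) y B'' z :
  trans B x B' y *m trans B' y B'' z = trans B x B'' z.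
Proof.
rewrite /trans !mulmxA -(mulmxA _ (wmx y)) wmxK mulmx1.
by rewrite -(mulmxA (mmx x)) gmxM.
Qed.

Lemma mcoord_moving (B : bases V) x (B' : bases V) y w i j : vtx i = w -> vtx j = w ->
  mcoord B' y j (moving B x w (loc i)) = trans B x B' y i j.
Proof.
move=> iw jw; rewrite /mcoord movingE // /trans mxE [LHS]big_mkcond /=.
apply: eq_bigr => k _; case: eqVneq => kw; last first.
  have [->|] := eqVneq (wmx y k j) 0; first by rewrite mulr0.
  case/wmx_nz => [e|[e _]]; first by rewrite e jw eqxx in kw.
  by rewrite e jw eqxx in kw.
congr (_ * _); rewrite mxE linear_sum /= [LHS]big_mkcond /=.
apply: eq_bigr => l _; case: eqVneq => lw; last first.
  have [->|/mmx_nz[e _]] := eqVneq (mmx x i l) 0; first by rewrite mul0r.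
  by rewrite -e iw eqxx in lw.
by rewrite linearZ /= (gmxE B B' lw kw).
Qed.

Lemma wmx_vtx x i j : wmx x i j != 0 -> vtx i = vtx j.
Proof. by case/wmx_nz => [->|[]]. Qed.

Lemma basis_moving (B : bases V) x w i : vtx i = w ->
  (B w)`_(loc i) = \sum_(j | vtx j == w) wmx x i j *: moving B x w (loc j).
Proof.
move=> iw; under eq_bigr => j /eqP jw do rewrite movingE // scaler_sumr.
rewrite exchange_big /= (bigD1 i) ?iw //= [X in _ + X]big1 ?addr0.
  rewrite -[LHS]scale1r; under eq_bigr do rewrite scalerA; rewrite -scaler_suml.
  congr (_ *: _); transitivity ((wmx x *m mmx x) i i); first by rewrite wmxK mxE eqxx.
  rewrite mxE [RHS]big_mkcond; apply: eq_bigr => j _; case: eqVneq => // jw.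
  have [->|/wmx_vtx e] := eqVneq (wmx x i j) 0; first by rewrite mul0r.
  by rewrite -e iw eqxx in jw.
move=> k /andP[kw nk]; under eq_bigr do rewrite scalerA; rewrite -scaler_suml.
rewrite -[RHS](scale0r (B w)`_(loc k)); congr (_ *: _).
transitivity ((wmx x *m mmx x) i k); last by rewrite wmxK mxE eq_sym (negbTE nk).
rewrite mxE [LHS]big_mkcond; apply: eq_bigr => j _; case: eqVneq => // jw.
have [->|/wmx_vtx e] := eqVneq (wmx x i j) 0; first by rewrite mul0r.
by rewrite -e iw eqxx in jw.
Qed.

Lemma mcoord_sum (B : bases V) x w (u : V w) : (0 < w <= M.+1)%N ->
  u = \sum_(j | vtx j == w) mcoord B x j u *: moving B x w (loc j).
Proof.
move=> w_le; rewrite {1}(coordn_sum B u w_le).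
under eq_bigr => i /eqP iw do rewrite (basis_moving B x iw) scaler_sumr.
rewrite exchange_big; apply: eq_bigr => j _ /=.
by rewrite /mcoord scaler_suml; apply: eq_bigr => i _; rewrite scalerA.
Qed.

Lemma moving_trans (B : bases V) x (B' : bases V) y w i : vtx i = w ->
  moving B x w (loc i) =
  \sum_(j | vtx j == w) trans B x B' y i j *: moving B' y w (loc j).
Proof.
move=> iw; have w_le : (0 < w <= M.+1)%N by rewrite -iw vtx_bound.
rewrite {1}(mcoord_sum B' y (moving B x w (loc i)) w_le).
by apply: eq_bigr => j /eqP jw; rewrite (mcoord_moving B x B' y iw jw).
Qed.

Lemma mcoord_inj (B : bases V) x w (u v : V w) : (0 < w <= M.+1)%N ->
  (forall j, vtx j = w -> mcoord B x j u = mcoord B x j v) -> u = v.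
Proof.
move=> w_le e; rewrite (mcoord_sum B x u w_le) (mcoord_sum B x v w_le).
by apply: eq_bigr => j /eqP jw; rewrite e.
Qed.

Lemma mem_span_moving (B : bases V) x w a (u : V w) : (0 < w <= M.+1)%N ->
    (a <= \dim {:V w})%N ->
  u \in <<mkseq (moving B x w) a>>%VS <->
  (forall j, vtx j = w -> (a <= loc j)%N -> mcoord B x j u = 0).
Proof.
move=> w_le a_le; split=> [u_in j jw aj|u0].
  suff sub : (<<mkseq (moving B x w) a>> <= lker (linfun (mcoord B x j : V w -> K^o)))%VS.
    by have := subvP sub _ u_in; rewrite memv_ker lfunE => /eqP.
  apply/span_subvP => v /mapP[k]; rewrite mem_iota /= add0n => k_lt ->.
  have [i iw ik] := pos_ex w_le (leq_trans k_lt a_le).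
  rewrite memv_ker lfunE /= -ik mcoord_moving // trans1 mxE.
  have [e|_] := eqVneq i j; last by [].
  by rewrite -ik e ltnNge aj in k_lt.
rewrite (mcoord_sum B x u w_le); apply: rpred_sum => j /eqP jw.
have [aj|ja] := leqP a (loc j); first by rewrite u0 // scale0r rpred0.
apply/rpredZ/memv_span/mapP; exists (loc j) => //.
by rewrite mem_iota.
Qed.

Lemma blk_spec i : (0 < vtx i <= M)%N ->
  ((alpha (vtx i) <= loc i)%N = (0 < blk i)%N) *
  ((beta (vtx i) <= loc i)%N = (1 < blk i)%N).
Proof.
move=> iM; have := le_ab iM; case/andP: iM => _ iM; rewrite /blk iM.
by split; lia.
Qed.

Lemma dim_cell (B : bases V) (x : 'rV_N) w : (0 < w <= M)%N ->
  \dim (cell B x w).1 = alpha w /\ \dim (cell B x w).2 = beta w.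
Proof.
move=> wM; have ab v : (0 < v <= M)%N -> (alpha v <= beta v <= \dim {:V v})%N.
  by move=> vM; rewrite le_ab ?le_bn.
by have /and3P[/eqP-> /eqP->] := cell_in_F B x ab wM.
Qed.

(** A vanishing upper block says that the leading vectors of one moving basis lie in the span of the
    leading vectors of the other. One inclusion is enough, the dimensions being equal. *)
Lemma glueP (B : bases V) x (B' : bases V) y :
  glueF B x B' y <-> parabolic (@vtx _ V M) blk (trans B x B' y).
Proof.
split=> [gl i j nz|pT w wM].
  have e := trans_vtx nz; split=> //; rewrite leqNgt; apply: contra nz => lt.
  have [iM kl] := andP (etrans (esym (blk_ltE e)) lt).
  have wM : (0 < vtx i <= M)%N by rewrite iM andbT; case/andP: (vtx_bound i).
  have w_le : (0 < vtx i <= M.+1)%N := vtx_bound i.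
  rewrite -(mcoord_moving _ _ _ _ (erefl _) (esym e)); apply/eqP.
  have [g1 g2] : cell B x (vtx i) = cell B' y (vtx i) by exact: gl.
  have b_le := le_bn wM; have a_le := leq_trans (le_ab wM) b_le.
  case/orP: kl => /andP[il jl].
    have := mem_span_moving B' y (moving B x (vtx i) (loc i)) w_le a_le.
    rewrite -g1 => -[+ _]; apply; rewrite // memv_span //.
    by apply/mapP; exists (loc i); rewrite ?mem_iota.
  have := mem_span_moving B' y (moving B x (vtx i) (loc i)) w_le b_le.
  rewrite -g2 => -[+ _]; apply; rewrite // memv_span //.
  by apply/mapP; exists (loc i); rewrite ?mem_iota.
have w_le : (0 < w <= M.+1)%N by case/andP: wM => -> /leqW.
have b_le := le_bn wM; have a_le := leq_trans (le_ab wM) b_le.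
have [d1 d2] := dim_cell B x wM; have [d1' d2'] := dim_cell B' y wM.
have sub c : (c <= \dim {:V w})%N -> (c == alpha w) || (c == beta w) ->
    (<<mkseq (moving B x w) c>> <= <<mkseq (moving B' y w) c>>)%VS.
  move=> c_le cE; apply/span_subvP => v /mapP[k]; rewrite mem_iota /= add0n => kc ->.
  have [i iw ik] := pos_ex w_le (leq_trans kc c_le).
  apply/mem_span_moving => // j jw cj; rewrite -ik (mcoord_moving _ _ _ _ iw jw).
  apply/eqP/negPn/negP => /pT[_]; rewrite leqNgt => /negP; apply.
  rewrite blk_ltE ?iw ?jw //; case/andP: wM => _ -> /=; rewrite ik.
  by case/orP: cE => /eqP <-; rewrite kc cj ?orbT.
apply: injective_projections; apply/eqP.
  by rewrite eqEdim d1 d1' leqnn andbT; apply: sub; rewrite ?eqxx.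
by rewrite eqEdim d2 d2' leqnn andbT; apply: sub; rewrite ?eqxx ?orbT.
Qed.

Lemma glue_sym (B : bases V) (x : 'rV_N) (B' : bases V) (y : 'rV_N) :
  glueF B x B' y -> glueF B' y B x.
Proof. by move=> gl v vM; rewrite gl. Qed.

End MovingBases.

(** * The canonical bundle *)

Lemma poly_eq0_numField (K : numFieldType) (p : {poly K}) :
  (forall t, p.[t] = 0) -> p = 0.
Proof.
move=> p0; apply/eqP; apply: contraT => nz.
have := @max_poly_roots _ p [seq n%:R | n <- iota 0 (size p)] nz.
rewrite size_map size_iota ltnn; apply.
  by apply/allP => t _; rewrite /root p0.
by rewrite map_inj_uniq ?iota_uniq //; exact: mulrIn (oner_neq0 K).
Qed.

(** The link between formal partial derivatives and derivatives in one variable. The property is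
    stable under sums and products, which reduces it to constants and variables. *)
Lemma mpoly_line (K : comNzRingType) N (x v : 'rV[K]_N) (P : {mpoly K[N]}) :
  exists p : {poly K}, (forall t, p.[t] = P.@[(x + t *: v) 0]) /\
    p^`().[0] = \sum_k (P^`M(k)).@[x 0] * v 0 k.
Proof.
pose L P := exists p : {poly K}, (forall t, p.[t] = P.@[(x + t *: v) 0]) /\
    p^`().[0] = \sum_k (P^`M(k)).@[x 0] * v 0 k.
rewrite -/(L P).
have LC c : L c%:MP.
  exists c%:P; split=> [t|]; first by rewrite hornerC mevalC.
  rewrite derivC horner0 big1 // => k _.
  by rewrite mderivC meval0 mul0r.
have LD P1 P2 : L P1 -> L P2 -> L (P1 + P2).
  move=> [p1 [e1 d1]] [p2 [e2 d2]]; exists (p1 + p2); split=> [t|].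
    by rewrite hornerD mevalD e1 e2.
  rewrite derivD hornerD d1 d2 -big_split; apply: eq_bigr => k _.
  by rewrite mderivD mevalD mulrDl.
have ev0 P1 (p1 : {poly K}) : (forall t, p1.[t] = P1.@[(x + t *: v) 0]) ->
    p1.[0] = P1.@[x 0].
  by move=> ->; rewrite scale0r addr0.
have LM P1 P2 : L P1 -> L P2 -> L (P1 * P2).
  move=> [p1 [e1 d1]] [p2 [e2 d2]]; exists (p1 * p2); split=> [t|].
    by rewrite hornerM mevalM e1 e2.
  rewrite derivM hornerD !hornerM d1 d2 (ev0 _ _ e1) (ev0 _ _ e2).
  rewrite mulr_suml mulr_sumr -big_split; apply: eq_bigr => k _ /=.
  by rewrite mderivM mevalD !mevalM; ring.
have LX i : L 'X_i.
  exists ((x 0 i)%:P + v 0 i *: 'X); split=> [t|].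
    by rewrite hornerD hornerC hornerZ hornerX mevalXU !mxE mulrC.
  rewrite derivD derivC add0r derivZ derivX hornerZ hornerC mulr1.
  rewrite (bigD1 i) //= big1 ?addr0 => [|k nk]; rewrite mderivX mnm1E.
    have ->: (U_(i) - U_(i))%MM = 0%MM by apply/mnmP => j; rewrite mnmBE subnn mnm0E.
    by rewrite eqxx scale1r mpolyX0 meval1 mul1r.
  by rewrite eq_sym (negbTE nk) scale0r meval0 mul0r.
rewrite (mpolyE P); apply: big_ind => [||m _]; first by rewrite -mpolyC0.
  exact: LD.
rewrite -mul_mpolyC; apply: (LM); first exact: LC.
rewrite mpolyXE_id; apply: (big_ind L) => [||i _]; first by rewrite -mpolyC1.
  exact: LM.
elim: (m i) => [|n IH]; first by rewrite expr0 -mpolyC1.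
by rewrite exprS; apply: LM.
Qed.

(** * Germs at the origin of rational functions of one variable *)

Section Germs.
Variable K : numFieldType.

(** Rational functions of one variable without pole at [0]. *)
Definition germ (F : K -> K) := exists p q : {poly K},
  q.[0] != 0 /\ forall t, q.[t] != 0 -> F t = p.[t] / q.[t].

Lemma germ_cst c : germ (fun=> c).
Proof.
by exists c%:P, 1; rewrite hornerC oner_neq0; split=> // t _; rewrite !hornerC divr1.
Qed.

Lemma germ_id : germ id.
Proof.
by exists 'X, 1; rewrite hornerC oner_neq0; split=> // t _; rewrite hornerX hornerC divr1.
Qed.

Lemma germ_div (p q : {poly K}) : q.[0] != 0 -> germ (fun t => p.[t] / q.[t]).
Proof. by move=> q0; exists p, q. Qed.

Lemma germD F G : germ F -> germ G -> germ (fun t => F t + G t).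
Proof.
move=> [p1 [q1 [n1 e1]]] [p2 [q2 [n2 e2]]]; exists (p1 * q2 + p2 * q1), (q1 * q2).
rewrite hornerM mulf_neq0 //; split=> // t; rewrite !(hornerD, hornerM) mulf_eq0 negb_or.
by case/andP => h1 h2; rewrite e1 // e2 // addf_div.
Qed.

Lemma germM F G : germ F -> germ G -> germ (fun t => F t * G t).
Proof.
move=> [p1 [q1 [n1 e1]]] [p2 [q2 [n2 e2]]]; exists (p1 * p2), (q1 * q2).
rewrite hornerM mulf_neq0 //; split=> // t; rewrite !hornerM mulf_eq0 negb_or.
by case/andP => h1 h2; rewrite e1 // e2 // mulf_div.
Qed.

Lemma germ_sum (I : Type) (r : seq I) (Q : pred I) (F : I -> K -> K) :
  (forall i, germ (F i)) -> germ (fun t => \sum_(i <- r | Q i) F i t).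
Proof.
move=> gF; elim: r => [|i r [p [q [n e]]]].
  have [p [q [n e]]] := germ_cst 0; exists p, q; split=> // t nt.
  by rewrite big_nil -e.
have : germ (fun t => (if Q i then F i t else 0) + \sum_(i <- r | Q i) F i t).
  apply: germD; last by exists p, q.
  by case: (Q i) => //; exact: germ_cst.
case=> p' [q' [n' e']]; exists p', q'; split=> // t nt.
by rewrite -e' // big_cons; case: ifP => // _; rewrite add0r.
Qed.

(** A substitute for continuity at 0: with [F = p / r] near 0, the polynomial [p * (r * q * 'X)]
    vanishes at every point of an infinite field. The factor [q] absorbs the finitely many
    parameters at which nothing is known of [F]. *)
Lemma germ0 F (q : {poly K}) : germ F -> q != 0 ->
  (forall t, t != 0 -> q.[t] != 0 -> F t = 0) -> F 0 = 0.
Proof.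
move=> [p [r [r0 e]]] q0 F0; rewrite e //.
suff -> : p = 0 by rewrite horner0 mul0r.
have rn0 : r != 0 by apply: contraNneq r0 => ->; rewrite horner0.
have : p * (r * q * 'X) = 0.
  apply: poly_eq0_numField => t; rewrite !hornerM hornerX.
  have [->|t0] := eqVneq t 0; first by rewrite !mulr0.
  have [->|qt] := eqVneq q.[t] 0; first by rewrite !(mulr0, mul0r).
  have [->|rt] := eqVneq r.[t] 0; first by rewrite !(mulr0, mul0r).
  have := F0 t t0 qt; rewrite e // => /eqP; rewrite mulf_eq0 invr_eq0 (negbTE rt) orbF.
  by move=> /eqP->; rewrite mul0r.
by move/eqP; rewrite !mulf_eq0 (negbTE rn0) (negbTE q0) polyX_eq0 !orbF => /eqP.
Qed.

Definition germ_mx m n (F : K -> 'M[K]_(m, n)) := forall i j, germ (fun t => F t i j).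

Lemma germ_ext F G : F =1 G -> germ F -> germ G.
Proof. by move=> e [p [q [n h]]]; exists p, q; split=> // t nt; rewrite -e h. Qed.

Lemma germ_mxM m n l (F : K -> 'M[K]_(m, n)) (G : K -> 'M[K]_(n, l)) :
  germ_mx F -> germ_mx G -> germ_mx (fun t => F t *m G t).
Proof.
move=> gF gG i j; apply: (@germ_ext (fun t => \sum_k F t i k * G t k j)).
  by move=> t; rewrite mxE.
by apply: germ_sum => k; apply: germM.
Qed.

Lemma germ_mxD m n (F G : K -> 'M[K]_(m, n)) :
  germ_mx F -> germ_mx G -> germ_mx (fun t => F t + G t).
Proof.
move=> gF gG i j; apply: (@germ_ext (fun t => F t i j + G t i j)).
  by move=> t; rewrite mxE.
exact: germD.
Qed.

Lemma germ_mxZ m n f (F : K -> 'M[K]_(m, n)) :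
  germ f -> germ_mx F -> germ_mx (fun t => f t *: F t).
Proof.
move=> gf gF i j; apply: (@germ_ext (fun t => f t * F t i j)).
  by move=> t; rewrite mxE.
exact: germM.
Qed.

Lemma germ_mx_cst m n (A : 'M[K]_(m, n)) : germ_mx (fun=> A).
Proof. by move=> i j; exact: germ_cst. Qed.

Lemma germ_mxN m n (F : K -> 'M[K]_(m, n)) :
  germ_mx F -> germ_mx (fun t => - F t).
Proof.
move=> gF i j; apply: (@germ_ext (fun t => -1 * F t i j)).
  by move=> t; rewrite mxE mulN1r.
by apply: germM => //; exact: germ_cst.
Qed.

End Germs.

Section TwoSidedProduct.
Variables (K : fieldType) (p : nat) (vtx blk : 'I_p -> nat).

(** The intermediate pair is reached from the row index through [S1] and [T1]; since these are
    parabolic, it does not leave the closed set. *)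
Lemma two_sidedM n (z : 'I_n -> 'I_p * 'I_p) (S1 T1 S2 T2 : 'M[K]_p) :
    injective z -> closed_index vtx blk z ->
    parabolic vtx blk S1 -> parabolic vtx blk T1 ->
  two_sided z (S1 *m S2) (T2 *m T1) = two_sided z S1 T1 *m two_sided z S2 T2.
Proof.
move=> z_inj z_cl pS pT; apply/matrixP => a c; rewrite !mxE.
pose F (y : 'I_p * 'I_p) := (S1 (z a).1 y.1 * S2 y.1 (z c).1) *
  (T2 (z c).2 y.2 * T1 y.2 (z a).2).
rewrite (eq_bigr (fun b => F (z b))) => [|b _]; last by rewrite !mxE /F; ring.
rewrite (big_inj_codom F z_inj) [RHS]big_mkcond /= big_distrlr /=.
rewrite (pair_bigA _ (fun s t => F (s, t))); apply: eq_bigr => -[s t] _ /=.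
case: ifPn => // nin; rewrite /F /=.
have [->|/pS[e1 l1]] := eqVneq (S1 (z a).1 s) 0; first by rewrite !mul0r.
have [->|/pT[e2 l2]] := eqVneq (T1 t (z a).2) 0; first by rewrite !mulr0.
case/negP: nin; apply: z_cl e1 (esym e2) l1 l2.
by rewrite -surjective_pairing codom_f.
Qed.

End TwoSidedProduct.

Section CanonicalBundle.
Variables (K : numFieldType) (V : nat -> vectType K) (M : nat).
Variables alpha beta : nat -> nat.
Hypothesis le_ab : forall v, (0 < v <= M)%N -> (alpha v <= beta v)%N.
Hypothesis le_bn : forall v, (0 < v <= M)%N -> (beta v <= \dim {:V v})%N.

Local Notation N := (dimF V M alpha beta).
Local Notation npos := (npos V M).
Local Notation vtx := (@vtx K V M).
Local Notation zpos := (@slot_pos K V M alpha beta).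
Local Notation blk := (@blk K V M alpha beta).
Implicit Types (B : bases V) (x y : 'rV[K]_N).

Let nmx_nz := @nmx_nz K V M alpha beta le_ab.
Let wmx_nz := @wmx_nz K V M alpha beta le_ab.
Let transM := @transM K V M alpha beta le_ab.
Let glueP := @glueP K V M alpha beta le_ab le_bn.
Let z_cl : closed_index vtx blk zpos := slot_pos_closed le_ab.
Let z_inj : injective zpos := @slot_pos_inj K V M alpha beta.

Lemma nmx_wmx_nz x y i j : (nmx x *m wmx y) i j != 0 ->
  vtx i = vtx j /\ (blk i < blk j)%N.
Proof.
case/mulmx_nz => k /nmx_nz[-> l1] /wmx_nz[<-//|[-> l2]].
by split=> //; apply: ltn_trans l2.
Qed.

Lemma trans_same B x y : trans B x B y = 1%:M + nmx (x - y) *m wmx y.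
Proof.
rewrite /trans gmx1 mulmx1 -(mmxK le_ab y) -mulmxDl; congr (_ *m _).
by rewrite /mmx -addrA -nmxD [y + _]addrC subrK.
Qed.

(** Inside one chart [trans] is the identity plus a strictly upper block part, while gluing forces
    it to be block lower triangular. This identifies the value at [x] of any rational expression of
    the change of chart. *)
Lemma glue_inj B x B' y y' : glueF B x B' y -> glueF B x B' y' -> y = y'.
Proof.
move=> gl gl'.
have := parabolicM ((glueP _ _ _ _).1 (glue_sym gl)) ((glueP _ _ _ _).1 gl').
rewrite transM trans_same => pT.
have d0 : nmx (y - y') = 0.
  rewrite -[LHS]mulmx1 -(wmxK le_ab y') mulmxA.
  suff -> : nmx (y - y') *m wmx y' = 0 by rewrite mul0mx.
  apply/matrixP => i j; rewrite [RHS]mxE; apply: contraTeq isT => nz.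
  have [_ lt] := nmx_wmx_nz nz; have := pT i j; rewrite mxE [X in X + _]mxE.
  have -> : (i == j) = false by apply: contraTF lt => /eqP->; rewrite ltnn.
  by rewrite add0r => /(_ nz)[_]; rewrite leqNgt lt.
apply/eqP; rewrite -subr_eq0; apply/eqP/rowP => a.
by rewrite -(nmx_slot (y - y')) d0 !mxE.
Qed.

Section JacobianLine.
Variables (B B' : bases V) (x v : 'rV[K]_N).
Variables (P : 'I_N -> {mpoly K[N]}) (Q : {mpoly K[N]}).
Hypothesis Qx : Q.@[x 0] != 0.
Hypothesis glueP_Q : forall x' : 'rV[K]_N, Q.@[x' 0] != 0 ->
  glueF B x' B' (\row_l ((P l).@[x' 0] / Q.@[x' 0])).

Let y0 : 'rV[K]_N := \row_l ((P l).@[x 0] / Q.@[x 0]).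
Let dy : 'rV[K]_N := \row_l \sum_k (((P l)^`M(k).@[x 0] * Q.@[x 0]
  - (P l).@[x 0] * Q^`M(k).@[x 0]) / Q.@[x 0] ^+ 2) * v 0 k.

(** With [S0 = T0^-1], the matrix [S0 *m trans B (x + t *: v) B' (yt t)] is
    parabolic and equals [1 + t *: D t], where [D] is a rational function of [t]:
    hence the upper blocks of [D 0] vanish, which is the claim. *)
Lemma jacobian_line i j : vtx i = vtx j -> (blk i < blk j)%N ->
  (trans B' y0 B x *m (nmx v *m wmx x) *m trans B x B' y0) i j =
  (nmx dy *m wmx y0) i j.
Proof.
move=> e lt.
have [q [qE dq]] := mpoly_line x v Q.
have ev0 (P1 : {mpoly K[N]}) (p1 : {poly K}) :
    (forall t, p1.[t] = P1.@[(x + t *: v) 0]) -> p1.[0] = P1.@[x 0].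
  by move=> ->; rewrite scale0r addr0.
have q0 := ev0 _ _ qE.
have q0n : q.[0] != 0 by rewrite q0.
have /fin_all_exists[p pE] l : exists p : {poly K},
    (forall t, p.[t] = (P l).@[(x + t *: v) 0]) /\
    p^`().[0] = \sum_k ((P l)^`M(k)).@[x 0] * v 0 k by exact: mpoly_line.
have p0 l := ev0 _ _ (pE l).1.
(* Division of the increment by [t]: the displacement from [y0] is [t] times a rational vector
   [wv t] without pole at 0, whose value there is [dy]. *)
have /fin_all_exists[w wE] l : exists w : {poly K},
    q.[0] *: p l - (p l).[0] *: q = w * 'X.
  have : root (q.[0] *: p l - (p l).[0] *: q) 0.
    by rewrite /root hornerD hornerN !hornerZ mulrC subrr.
  by case/factor_theorem => w; rewrite subr0; exists w.
have w0 l : (w l).[0] = q.[0] * (p l)^`().[0] - (p l).[0] * q^`().[0].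
  have := congr1 (fun r : {poly K} => r^`().[0]) (wE l).
  rewrite derivB !derivZ derivM derivX mulr1 !(hornerD, hornerN, hornerZ, hornerM).
  by rewrite hornerX mulr0 add0r.
pose wv t : 'rV[K]_N := \row_l ((w l).[t] / (q * q.[0]%:P).[t]).
pose yt t : 'rV[K]_N := y0 + t *: wv t.
have ytE t : q.[t] != 0 -> yt t = \row_l ((P l).@[(x + t *: v) 0] / Q.@[(x + t *: v) 0]).
  move=> qt; apply/rowP => l; rewrite !mxE -(pE l).1 -qE -p0 -q0 hornerM hornerC.
  have := congr1 (fun r : {poly K} => r.[t]) (wE l).
  rewrite !(hornerD, hornerN, hornerZ, hornerM) hornerX => wt.
  rewrite mulrA [t * _]mulrC -wt; field.
  by rewrite qt.
have wv0 : wv 0 = dy.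
  apply/rowP => l; rewrite !mxE hornerM hornerC w0 (pE l).2 dq p0 q0.
  move: Q.@[x 0] (P l).@[x 0] Qx => c b c0.
  rewrite !mulr_sumr -sumrB mulr_suml; apply: eq_bigr => k _; field.
  exact: c0.
pose S0 := trans B' y0 B x; pose T0 := trans B x B' y0.
pose A := S0 *m (nmx v *m wmx x) *m T0.
pose D t := A - nmx (wv t) *m wmx (yt t) - t *: (A *m (nmx (wv t) *m wmx (yt t))).
have Dij t : t != 0 -> q.[t] != 0 -> D t i j = 0.
  move=> t0 qt.
  have g0 : parabolic vtx blk S0 by apply/glueP/glue_sym/glueP_Q.
  have gt : parabolic vtx blk (trans B (x + t *: v) B' (yt t)).
    by rewrite ytE //; apply/glueP/glueP_Q; rewrite -qE.
  have := parabolicM g0 gt.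
  (* Passing through [(B, x)] and [(B', y0)] gives the factorisation [(1 + t A) (1 - t Y)], where
     [Y] is [nmx (wv t) *m wmx (yt t)]. *)
  have -> : S0 *m trans B (x + t *: v) B' (yt t) = 1%:M + t *: D t.
    rewrite -(transM B (x + t *: v) B x) -(transM B x B' y0) !trans_same.
    rewrite [x + _]addrC addrK opprD addrA subrr add0r -/T0.
    rewrite nmxZ -scaleNr nmxZ scaleNr -scalemxAl mulNmx -scalemxAl.
    set X := nmx v *m wmx x; set Y := nmx _ *m wmx (yt t).
    have ST : S0 *m T0 = 1%:M by rewrite transM trans1.
    rewrite (mulmxA S0) (mulmxA _ T0) [S0 *m _]mulmxDr mulmx1 [_ *m T0]mulmxDl ST.
    rewrite -scalemxAr -scalemxAl -/A /D -/X -/Y mulmxBr mulmx1 -scalemxAr.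
    rewrite mulmxDl mul1mx -scalemxAl !scalerBr !scalerDr opprD.
    by rewrite !addrA [_ *: (t *: _)]scalerA.
  move=> /(_ i j); rewrite mxE [X in X + _]mxE.
  have -> : (i == j) = false by apply: contraTF lt => /eqP->; rewrite ltnn.
  rewrite add0r mxE => h; apply: contraTeq lt => nz.
  by rewrite -leqNgt; case: h; rewrite ?mulf_neq0.
have germ_wv a : germ (fun t => wv t 0 a).
  apply: (germ_ext (F := fun t => (w a).[t] / (q * q.[0]%:P).[t])).
    by move=> t; rewrite mxE.
  by apply: germ_div; rewrite hornerM hornerC mulf_neq0.
have germ_nmx (f : K -> 'rV[K]_N) : (forall a, germ (fun t => f t 0 a)) ->
    germ_mx (fun t => nmx (f t)).
  move=> gf i' j'.
  apply: (germ_ext (F := fun t => \sum_a f t 0 a *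
      (delta_mx (zpos a).1 (zpos a).2 : 'M[K]_npos) i' j')).
    by move=> t; rewrite summxE; apply: eq_bigr => a _; rewrite !mxE.
  by apply: germ_sum => a; apply: germM => //; exact: germ_cst.
have germ_yt : germ_mx (fun t => nmx (yt t)).
  apply: germ_nmx => a; apply: (germ_ext (F := fun t => y0 0 a + t * wv t 0 a)).
    by move=> t; rewrite [RHS]mxE [X in _ = _ + X]mxE.
  by apply: germD; [exact: germ_cst|apply: germM => //; exact: germ_id].
have germ_nw : germ_mx (fun t => nmx (wv t) *m wmx (yt t)).
  apply: germ_mxM; first exact: germ_nmx.
  apply: germ_mxD; last exact: germ_mxM.
  by apply: germ_mxD; [exact: germ_mx_cst|exact: germ_mxN].
have gD : germ_mx D.
  apply: germ_mxD; first by apply: germ_mxD; [exact: germ_mx_cst|exact: germ_mxN].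
  apply: germ_mxN; apply: germ_mxZ; first exact: germ_id.
  by apply: germ_mxM => //; exact: germ_mx_cst.
have qn : q != 0 by apply: contraNneq q0n => ->; rewrite horner0.
have := germ0 (gD i j) qn Dij.
rewrite /D /yt !scale0r subr0 addr0 wv0 mxE [X in _ + X]mxE => /eqP.
by rewrite subr_eq0 => /eqP.
Qed.

End JacobianLine.

(** Applying [jacobian_line] to every coordinate direction determines [J] up to the matrices of the
    right multiplications by [wmx x] and [wmx y], which relate the coordinates of the cells to the
    moving bases. These are unipotent, so the determinant sees neither them nor the fractions from
    which [J] was computed. *)
Lemma det_jacobian B x B' y J : glueF B x B' y ->
    jacobian (@glueF K V M alpha beta) B B' x J ->
  \det J = \det (two_sided zpos (trans B' y B x) (trans B x B' y)).
Proof.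
move=> gl [P [Q [Qx glQ JE]]].
have ey := glue_inj gl (glQ x Qx).
have line v := @jacobian_line B B' x v P Q Qx glQ.
have det_w (u : 'rV[K]_N) : \det (two_sided zpos 1%:M (wmx u)) = 1.
  rewrite (_ : two_sided _ _ _ = one_sided zpos (wmx u)).
    (* The block increases along the nonzero entries of [wmx], whereas the rank has to decrease; 2
       is the largest block. *)
    rewrite (det_one_sided_rank (rho := fun t => (2 - blk t)%N) z_inj).
      by rewrite big1 // => a _; exact: (wmx_diag le_ab).
    move=> t t' /wmx_nz[->|[_ lt]]; [by left|right].
    by have := blk_le2 alpha beta t; lia.
  by apply/matrixP => a b; rewrite !mxE.
have pS := (glueP _ _ _ _).1 (glue_sym gl); have pT := (glueP _ _ _ _).1 gl.
suff : two_sided zpos 1%:M (wmx y) *m J =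
    two_sided zpos (trans B' y B x) (trans B x B' y) *m
    two_sided zpos 1%:M (wmx x).
  by move/(congr1 determinant); rewrite !det_mulmx !det_w mul1r mulr1.
rewrite -(two_sidedM _ _ z_inj z_cl pS pT) mulmx1; apply/matrixP => a b.
have /andP[/eqP e lt] : (vtx (zpos a).1 == vtx (zpos a).2) &&
    (blk (zpos a).1 < blk (zpos a).2)%N.
  by rewrite -(mem_codom_slot_pos le_ab) -surjective_pairing codom_f.
have := line (delta_mx 0 b) _ _ e lt; rewrite -ey.
have deltaE (A C : 'M[K]_npos) i j k l : (A *m delta_mx k l *m C) i j = A i k * C l j.
  rewrite mxE (bigD1 l) //= big1 ?addr0 => [|l' nl].
    congr (_ * _); rewrite mxE (bigD1 k) //= mxE !eqxx mulr1 big1 ?addr0 // => k' nk.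
    by rewrite mxE (negbTE nk) mulr0.
  rewrite mxE big1 ?mul0r // => k' _.
  by rewrite mxE (negbTE nl) andbF mulr0.
rewrite nmx_delta (mulmxA (trans _ _ _ _)) -(mulmxA _ (wmx x)) deltaE => lineE.
transitivity ((nmx (col b J)^T *m wmx y) (zpos a).1 (zpos a).2).
  rewrite /nmx mulmx_suml summxE mxE; apply: eq_bigr => c _.
  rewrite -scalemxAl [RHS]mxE -[delta_mx _ _]mul1mx deltaE [RHS]mulrC.
  by rewrite 2![X in _ = _ * X]mxE [two_sided _ _ _ _ _]mxE.
rewrite [RHS]mxE lineE; congr ((nmx _ *m _) _ _); apply/rowP => l.
rewrite !mxE JE (bigD1 b) //= big1 ?addr0 => [|k nk].
  by rewrite mxE !eqxx mulr1.
by rewrite mxE (negbTE nk) andbF mulr0.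
Qed.

End CanonicalBundle.

(** * Regular functions and matrices of regular functions on an affine chart *)

Section RegularFunctions.
Variables (K : fieldType) (N : nat).
Implicit Types f g : 'rV[K]_N -> K.

Lemma regular_ext f g : f =1 g -> regular_fun f -> regular_fun g.
Proof. by move=> e [P PE]; exists P => x; rewrite -e. Qed.

Lemma regular_cst c : regular_fun (fun _ : 'rV[K]_N => c).
Proof. by exists c%:MP => x; rewrite mevalC. Qed.

Lemma regular_coord a : regular_fun (fun x : 'rV[K]_N => x 0 a).
Proof. by exists 'X_a => x; rewrite mevalXU. Qed.

Lemma regularD f g : regular_fun f -> regular_fun g ->
  regular_fun (fun x => f x + g x).
Proof. by move=> [P PE] [Q QE]; exists (P + Q) => x; rewrite mevalD PE QE. Qed.

Lemma regularM f g : regular_fun f -> regular_fun g ->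
  regular_fun (fun x => f x * g x).
Proof. by move=> [P PE] [Q QE]; exists (P * Q) => x; rewrite mevalM PE QE. Qed.

Lemma regular_sum (I : finType) (A : pred I) (F : I -> 'rV[K]_N -> K) :
  (forall i, A i -> regular_fun (F i)) -> regular_fun (fun x => \sum_(i | A i) F i x).
Proof.
move=> rF; have /fin_all_exists[P PE] i : exists P : {mpoly K[N]},
    A i -> forall x, F i x = P.@[x 0].
  by have [/rF[P PE]|_] := boolP (A i); [exists P|exists 0].
exists (\sum_(i | A i) P i) => x; rewrite raddf_sum.
by apply: eq_bigr => i Ai; apply: PE.
Qed.

Lemma regular_prod (I : finType) (F : I -> 'rV[K]_N -> K) :
  (forall i, regular_fun (F i)) -> regular_fun (fun x => \prod_i F i x).
Proof.
move=> /fin_all_exists[P PE]; exists (\prod_i P i) => x.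
by rewrite rmorph_prod; apply: eq_bigr => i _; apply: PE.
Qed.

Definition regular_mx m n (A : 'rV[K]_N -> 'M[K]_(m, n)) :=
  forall i j, regular_fun (fun x => A x i j).

Lemma regular_mxM m n l (A : 'rV[K]_N -> 'M[K]_(m, n)) (B : 'rV[K]_N -> 'M[K]_(n, l)) :
  regular_mx A -> regular_mx B -> regular_mx (fun x => A x *m B x).
Proof.
move=> rA rB i j; apply: (@regular_ext (fun x => \sum_k A x i k * B x k j)).
  by move=> x; rewrite mxE.
by apply: regular_sum => k _; apply: regularM.
Qed.

Lemma regular_mxD m n (A B : 'rV[K]_N -> 'M[K]_(m, n)) :
  regular_mx A -> regular_mx B -> regular_mx (fun x => A x + B x).
Proof.
move=> rA rB i j; apply: (@regular_ext (fun x => A x i j + B x i j)).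
  by move=> x; rewrite mxE.
exact: regularD.
Qed.

Lemma regular_mxN m n (A : 'rV[K]_N -> 'M[K]_(m, n)) :
  regular_mx A -> regular_mx (fun x => - A x).
Proof.
move=> rA i j; apply: (@regular_ext (fun x => -1 * A x i j)).
  by move=> x; rewrite mxE mulN1r.
by apply: regularM => //; exact: regular_cst.
Qed.

Lemma regular_mx_cst m n (A : 'M[K]_(m, n)) : regular_mx (fun=> A).
Proof. by move=> i j; exact: regular_cst. Qed.

Lemma regular_det n (A : 'rV[K]_N -> 'M[K]_n) :
  regular_mx A -> regular_fun (fun x => \det (A x)).
Proof.
move=> rA; apply: regular_sum => s _; apply: regularM; first exact: regular_cst.
by apply: regular_prod => i.
Qed.

Lemma regular_adj n (A : 'rV[K]_N -> 'M[K]_n) :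
  regular_mx A -> regular_mx (fun x => \adj (A x)).
Proof.
move=> rA i j; apply: (@regular_ext (fun x => cofactor (A x) j i)).
  by move=> x; rewrite mxE.
apply: regularM; first exact: regular_cst.
apply: regular_det => k l; apply: (@regular_ext (fun x => A x (lift j k) (lift i l))).
  by move=> x; rewrite !mxE.
exact: rA.
Qed.

End RegularFunctions.

(** * Rational formulas for the changes of chart *)

Section JacobianExists.
Variables (K : fieldType) (V : nat -> vectType K) (M : nat).
Variables alpha beta : nat -> nat.
Hypothesis le_ab : forall v, (0 < v <= M)%N -> (alpha v <= beta v)%N.
Hypothesis le_bn : forall v, (0 < v <= M)%N -> (beta v <= \dim {:V v})%N.

Local Notation N := (dimF V M alpha beta).
Local Notation npos := (npos V M).
Local Notation vtx := (@vtx K V M).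
Local Notation zpos := (@slot_pos K V M alpha beta).
Local Notation blk := (@blk K V M alpha beta).
Implicit Types (B : bases V) (x y : 'rV[K]_N).

Let glueP := @glueP K V M alpha beta le_ab le_bn.

Lemma regular_nmx : regular_mx (fun x : 'rV[K]_N => nmx x).
Proof.
move=> i j; apply: (@regular_ext _ _ (fun x => \sum_a x 0 a *
    (delta_mx (zpos a).1 (zpos a).2 : 'M[K]_npos) i j)).
  by move=> x; rewrite summxE; apply: eq_bigr => a _; rewrite !mxE.
by apply: regular_sum => a _; apply: regularM; [exact: regular_coord|exact: regular_cst].
Qed.

Lemma regular_mmx : regular_mx (fun x : 'rV[K]_N => mmx x).
Proof. by apply: regular_mxD; [exact: regular_mx_cst|exact: regular_nmx]. Qed.

Lemma regular_wmx : regular_mx (fun x : 'rV[K]_N => wmx x).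
Proof.
apply: regular_mxD; last by apply: regular_mxM; exact: regular_nmx.
by apply: regular_mxD; [exact: regular_mx_cst|apply: regular_mxN; exact: regular_nmx].
Qed.

Let proj c : 'M[K]_npos := diag_mx (\row_i (blk i <= c)%:R).

Let projl c n (A : 'M[K]_(npos, n)) i j : (proj c *m A) i j = (blk i <= c)%:R * A i j.
Proof. by rewrite mul_diag_mx !mxE. Qed.

Let projr c n (A : 'M[K]_(n, npos)) i j : (A *m proj c) i j = A i j * (blk j <= c)%:R.
Proof. by rewrite mul_mx_diag !mxE. Qed.

Let proj_id c : proj c *m proj c = proj c.
Proof.
apply/matrixP => i j; rewrite projl !mxE.
by case: eqP => [->|]; rewrite ?mulr1n ?mulr0n ?mulr0 // -natrM mulnb andbb.
Qed.

Let proj_parabolic c (A : 'M[K]_npos) : parabolic vtx blk A ->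
  proj c *m A = proj c *m A *m proj c.
Proof.
move=> pA; apply/matrixP => i j; rewrite projr projl.
have [->|/pA[_ l]] := eqVneq (A i j) 0; first by rewrite mulr0 mul0r.
case: leqP => ic; last by rewrite !mul0r.
by rewrite (leq_trans l ic) mulr1.
Qed.

Let proj_upper c (A : 'M[K]_npos) :
    (forall i j, A i j != 0 -> (blk i <= blk j)%N) ->
  A *m proj c = proj c *m A *m proj c.
Proof.
move=> pA; apply/matrixP => i j; rewrite !projr projl.
have [->|/pA l] := eqVneq (A i j) 0; first by rewrite mulr0.
case: (leqP (blk j) c) => jc; last by rewrite !mulr0.
by rewrite (leq_trans l jc) mul1r.
Qed.

Let vdiag (A : 'M[K]_npos) := forall i j, A i j != 0 -> vtx i = vtx j.

Let vdiagM (A C : 'M[K]_npos) : vdiag A -> vdiag C -> vdiag (A *m C).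
Proof. by move=> vA vC i j /mulmx_nz[k /vA-> /vC]. Qed.

(** Being diagonal with respect to the vertices means commuting with the projector [F] on each
    vertex, a property inherited by the inverse. *)
Let vdiag_inv (A H : 'M[K]_npos) : H *m A = 1%:M -> vdiag A -> vdiag H.
Proof.
move=> HA vA i j nz; have AH := mulmx1C HA.
pose F : 'M[K]_npos := diag_mx (\row_k (vtx k == vtx j)%:R).
have FA : F *m A = A *m F.
  apply/matrixP => k l; rewrite mul_diag_mx mul_mx_diag !mxE.
  have [->|/vA->] := eqVneq (A k l) 0; first by rewrite mulr0 mul0r.
  by rewrite mulrC.
have FH : F *m H = H *m F.
  by rewrite -[F *m H]mul1mx -HA -!mulmxA (mulmxA A) -FA -mulmxA AH mulmx1.
have := congr1 (fun X : 'M[K]_npos => X i j) FH.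
rewrite mul_diag_mx mul_mx_diag !mxE eqxx mulr1.
by case: eqP => // _ /eqP; rewrite mul0r eq_sym (negbTE nz).
Qed.

Let C B B' x : 'M[K]_npos := mmx x *m gmx M B B'.
(** The submatrix of [C] on the blocks up to [c], completed by the identity: its adjugate then has
    the full size and needs no reindexing. *)
Let minor c B B' x : 'M[K]_npos := proj c *m C B B' x *m proj c + (1%:M - proj c).

Let vdiag_C B B' x : vdiag (C B B' x).
Proof. by apply: vdiagM => [i j /(mmx_nz le_ab)[]|i j /gmx_vtx]. Qed.

Let vdiag_proj c : vdiag (proj c).
Proof. by move=> i j; rewrite !mxE; have [->|_] := eqVneq i j; rewrite ?mulr0n ?eqxx. Qed.

Let vdiag_minor c B B' x : vdiag (minor c B B' x).
Proof.
move=> i j; rewrite mxE => nz.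
have [z|] := eqVneq ((proj c *m C B B' x *m proj c) i j) 0; last first.
  by apply: vdiagM => //; apply: vdiagM.
move: nz; rewrite z add0r !mxE; have [->//|_] := eqVneq i j.
by rewrite !mulr0n subr0 eqxx.
Qed.

(** At a common point [C] is a block lower triangular matrix times the block upper triangular
    [mmx y]. In such a factorisation the leading blocks are invertible, and [key] gives the inverse
    explicitly. *)
Let minor_unit c B x B' y : glueF B x B' y -> \det (minor c B B' x) != 0.
Proof.
move=> gl; have pT := (glueP _ _ _ _).1 gl.
pose T := trans B x B' y; pose S := trans B' y B x.
have CE : C B B' x = T *m mmx y by rewrite /T /trans -mulmxA (wmxK le_ab) mulmx1.
have TS : T *m S = 1%:M by rewrite (transM le_ab) (trans1 le_ab).
pose E := proj c; have EE : E *m E = E := proj_id c.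
have ET : E *m T *m E = E *m T by rewrite -proj_parabolic.
have WE : E *m wmx y *m E = wmx y *m E.
  by rewrite -proj_upper // => i j /(wmx_nz le_ab)[->//|[_ /ltnW]].
have MW := mmxK le_ab y.
move: (wmx y) (mmx y) MW CE WE => W X XW CE WE; move: T S TS CE ET => T S TS CE ET.
have key : minor c B B' x *m (E *m W *m E *m S *m E + (1%:M - E)) = 1%:M.
  have E1 : (1%:M - E) *m E = 0 by rewrite mulmxBl mul1mx EE subrr.
  have E2 : E *m (1%:M - E) = 0 by rewrite mulmxBr mulmx1 EE subrr.
  have E3 : (1%:M - E) *m (1%:M - E) = 1%:M - E.
    by rewrite [LHS]mulmxBr mulmx1 E1 subr0.
  rewrite /minor -/E CE; move: (1%:M - E) (subrK E 1%:M) E1 E2 E3 => F FE E1 E2 E3.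
  rewrite mulmxDl !mulmxDr E3 -[_ *m E *m F]mulmxA E2 mulmx0 addr0.
  rewrite [F *m (_ *m E)](_ : _ = 0); last by rewrite !mulmxA E1 !mul0mx.
  rewrite add0r (_ : _ *m (_ *m E) = E); first by rewrite addrC.
  rewrite WE -!mulmxA.
  rewrite (mulmxA E W) (mulmxA (E *m _) E) WE -(mulmxA W) (mulmxA X) XW mul1mx.
  by rewrite !mulmxA ET -(mulmxA E) TS mulmx1 EE.
by have [] := mulmx1_unit key; rewrite unitmxE unitfE.
Qed.

(** Cramer's rule: a row of block [c <= 1] of the new moving basis is a row of
    [minor c ^-1 *m proj c *m C]. *)
Lemma jacobian_exists B x B' y : glueF B x B' y ->
  exists J, jacobian (@glueF K V M alpha beta) B B' x J.
Proof.
move=> gl.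
have rC : regular_mx (C B B').
  by apply: regular_mxM; [exact: regular_mmx|exact: regular_mx_cst].
have rm c : regular_mx (minor c B B').
  apply: regular_mxD; last exact: regular_mx_cst.
  apply: regular_mxM; last exact: regular_mx_cst.
  by apply: regular_mxM => //; exact: regular_mx_cst.
have [D0 D0E] := regular_det (rm 0%N); have [D1 D1E] := regular_det (rm 1%N).
(* Rows of blocks 0 and 1 have different minors as denominators. The product is a common one, and
   the numerator of a row of block [c] takes the other minor, of index [1 - c], as a factor. *)
pose Q := D0 * D1.
have QE x' : Q.@[x' 0] = \det (minor 0 B B' x') * \det (minor 1 B B' x').
  by rewrite mevalM -D0E -D1E.
have rA c : regular_mx (fun x' => \adj (minor c B B' x') *m proj c *m C B B' x').
  apply: regular_mxM => //; apply: regular_mxM; last exact: regular_mx_cst.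
  exact: regular_adj.
have /fin_all_exists[P PE] a : exists P : {mpoly K[N]}, forall x',
    let c := blk (zpos a).1 in
    P.@[x' 0] = (\adj (minor c B B' x') *m proj c *m C B B' x') (zpos a).1 (zpos a).2 *
                \det (minor (1 - c) B B' x').
  have [P PE] := regularM (rA (blk (zpos a).1) (zpos a).1 (zpos a).2)
    (regular_det (rm (1 - blk (zpos a).1)%N)).
  by exists P => x' c; rewrite -PE.
exists (\matrix_(l, k) (((P l)^`M(k).@[x 0] * Q.@[x 0]
                   - (P l).@[x 0] * Q^`M(k).@[x 0]) / Q.@[x 0] ^+ 2)).
exists P, Q; split=> [|x' Qx'|l k]; last by rewrite mxE.
  by rewrite QE mulf_neq0 // (minor_unit _ gl).
apply/glue_sym/glueP; set y' := \row_l _.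
have := Qx'; rewrite QE mulf_eq0 negb_or => /andP[n0 n1].
have nc c : (c <= 1)%N -> \det (minor c B B' x') != 0 by case: c => [|[]].
pose H c := invmx (minor c B B' x').
have HE c : (c <= 1)%N -> H c = (\det (minor c B B' x'))^-1 *: \adj (minor c B B' x').
  by move=> /nc n; rewrite /H /invmx unitmxE unitfE n.
have Hm c : (c <= 1)%N -> H c *m minor c B B' x' = 1%:M.
  by move=> /nc n; rewrite /H mulVmx // unitmxE unitfE.
have row c i j : (c <= 1)%N -> blk i = c ->
    mmx y' i j = (H c *m proj c *m C B B' x') i j.
  move=> c1 ic.
  have vH : vdiag (H c *m proj c *m C B B' x').
    by apply: vdiagM => //; apply: vdiagM => //; apply: vdiag_inv (Hm _ c1) _.
  have [jc|jc] := leqP (blk j) c.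
    transitivity ((1%:M : 'M[K]_npos) i j).
      rewrite !mxE -[RHS]addr0; congr (_ + _).
      by apply: contraTeq jc => /(nmx_nz le_ab)[_]; rewrite -ltnNge ic.
    have HC : H c *m (proj c *m C B B' x' *m proj c) = proj c.
      have := congr1 (mulmx^~ (proj c)) (Hm _ c1); rewrite /= mul1mx -(mulmxA (H c)) /minor.
      rewrite mulmxDl mulmxBl mul1mx proj_id subrr addr0.
      by rewrite -[_ *m proj c *m proj c]mulmxA proj_id.
    have := congr1 (fun X : 'M_npos => X i j) HC.
    rewrite mulmxA (mulmxA (H c)) projr jc mulr1 => ->.
    by rewrite !mxE; have [->|_] := eqVneq i j; rewrite ?jc ?mulr0n.
  have [e|ne] := eqVneq (vtx i) (vtx j); last first.
    have -> : mmx y' i j = 0.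
      by apply: contraTeq ne => /(mmx_nz le_ab)[-> _]; rewrite eqxx.
    by apply/esym; apply: contraTeq ne => /vH ->; rewrite eqxx.
  have /codomP[a za] : (i, j) \in codom zpos.
    by rewrite (mem_codom_slot_pos le_ab) e eqxx ic.
  have [zi zj] : i = (zpos a).1 /\ j = (zpos a).2 by rewrite -za.
  have -> : mmx y' i j = y' 0 a.
    rewrite !mxE {1 2}zi zj nmx_slot; case: eqP => [h|_]; last by rewrite add0r mxE.
    by move: jc; rewrite zj -h -zi ic ltnn.
  rewrite mxE PE QE -zi -zj ic HE // -!scalemxAl [RHS]mxE.
  have := nc _ c1; have := nc (1 - c)%N (leq_subr _ _).
  have -> : \det (minor 0 B B' x') * \det (minor 1 B B' x') =
    \det (minor c B B' x') * \det (minor (1 - c) B B' x').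
    by case: (c) c1 => [|[]] //; rewrite mulrC.
  move: (\det _) (\det _) => d1 d2 h1 h2; field.
  by rewrite h1 h2.
have trE : trans B' y' B x' = mmx y' *m (gmx M B' B *m wmx x') by rewrite mulmxA.
have CK : C B B' x' *m (gmx M B' B *m wmx x') = 1%:M.
  by rewrite mulmxA -(mulmxA (mmx x')) gmxM gmx1 mulmx1 (mmxK le_ab).
move=> i j nz; have e := trans_vtx le_ab nz; split=> //.
have [c2|c1] := ltnP 1 (blk i).
  exact: leq_trans (blk_le2 _ _ _) c2.
(* The second factor of [trans] in [trE] is the inverse of [C], so this row of [trans] is a row of
   [H c *m proj c] with [c = blk i], where the columns beyond block [c] vanish. *)
have : (H (blk i) *m proj (blk i)) i j != 0.
  rewrite (_ : _ i j = trans B' y' B x' i j) //.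
  rewrite trE -[H _ *m _]mulmx1 -CK (mulmxA (_ *m proj _)) [LHS]mxE [RHS]mxE.
  by apply: eq_bigr => k _; rewrite (row (blk i)).
by rewrite projr; case: leqP => //; rewrite mulr0 eqxx.
Qed.

End JacobianExists.

(** * Frames of W *)

Section Homs.
Variables (K : fieldType) (V : nat -> vectType K) (M : nat).
Variables alpha beta : nat -> nat.
Hypothesis le_ab : forall v, (0 < v <= M)%N -> (alpha v <= beta v)%N.

Local Notation N := (dimF V M alpha beta).
Local Notation npos := (npos V M).
Local Notation moving := (@moving_basis K V M alpha beta).
Implicit Types (B : bases V) (x y : 'rV[K]_N).

Lemma hom_ext B x w w' (f g : 'Hom(V w, V w')) :
    (0 < w <= M.+1)%N -> (0 < w' <= M.+1)%N ->
    (forall s t : 'I_npos, vtx s = w' -> vtx t = w ->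
      mcoord B x s (f (moving B x w (loc t))) = mcoord B x s (g (moving B x w (loc t)))) ->
  f = g.
Proof.
move=> w_le w'_le fg; apply/lfunP => u; rewrite (mcoord_sum le_ab B x u w_le) !linear_sum.
apply: eq_bigr => t /eqP tw; rewrite !linearZ /=; congr (_ *: _).
by apply: (mcoord_inj (B := B) (x := x) le_ab w'_le) => s sw; apply: fg.
Qed.

(** In the moving bases, the maps that factor through the quotient by the first subspace and land in
    the second are the matrices supported on the columns outside the one and the rows inside the
    other. *)
Lemma hom_flagsP B x w w' (f : 'Hom(V w, V w')) a a' :
    (0 < w <= M.+1)%N -> (0 < w' <= M.+1)%N ->
    (a <= \dim {:V w})%N -> (a' <= \dim {:V w'})%N ->
  (<<mkseq (moving B x w) a>> <= lker f)%VS /\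
    (limg f <= <<mkseq (moving B x w') a'>>)%VS <->
  forall s t : 'I_npos, vtx s = w' -> vtx t = w ->
    mcoord B x s (f (moving B x w (loc t))) != 0 -> (a <= loc t)%N /\ (loc s < a')%N.
Proof.
move=> w_le w'_le a_le a'_le; split=> [[kf lf] s t sw tw nz|nz].
  split; rewrite leqNgt; apply: contra nz => lt; apply/eqP.
    have: moving B x w (loc t) \in lker f.
      by apply: (subvP kf); apply/memv_span/mapP; exists (loc t); rewrite ?mem_iota.
    by rewrite memv_ker => /eqP->; rewrite linear0.
  have := subvP lf _ (memv_img f (memvf (moving B x w (loc t)))).
  by move/(mem_span_moving le_ab _ _ _ w'_le a'_le); apply.
split.
  apply/span_subvP => u /mapP[k]; rewrite mem_iota /= add0n => ka ->.
  have [t tw tk] := pos_ex w_le (leq_trans ka a_le).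
  rewrite memv_ker -tk; apply/eqP/(mcoord_inj (B := B) (x := x) le_ab w'_le) => s sw.
  rewrite linear0; apply: contraTeq ka => /(nz s t sw tw)[+ _].
  by rewrite tk -leqNgt.
apply/subvP => _ /memv_imgP[u _ ->].
rewrite (mcoord_sum le_ab B x u w_le) linear_sum; apply: rpred_sum => t /eqP tw.
rewrite linearZ /=; apply/rpredZ/(mem_span_moving le_ab _ _ _ w'_le a'_le) => s sw a's.
apply: contraTeq a's => /(nz s t sw tw)[_].
by rewrite -ltnNge.
Qed.

Definition hom_of B x (A : 'M[K]_npos) w w' (u : V w) : V w' :=
  \sum_(s | vtx s == w') \sum_(t | vtx t == w)
    (A s t * mcoord B x t u) *: moving B x w' (loc s).

Fact hom_of_is_linear B x A w w' : linear (@hom_of B x A w w').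
Proof.
move=> c u v; rewrite /hom_of scaler_sumr -big_split; apply: eq_bigr => s _ /=.
rewrite scaler_sumr -big_split; apply: eq_bigr => t _ /=.
by rewrite linearP /= mulrDr scalerDl scalerA mulrCA.
Qed.
HB.instance Definition _ B x A w w' :=
  GRing.isLinear.Build K (V w) (V w') *:%R (@hom_of B x A w w') (@hom_of_is_linear B x A w w').

Lemma mcoord_hom_of B x A w w' (s t : 'I_npos) : vtx s = w' -> vtx t = w ->
  mcoord B x s (linfun (@hom_of B x A w w') (moving B x w (loc t))) = A s t.
Proof.
move=> sw tw; have mc v (i j : 'I_npos) : vtx i = v -> vtx j = v ->
    mcoord B x j (moving B x v (loc i)) = (i == j)%:R.
  by move=> iv jv; rewrite (mcoord_moving le_ab B x B x iv jv) trans1 // mxE.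
rewrite lfunE /= /hom_of linear_sum (bigD1 s) ?sw //= [X in _ + X]big1 => [|s'].
  rewrite addr0 linear_sum (bigD1 t) ?tw //= big1 => [|t' /andP[/eqP tw' nt]].
    by rewrite linearZ /= !mc // !eqxx !mulr1 addr0.
  by rewrite linearZ /= !mc // [t == _]eq_sym (negbTE nt) mulr0 mul0r.
case/andP=> /eqP sw' ns; rewrite linear_sum big1 // => t' _.
by rewrite linearZ /= (mc _ _ _ sw' sw) (negbTE ns) mulr0.
Qed.

Lemma mcoord_change B x B' y w w' (f : 'Hom(V w, V w')) (s t : 'I_npos) :
    vtx s = w' -> vtx t = w ->
  mcoord B' y s (f (moving B' y w (loc t))) =
  \sum_(s' | vtx s' == w') \sum_(t' | vtx t' == w) trans B x B' y s' s *
    mcoord B x s' (f (moving B x w (loc t'))) * trans B' y B x t t'.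
Proof.
move=> sw tw; have w'_le : (0 < w' <= M.+1)%N by rewrite -sw vtx_bound.
set v := f _; rewrite (mcoord_sum le_ab B x v w'_le) linear_sum.
apply: eq_bigr => s' /eqP sw' /=; rewrite linearZ /= (mcoord_moving le_ab B x B' y sw' sw).
rewrite mulrC /v (moving_trans le_ab B' y B x tw) !linear_sum mulr_sumr.
by apply: eq_bigr => t' _; rewrite !linearZ /=; ring.
Qed.

End Homs.

(** * Representations as matrices in the moving bases *)

Section QuiverFrames.
Variables (K : fieldType) (V : nat -> vectType K) (m : nat).
Variables alpha beta : nat -> nat.
Local Notation M := m.*2.
Hypothesis le_ab : forall v, (0 < v <= M)%N -> (alpha v <= beta v)%N.
Hypothesis le_bn : forall v, (0 < v <= M)%N -> (beta v <= \dim {:V v})%N.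

Local Notation N := (dimF V M alpha beta).
Local Notation npos := (npos V M).
Local Notation moving := (@moving_basis K V M alpha beta).
Local Notation blk := (@blk K V M alpha beta).
Implicit Types (B : bases V) (x y : 'rV[K]_N) (s t : 'I_npos) (phi : rep V).

Definition arrow s t := ~~ odd (vtx t) &&
  ((vtx s == (vtx t)./2.*2.-1) || (vtx s == (vtx t)./2.*2.+1)).

(** All the arrows are stored in one matrix, with rows for targets and columns for sources: a change
    of chart acts on the whole representation by one two-sided multiplication. *)
Definition rep_mx B x phi : 'M[K]_npos := \matrix_(s, t)
  if odd (vtx t) then 0 else
  if vtx s == (vtx t)./2.*2.-1 then
    mcoord B x s (phi_odd phi (vtx t)./2 (moving B x _ (loc t)))
  else if vtx s == (vtx t)./2.*2.+1 then
    mcoord B x s (phi_even phi (vtx t)./2 (moving B x _ (loc t)))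
  else 0.

Definition mx_rep B x (A : 'M[K]_npos) : rep V :=
  Rep (fun i => linfun (@hom_of K V M alpha beta B x A i.*2 i.*2.-1))
      (fun i => linfun (@hom_of K V M alpha beta B x A i.*2 i.*2.+1)).

Lemma arrow_bound t i : vtx t = i.*2 -> (1 <= i <= m)%N.
Proof. by move=> ti; have := vtx_bound t; rewrite ti; lia. Qed.

(** The last case asserts vanishing at all positions over the same two vertices, as required by the
    sums over [s'] and [t'] in a change of chart. *)
Variant arrow_spec s t : bool -> Type :=
| ArrowOdd i of (1 <= i <= m)%N & vtx t = i.*2 & vtx s = i.*2.-1 : arrow_spec s t true
| ArrowEven i of (1 <= i <= m)%N & vtx t = i.*2 & vtx s = i.*2.+1 : arrow_spec s t true
| NoArrow of (forall s' t' B x phi, vtx s' = vtx s -> vtx t' = vtx t ->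
    rep_mx B x phi s' t' = 0) : arrow_spec s t false.

Lemma arrowP s t : arrow_spec s t (arrow s t).
Proof.
rewrite /arrow; have [to|te] /= := boolP (odd (vtx t)).
  by apply: NoArrow => s' t' B x phi _ e; rewrite mxE e to.
have ti : vtx t = (vtx t)./2.*2 by rewrite even_halfK.
have ib := arrow_bound ti.
case: eqVneq => [so|no] /=; first exact: ArrowOdd ib ti so.
case: eqVneq => [se|ne] /=; first exact: ArrowEven ib ti se.
by apply: NoArrow => s' t' B x phi e e'; rewrite mxE e e' (negbTE te) (negbTE no) (negbTE ne).
Qed.

Lemma rep_mx_odd B x phi s t i : vtx t = i.*2 -> vtx s = i.*2.-1 ->
  rep_mx B x phi s t = mcoord B x s (phi_odd phi i (moving B x _ (loc t))).
Proof. by move=> ti si; rewrite mxE ti odd_double doubleK si eqxx. Qed.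

Lemma rep_mx_even B x phi s t i : vtx t = i.*2 -> vtx s = i.*2.+1 ->
  rep_mx B x phi s t = mcoord B x s (phi_even phi i (moving B x _ (loc t))).
Proof.
move=> ti si; rewrite mxE ti odd_double doubleK si eqxx ifN //.
by apply/eqP; lia.
Qed.

Lemma rep_mxK B x A s t : arrow s t -> rep_mx B x (mx_rep B x A) s t = A s t.
Proof.
case: arrowP => // i _ ti si _; first by rewrite (rep_mx_odd _ _ _ ti si) mcoord_hom_of.
by rewrite (rep_mx_even _ _ _ ti si) mcoord_hom_of.
Qed.

Lemma lin_combP B x k (c : 'rV[K]_k) e phi : lin_comb m c e phi <->
  rep_mx B x phi = \sum_a c 0 a *: rep_mx B x (e a).
Proof.
split=> [lc|eq_mx i i_le].
  apply/matrixP => s t; rewrite summxE.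
  under eq_bigr do rewrite mxE.
  case: (arrowP s t) => [i ib ti si|i ib ti si|z].
  - under eq_bigr do rewrite (rep_mx_odd _ _ _ ti si).
    rewrite (rep_mx_odd _ _ _ ti si) (lc i ib).1 sum_lfunE linear_sum.
    by apply: eq_bigr => a _; rewrite scale_lfunE linearZ.
  - under eq_bigr do rewrite (rep_mx_even _ _ _ ti si).
    rewrite (rep_mx_even _ _ _ ti si) (lc i ib).2 sum_lfunE linear_sum.
    by apply: eq_bigr => a _; rewrite scale_lfunE linearZ.
  by rewrite z // big1 // => a _; rewrite z // mulr0.
have b0 : (0 < i.*2 <= M.+1)%N by lia.
have b1 : (0 < i.*2.-1 <= M.+1)%N by lia.
have b2 : (0 < i.*2.+1 <= M.+1)%N by lia.
split; apply: (hom_ext (B := B) (x := x) le_ab) => // s t si ti.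
  rewrite -(rep_mx_odd _ _ _ ti si) eq_mx summxE sum_lfunE linear_sum.
  by apply: eq_bigr => a _; rewrite mxE (rep_mx_odd _ _ _ ti si) scale_lfunE linearZ.
rewrite -(rep_mx_even _ _ _ ti si) eq_mx summxE sum_lfunE linear_sum.
by apply: eq_bigr => a _; rewrite mxE (rep_mx_even _ _ _ ti si) scale_lfunE linearZ.
Qed.

Lemma rep_mx_change B x B' y phi : rep_mx B' y phi =
  (trans B x B' y)^T *m rep_mx B x phi *m (trans B' y B x)^T.
Proof.
apply/matrixP => s t.
have tv := @trans_vtx K V M alpha beta le_ab.
transitivity (\sum_(s' | vtx s' == vtx s) \sum_(t' | vtx t' == vtx t)
    trans B x B' y s' s * rep_mx B x phi s' t' * trans B' y B x t t').
  case: (arrowP s t) => [i ib ti si|i ib ti si|z].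
  - rewrite (rep_mx_odd _ _ _ ti si) (mcoord_change le_ab B x B' y _ si ti) si ti.
    apply: eq_bigr => s' /eqP si'; apply: eq_bigr => t' /eqP ti'.
    by rewrite (rep_mx_odd _ _ _ ti' si').
  - rewrite (rep_mx_even _ _ _ ti si) (mcoord_change le_ab B x B' y _ si ti) si ti.
    apply: eq_bigr => s' /eqP si'; apply: eq_bigr => t' /eqP ti'.
    by rewrite (rep_mx_even _ _ _ ti' si').
  rewrite z // big1 // => s' /eqP es; rewrite big1 // => t' /eqP et.
  by rewrite z // mulr0 mul0r.
rewrite [RHS]mxE big_mkcond /=.
under [RHS]eq_bigr => t' _ do rewrite mxE mulr_suml.
rewrite [RHS]exchange_big; apply: eq_bigr => s' _ /=.
case: eqVneq => ss'; last first.
  rewrite big1 // => t' _; rewrite mxE.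
  have [->|/tv e] := eqVneq (trans B x B' y s' s) 0; first by rewrite !mul0r.
  by rewrite e eqxx in ss'.
rewrite big_mkcond; apply: eq_bigr => t' _.
rewrite [X in _ = _ * X]mxE [X in _ = X * _ * _]mxE.
case: eqVneq => tt' //.
have [->|/tv e] := eqVneq (trans B' y B x t t') 0; first by rewrite mulr0.
by rewrite e eqxx in tt'.
Qed.

(** The alternatives are the two kinds of summands of [W]: source modulo its smaller subspace into
    the smaller subspace of the left neighbour, and source modulo its larger subspace into the
    larger subspace of the right neighbour. At the vertex [2m+1] every position has block 0, so the
    second one allows all of the target, as the last summand does. *)
Definition in_support s t := ~~ odd (vtx t) &&
  ((((vtx s).+1 == vtx t) && (blk s == 0%N) && (0 < blk t)%N)
   || ((vtx s == (vtx t).+1) && (blk s < 2)%N && (blk t == 2)%N)).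

Lemma in_support_arrow s t : in_support s t -> arrow s t.
Proof.
rewrite /in_support /arrow => /andP[te st]; rewrite te even_halfK //=.
by have := vtx_bound t; lia.
Qed.

Lemma in_WP B x phi : in_W m (cell B x) phi <->
  forall s t, rep_mx B x phi s t != 0 -> in_support s t.
Proof.
have bi i : (1 <= i <= m)%N -> [/\ (0 < i.*2 <= M.+1)%N, (0 < i.*2.-1 <= M.+1)%N,
    (0 < i.*2.+1 <= M.+1)%N, (0 < i.*2 <= M)%N & (0 < i.*2.-1 <= M)%N] by split; lia.
have an v : (0 < v <= M)%N -> (alpha v <= \dim {:V v})%N.
  by move=> vM; apply: leq_trans (le_ab vM) (le_bn vM).
have bs s := @blk_spec K V M alpha beta le_ab s.
have b2 s := @blk_le2 K V M alpha beta s.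
split=> [inW s t|supp i ib].
  case: (arrowP s t) => [i ib ti si|i ib ti si|z]; last by rewrite z ?eqxx.
  - have [kf lf _ _] := inW i ib; have [h0 h1 h2 h3 h4] := bi i ib.
    rewrite (rep_mx_odd _ _ _ ti si).
    move/((hom_flagsP le_ab _ _ _ h0 h1 (an _ h3) (an _ h4)).1 (conj kf lf) s t si ti).
    have := bs s; have := bs t; rewrite si ti => /(_ h3)[-> _] /(_ h4)[e _] [h5].
    rewrite ltnNge e -leqNgt => h6.
    by rewrite /in_support ti si odd_double /= h5; lia.
  - have [_ _ kf lf] := inW i ib; have [h0 h1 h2 h3 h4] := bi i ib.
    rewrite (rep_mx_even _ _ _ ti si) /in_support ti si odd_double eqxx /=.
    have [im|im] := ltnP i m.
      have h5 : (0 < i.*2.+1 <= M)%N by lia.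
      move/((hom_flagsP le_ab _ _ _ h0 h2 (le_bn h3) (le_bn h5)).1 (conj kf (lf im)) s t si ti).
      have := bs s; have := bs t; rewrite si ti => /(_ h3)[_ ->] /(_ h5)[_ e] [h6].
      rewrite ltnNge e -leqNgt => h7.
      by have := b2 t; lia.
    (* For [i = m] there is no flag at the target, and its full moving basis stands for the
       subspace. *)
    have lf' : (limg (phi_even phi i) <= <<mkseq (moving B x i.*2.+1) (\dim {:V i.*2.+1})>>)%VS.
      by have /andP[/eqP-> _] := moving_basisP B x i.*2.+1; rewrite subvf.
    move/((hom_flagsP le_ab _ _ _ h0 h2 (le_bn h3) (leqnn _)).1 (conj kf lf') s t si ti).
    have := bs t; rewrite ti => /(_ h3)[_ ->] [h6 _].
    have -> : blk s = 0%N by apply: blk_last; rewrite si; lia.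
    by have := b2 t; lia.
have [h0 h1 h2 h3 h4] := bi i ib.
have [] : ((cell B x i.*2).1 <= lker (phi_odd phi i))%VS /\
    (limg (phi_odd phi i) <= (cell B x i.*2.-1).1)%VS.
  apply/(hom_flagsP le_ab _ _ _ h0 h1 (an _ h3) (an _ h4)) => s t si ti.
  rewrite -(rep_mx_odd _ _ _ ti si) => /supp; rewrite /in_support.
  have := bs s; have := bs t; rewrite si ti => /(_ h3)[-> _] /(_ h4)[e _].
  by rewrite [(loc s < _)%N]ltnNge e; lia.
have even_supp s t : vtx s = i.*2.+1 -> vtx t = i.*2 ->
    mcoord B x s (phi_even phi i (moving B x i.*2 (loc t))) != 0 ->
    (beta i.*2 <= loc t)%N /\ (blk s < 2)%N.
  move=> si ti; rewrite -(rep_mx_even _ _ _ ti si) => /supp; rewrite /in_support.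
  by have := bs t; rewrite si ti => /(_ h3)[_ ->]; lia.
have [kf _] : (<<mkseq (moving B x i.*2) (beta i.*2)>> <= lker (phi_even phi i))%VS /\
    (limg (phi_even phi i) <= <<mkseq (moving B x i.*2.+1) (\dim {:V i.*2.+1})>>)%VS.
  apply/(hom_flagsP le_ab _ _ _ h0 h2 (le_bn h3) (leqnn _)) => s t si ti.
  by move/(even_supp s t si ti) => [? _]; split=> //; rewrite -si loc_lt.
split=> // im; have h5 : (0 < i.*2.+1 <= M)%N by lia.
have [] : (<<mkseq (moving B x i.*2) (beta i.*2)>> <= lker (phi_even phi i))%VS /\
    (limg (phi_even phi i) <= (cell B x i.*2.+1).2)%VS; last by [].
apply/(hom_flagsP le_ab _ _ _ h0 h2 (le_bn h3) (le_bn h5)) => s t si ti.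
move/(even_supp s t si ti) => [? ?]; split=> //.
have := bs s; rewrite si => /(_ h5)[_ e]; rewrite ltnNge e.
by rewrite -leqNgt.
Qed.

End QuiverFrames.

(** On the line through two points the function is a polynomial in one variable without root, hence
    a constant. *)
Lemma regular_nonzero_cst (K : closedFieldType) N (f : 'rV[K]_N -> K) :
  regular_fun f -> (forall x, f x != 0) -> forall x y, f x = f y.
Proof.
move=> [P PE] f0 x y; have [p [pE _]] := mpoly_line x (y - x) P.
have : size p == 1%N.
  apply: contraT => /closed_rootP[t /rootP]; rewrite pE -PE => /eqP.
  by rewrite (negbTE (f0 _)).
case/size_poly1P => c _ pc; have := pE 0; have := pE 1.
rewrite scale1r addrC subrK scale0r addr0 -!PE => <- <-.
by rewrite pc !hornerC.
Qed.

(** * The standard frame of [W] and its comparison with any other frame *)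

Section Frames.
Variables (K : fieldType) (V : nat -> vectType K) (m : nat).
Variables alpha beta : nat -> nat.
Local Notation M := m.*2.
Hypothesis le_ab : forall v, (0 < v <= M)%N -> (alpha v <= beta v)%N.
Hypothesis le_bn : forall v, (0 < v <= M)%N -> (beta v <= \dim {:V v})%N.

Local Notation N := (dimF V M alpha beta).
Local Notation npos := (npos V M).
Local Notation moving := (@moving_basis K V M alpha beta).
Local Notation blk := (@blk K V M alpha beta).
Local Notation vtx := (@vtx K V M).
Implicit Types (B : bases V) (x y : 'rV[K]_N) (s t : 'I_npos) (phi : rep V).

Definition w_index := [set u : 'I_npos * 'I_npos | in_support alpha beta u.1 u.2].
Definition support_pos (b : 'I_#|w_index|) : 'I_npos * 'I_npos := enum_val b.

Lemma support_pos_inj : injective support_pos.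
Proof. exact: enum_val_inj. Qed.

Lemma mem_codom_support s t : ((s, t) \in codom support_pos) = in_support alpha beta s t.
Proof.
apply/codomP/idP => [[b e]|st].
  by have := enum_valP b; rewrite -/(support_pos b) -e inE.
have u : (s, t) \in w_index by rewrite inE.
by exists (enum_rank_in u (s, t)); rewrite /support_pos enum_rankK_in.
Qed.

Lemma support_posP b : in_support alpha beta (support_pos b).1 (support_pos b).2.
Proof. by rewrite -mem_codom_support -surjective_pairing codom_f. Qed.

Lemma support_closed : closed_index vtx blk support_pos.
Proof.
move=> s t s' t'; rewrite !mem_codom_support /in_support => + es et ls lt.
rewrite es et => /andP[-> /=].
by have := blk_le2 alpha beta t'; lia.
Qed.

Definition std_frame B x b :=
  mx_rep B x (delta_mx (support_pos b).1 (support_pos b).2).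

Lemma rep_mx_std_frame B x b : rep_mx B x (std_frame B x b) =
  delta_mx (support_pos b).1 (support_pos b).2.
Proof.
apply/matrixP => s t; have [st|] := boolP (arrow s t); first by rewrite rep_mxK.
move=> nst; have := nst; case: (arrowP alpha beta s t) => // z _; rewrite z // mxE.
case: eqP => //= es; case: eqP => //= et.
by case/negP: nst; rewrite es et; exact: (in_support_arrow (support_posP b)).
Qed.

Lemma rep_mx_in_W B x phi : in_W m (cell B x) phi ->
  rep_mx B x phi = \sum_b rep_mx B x phi (support_pos b).1 (support_pos b).2 *:
    delta_mx (support_pos b).1 (support_pos b).2.
Proof.
move/(in_WP le_ab le_bn) => supp; apply/matrixP => s t; rewrite summxE.
have delta b : (delta_mx (support_pos b).1 (support_pos b).2 : 'M[K]_npos) s t =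
    ((s, t) == support_pos b)%:R.
  by rewrite mxE -xpair_eqE -surjective_pairing.
under eq_bigr do rewrite mxE delta.
have [|nst] := boolP (in_support alpha beta s t).
  rewrite -mem_codom_support => /codomP[b e].
  rewrite (bigD1 b) //= -e eqxx mulr1 big1 ?addr0 // => b' nb.
  by rewrite e (inj_eq support_pos_inj) eq_sym (negbTE nb) mulr0.
rewrite big1 => [|b _]; first by apply: contraNeq nst; exact: supp.
case: eqP => [e|]; rewrite ?mulr0 //; case/negP: nst.
by rewrite -mem_codom_support e codom_f.
Qed.

Lemma std_frame_basis B x : is_basis_of m (in_W m (cell B x)) (std_frame B x).
Proof.
split=> [b|phi /rep_mx_in_W phiE].
  apply/(in_WP le_ab le_bn) => s t; rewrite rep_mx_std_frame mxE.
  have [/andP[/eqP-> /eqP->] _|] := boolP (_ && _); first exact: support_posP.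
  by rewrite eqxx.
exists (\row_b rep_mx B x phi (support_pos b).1 (support_pos b).2); split.
  apply/(lin_combP le_ab B x); rewrite {1}phiE; apply: eq_bigr => b _.
  by rewrite mxE rep_mx_std_frame.
move=> c /(lin_combP le_ab B x) cE; apply/rowP => b; rewrite mxE cE summxE.
rewrite (bigD1 b) //= mxE rep_mx_std_frame mxE !eqxx mulr1 big1 ?addr0 // => b' nb.
rewrite mxE rep_mx_std_frame mxE -xpair_eqE -!surjective_pairing.
by rewrite (inj_eq support_pos_inj) eq_sym (negbTE nb) mulr0.
Qed.

Lemma regular_moving B w (i : 'I_npos) (l : 'Hom(V w, K^o)) : vtx i = w ->
  regular_fun (fun x => l (moving B x w (loc i))).
Proof.
move=> iw; apply: (@regular_ext _ _ (fun x => \sum_(j | vtx j == w) mmx x i j * l (B w)`_(loc j))).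
  by move=> x; rewrite movingE // linear_sum; apply: eq_bigr => j _; rewrite linearZ.
apply: regular_sum => j _; apply: regularM; last exact: regular_cst.
exact: (regular_mmx alpha beta).
Qed.

Lemma regular_mcoord B w (j : 'I_npos) (u : V w) : regular_fun (fun x => mcoord B x j u).
Proof.
apply: regular_sum => i _; apply: regularM; first exact: regular_cst.
exact: (regular_wmx alpha beta).
Qed.

Lemma regular_hom_of B A w w' (u : V w) (l : 'Hom(V w', K^o)) :
  regular_fun (fun x => l (linfun (@hom_of K V M alpha beta B x A w w') u)).
Proof.
apply: (@regular_ext _ _ (fun x => \sum_(s | vtx s == w') \sum_(t | vtx t == w)
    (A s t * mcoord B x t u) * l (moving B x w' (loc s)))).
  move=> x; rewrite lfunE /= /hom_of linear_sum; apply: eq_bigr => s _.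
  by rewrite linear_sum; apply: eq_bigr => t _; rewrite linearZ.
apply: regular_sum => s /eqP sw; apply: regular_sum => t _.
apply: regularM; last exact: regular_moving.
by apply: regularM; [exact: regular_cst|exact: regular_mcoord].
Qed.

Lemma std_frame_regular B b : regular_rep m (fun x => std_frame B x b).
Proof. by move=> i _ u; split=> l; exact: regular_hom_of. Qed.

Lemma regular_rep_mx B (f : 'rV[K]_N -> rep V) :
  regular_rep m f -> regular_mx (fun x => rep_mx B x (f x)).
Proof.
move=> rf s t.
have reg w w' (h : 'rV[K]_N -> 'Hom(V w, V w')) : vtx s = w' -> vtx t = w ->
    (forall u (l : 'Hom(V w', K^o)), regular_fun (fun x => l (h x u))) ->
    regular_fun (fun x => mcoord B x s (h x (moving B x w (loc t)))).
  move=> sw tw rh; apply: (@regular_ext _ _ (fun x => \sum_(i | vtx i == w')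
      (\sum_(j | vtx j == w) mmx x t j *
        linfun (coordn B (loc i) : V w' -> K^o) (h x (B w)`_(loc j))) * wmx x i s)).
    move=> x; apply: eq_bigr => i _; congr (_ * _).
    rewrite movingE // !linear_sum; apply: eq_bigr => j _.
    by rewrite !linearZ lfunE.
  apply: regular_sum => i _; apply: regularM; last exact: (regular_wmx alpha beta).
  apply: regular_sum => j _; apply: regularM; last exact: rh.
  exact: (regular_mmx alpha beta).
case: (arrowP alpha beta s t) => [i ib ti si|i ib ti si|z].
- apply: (@regular_ext _ _ (fun x => mcoord B x s (phi_odd (f x) i (moving B x i.*2 (loc t))))).
    by move=> x; rewrite (rep_mx_odd _ _ _ ti si).
  by apply: reg => // u l; have [] := rf i ib u.
- apply: (@regular_ext _ _ (fun x => mcoord B x s (phi_even (f x) i (moving B x i.*2 (loc t))))).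
    by move=> x; rewrite (rep_mx_even _ _ _ ti si).
  by apply: reg => // u l; have [] := rf i ib u.
by apply: (regular_ext _ (regular_cst _ 0)) => x; rewrite z.
Qed.

Definition frame_mx B x k (e : 'I_k -> rep V) : 'M[K]_(k, #|w_index|) :=
  \matrix_(a, b) rep_mx B x (e a) (support_pos b).1 (support_pos b).2.

Lemma rep_mx_frame B x k (e : 'I_k -> rep V) a : in_W m (cell B x) (e a) ->
  rep_mx B x (e a) = \sum_b frame_mx B x e a b *:
    delta_mx (support_pos b).1 (support_pos b).2.
Proof. by move/rep_mx_in_W => {1}->; apply: eq_bigr => b _; rewrite [frame_mx _ _ _ _ _]mxE. Qed.

(** Uniqueness of coordinates gives one of the two identities, their existence the other. Both are
    recorded since the matrix is a priori rectangular: together they force [k] to be the number of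
    pairs in the support. *)
Lemma frame_mx_inv B x k (e : 'I_k -> rep V) :
    is_basis_of m (in_W m (cell B x)) e ->
  exists g, frame_mx B x e *m g = 1%:M /\ g *m frame_mx B x e = 1%:M.
Proof.
move=> [eW e_ex].
have [stdW _] := std_frame_basis B x.
have /fin_all_exists[c cE] b : exists c : 'rV[K]_k, lin_comb m c e (std_frame B x b).
  by have [c [cE _]] := e_ex _ (stdW b); exists c.
pose g : 'M[K]_(#|w_index|, k) := \matrix_b c b.
exists g; split; apply/matrixP => a b.
  have [c0 [_ c0_uniq]] := e_ex _ (eW a).
  have h1 : c0 = row a (frame_mx B x e *m g).
    apply: c0_uniq; apply/(lin_combP le_ab B x).
    rewrite (rep_mx_frame (eW a)); under [RHS]eq_bigr => a' _ do
      rewrite mxE mxE scaler_suml.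
    rewrite exchange_big; apply: eq_bigr => b' _ /=.
    rewrite -(rep_mx_std_frame B x) ((lin_combP le_ab B x _ _ _).1 (cE b')) scaler_sumr.
    by apply: eq_bigr => a' _; rewrite scalerA [g _ _]mxE.
  have h2 : c0 = row a 1%:M.
    apply: c0_uniq; apply/(lin_combP le_ab B x).
    rewrite (bigD1 a) //= !mxE eqxx scale1r big1 ?addr0 // => a' na.
    by rewrite !mxE eq_sym (negbTE na) scale0r.
  by have := congr1 (fun r : 'rV_k => r 0 b) (etrans (esym h1) h2); rewrite !mxE.
have := congr1 (fun X : 'M[K]_npos => X (support_pos b).1 (support_pos b).2)
  ((lin_combP le_ab B x _ _ _).1 (cE a)).
rewrite rep_mx_std_frame summxE [LHS]mxE -xpair_eqE -!surjective_pairing.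
rewrite (inj_eq support_pos_inj) eq_sym => h; rewrite [RHS]mxE h mxE.
by apply: eq_bigr => a' _; rewrite !mxE.
Qed.

(** The transition matrix of an arbitrary frame is the two-sided one corrected by a matrix attached
    to each chart, so the two transition functions of the determinant bundle differ by a
    coboundary. *)
Lemma frame_mx_change B x B' y k (e e' : 'I_k -> rep V) (A : 'M[K]_k) :
    (forall a, in_W m (cell B x) (e a)) -> (forall a, in_W m (cell B' y) (e' a)) ->
    (forall a, lin_comb m (row a A) e (e' a)) ->
  A *m frame_mx B x e =
  frame_mx B' y e' *m two_sided support_pos (trans B' y B x) (trans B x B' y).
Proof.
move=> eW e'W AE; apply/matrixP => a b.
have h := (lin_combP le_ab B x _ _ _).1 (AE a).
transitivity (rep_mx B x (e' a) (support_pos b).1 (support_pos b).2).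
  by rewrite h summxE mxE; apply: eq_bigr => a' _; rewrite !mxE.
rewrite (rep_mx_change le_ab B' y B x) (rep_mx_frame (e'W a)).
rewrite mulmx_sumr mulmx_suml summxE mxE; apply: eq_bigr => b' _.
rewrite -scalemxAr -scalemxAl mxE; congr (_ * _).
rewrite mxE (bigD1 (support_pos b').2) //= [X in _ + X]big1 ?addr0 => [|t nt].
  rewrite [X in _ * X]mxE [in RHS]mxE; congr (_ * _).
  rewrite mxE (bigD1 (support_pos b').1) //= big1 ?addr0 => [|s ns].
    by rewrite !mxE !eqxx mulr1.
  by rewrite [X in _ * X]mxE (negbTE ns) mulr0.
rewrite mxE big1 ?mul0r // => s _.
by rewrite [X in _ * X]mxE (negbTE nt) andbF mulr0.
Qed.

End Frames.

(** * Crepancy and degrees *)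

Section Degrees.
Variables (K : fieldType) (p : nat).

Definition degree n (z : 'I_n -> 'I_p * 'I_p) (i : 'I_p) : int :=
  #|[set s | (s, i) \in codom z]|%:Z - #|[set t | (i, t) \in codom z]|%:Z.

Lemma prod_degree n (z : 'I_n -> 'I_p * 'I_p) (tau : 'I_p -> K) :
    (forall i, tau i != 0) ->
  \prod_(u in codom z) (tau u.2 / tau u.1) = \prod_i tau i ^ degree z i.
Proof.
move=> tau0; under [RHS]eq_bigr => i _ do rewrite expfzDr // -exprnN -exprnP.
rewrite big_split [RHS]big_split /=; congr (_ * _).
  rewrite (eq_bigl (fun u => (u.1, u.2) \in codom z)) => [|[s t] //].
  rewrite -(pair_big_dep xpredT (fun s t => (s, t) \in codom z) (fun s t => tau t)).
  rewrite (exchange_big_dep xpredT) //=; apply: eq_bigr => t _.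
  by rewrite -prodr_const; apply: eq_bigl => s; rewrite inE.
rewrite (eq_bigl (fun u => (u.1, u.2) \in codom z)) => [|[s t] //].
rewrite -(pair_big_dep xpredT (fun s t => (s, t) \in codom z) (fun s t => (tau s)^-1)) /=.
apply: eq_bigr => s _; rewrite -exprVn -prodr_const.
by apply: eq_bigl => t; rewrite inE.
Qed.

End Degrees.

(** * Exchange of two basis vectors at one vertex *)

Section Swap.
Variables (K : fieldType) (V : nat -> vectType K) (M : nat).
Variables alpha beta : nat -> nat.
Local Notation N := (dimF V M alpha beta).
Local Notation npos := (npos V M).

Definition swap_nat (a b k : nat) := if k == a then b else if k == b then a else k.

Lemma swap_natK a b : involutive (swap_nat a b).
Proof.
move=> k; rewrite /swap_nat; have [->|ka] := eqVneq k a.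
  by have [->|_] := eqVneq b a; rewrite ?eqxx.
have [->|kb] := eqVneq k b; first by rewrite eqxx.
by rewrite (negbTE ka) (negbTE kb).
Qed.

Lemma swap_nat_lt a b n k : (a < n)%N -> (b < n)%N -> (k < n)%N -> (swap_nat a b k < n)%N.
Proof. by rewrite /swap_nat; case: ifP => // _; case: ifP. Qed.

Lemma swapped_basis (B : bases V) (a b : 'I_npos) : vtx a = vtx b -> a != b ->
  exists B' : bases V, gmx M B B' =
    1%:M - delta_mx a a - delta_mx b b + delta_mx a b + delta_mx b a.
Proof.
move=> ab nab.
pose sw v k := if v == vtx a then swap_nat (loc a) (loc b) k else k.
have swK v k : sw v (sw v k) = k.
  by rewrite /sw; case: (v == _) => //=; rewrite swap_natK.
have sw_lt v k : (k < \dim {:V v})%N -> (sw v k < \dim {:V v})%N.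
  rewrite /sw; case: eqP => // -> k_lt; apply: swap_nat_lt => //; first exact: loc_lt.
  by rewrite ab loc_lt.
pose T v := [tuple of mkseq (fun k => (B v)`_(sw v k)) (\dim {:V v})].
have T_basis v : basis_of fullv (T v).
  rewrite basisEdim size_tuple leqnn andbT.
  rewrite -[X in (X <= _)%VS](span_basis (basis_atP B v)).
  apply/span_subvP => u /(nthP 0)[k]; rewrite size_tuple => k_lt <-.
  apply/memv_span/mapP; exists (sw v k); last by rewrite swK.
  by rewrite mem_iota /= sw_lt.
pose B' := Bases T_basis; exists B'; apply/matrixP => i j.
have BE v k : (k < \dim {:V v})%N -> (B v)`_k = (B' v)`_(sw v k).
  by move=> k_lt; rewrite /= nth_mkseq ?sw_lt // swK.
rewrite mxE BE ?loc_lt // coordn_basis ?sw_lt ?loc_lt //.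
have posE (k l : 'I_npos) : (vtx k == vtx l) && (loc k == loc l) = (k == l).
  apply/andP/eqP => [[/eqP e1 /eqP e2]|->]; [exact: pos_inj|by rewrite !eqxx].
have -> : (if vtx i == vtx j then (sw (vtx i) (loc i) == loc j)%:R else 0) =
    ((if i == a then b else if i == b then a else i) == j)%:R :> K.
  rewrite -posE /sw /swap_nat; have [->|ia] := eqVneq i a.
    by rewrite !eqxx -ab; case: (vtx a == _).
  have [->|ib] := eqVneq i b.
    rewrite ab !eqxx; have -> : (loc b == loc a) = false.
      by apply: contraNF nab => /eqP e; apply/eqP/pos_inj; rewrite // e.
    by case: (vtx b == _).
  have [ea|na] := eqVneq (vtx i) (vtx a); last by case: (vtx i == _).
  have -> : (loc i == loc a) = false.
    by apply: contraNF ia => /eqP e; apply/eqP/pos_inj.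
  have -> : (loc i == loc b) = false.
    by apply: contraNF ib => /eqP e; apply/eqP/pos_inj; rewrite // ea.
  by case: (vtx i == _).
rewrite !mxE ![_ == j]eq_sym.
have [->|ia] := eqVneq i a; first by rewrite (negbTE nab) /=; ring.
have [->|ib] := eqVneq i b; first by rewrite /=; ring.
by rewrite /= !subr0 !addr0.
Qed.

End Swap.

(** As 2 has infinite order, one value of the parameter suffices to detect an exponent. *)
Lemma exp2z_eq1 (K : numFieldType) (z : int) : (2%:R : K) ^ z = 1 -> z = 0.
Proof.
case: z => n.
  rewrite -exprnP -natrX => /eqP; rewrite pnatr_eq1; case: n => // n.
  by rewrite expnS mul2n; lia.
by rewrite NegzE -exprnN => /eqP; rewrite invr_eq1 -natrX pnatr_eq1 expnS; lia.
Qed.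

Section SwapTransition.
Variables (K : numClosedFieldType) (V : nat -> vectType K) (M : nat).
Variables alpha beta : nat -> nat.
Hypothesis le_ab : forall v, (0 < v <= M)%N -> (alpha v <= beta v)%N.
Hypothesis le_bn : forall v, (0 < v <= M)%N -> (beta v <= \dim {:V v})%N.
Local Notation N := (dimF V M alpha beta).
Local Notation vtx := (@vtx K V M).
Local Notation zpos := (@slot_pos K V M alpha beta).
Local Notation blk := (@blk K V M alpha beta).

Variables (B B' : bases V) (a0 : 'I_N) (u : K).
Let a := (zpos a0).1.
Let b := (zpos a0).2.
Hypothesis u_nz : u != 0.
Hypothesis gE : gmx M B B' =
  1%:M - delta_mx a a - delta_mx b b + delta_mx a b + delta_mx b a.

(** The points [x] and [y] run over the same coordinate axis in two charts, with inverse parameters: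
    these are the two affine lines that cover a projective line. *)
Let x : 'rV[K]_N := u *: delta_mx 0 a0.
Let y : 'rV[K]_N := u^-1 *: delta_mx 0 a0.

Let ab_slot : vtx a = vtx b /\ (blk a < blk b)%N.
Proof.
have : (a, b) \in codom zpos by rewrite -surjective_pairing codom_f.
by rewrite (mem_codom_slot_pos le_ab) => /andP[/eqP].
Qed.

Let nab : (a == b) = false.
Proof. by apply/eqP => e; have [_] := ab_slot; rewrite e ltnn. Qed.

(** The identity [(1 u; 0 1) (0 1; 1 0) = (u 0; 1 -1/u) (1 1/u; 0 1)]. *)
Lemma swap_trans : trans B x B' y =
  1%:M + (u - 1) *: delta_mx a a + delta_mx b a - (u^-1 + 1) *: delta_mx b b.
Proof.
set T := RHS.
suff e : mmx x *m gmx M B B' = T *m mmx y.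
  by rewrite /trans e -mulmxA (mmxK le_ab) mulmx1.
rewrite gE /mmx !nmxZ !nmx_delta -/a -/b /T.
rewrite !(mulmxDl, mulmxDr, mulNmx, mulmxN, mul1mx, mulmx1) -!scalemxAl -!scalemxAr.
rewrite !mul_delta_mx_cond !eqxx [b == a]eq_sym nab !mulr0n !mulr1n.
rewrite !(scaler0, oppr0, addr0, subr0).
apply/matrixP => i j; rewrite !mxE.
move: (_ && _) (_ && _) (_ && _) (_ && _) (i == j) => b1 b2 b3 b4 b5.
field.
exact: u_nz.
Qed.

Lemma swap_trans_nz i j : trans B x B' y i j != 0 -> i = j \/ i = b /\ j = a.
Proof.
rewrite swap_trans !mxE; have [->|nij] := eqVneq i j; first by left.
have [ia|_] /= := eqVneq i a.
  by rewrite -ia [j == i]eq_sym (negbTE nij) ia nab !mulr0 !addr0 subr0 eqxx.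
have [ib|_] /= := eqVneq i b; last by rewrite !mulr0 !addr0 subr0 eqxx.
rewrite -ib [j == i]eq_sym (negbTE nij) mulr0 addr0 mulr0 subr0 add0r.
by have [->|_] := eqVneq j a; [right|rewrite eqxx].
Qed.

Lemma swap_trans_diag i :
  trans B x B' y i i = if i == a then u else if i == b then - u^-1 else 1.
Proof.
rewrite swap_trans !mxE eqxx; have [->|_] := eqVneq i a.
  by rewrite nab /=; ring.
by case: (i == b) => /=; ring.
Qed.

Lemma swap_glue : glueF B x B' y.
Proof.
apply/(glueP le_ab le_bn) => i j /swap_trans_nz[->|[-> ->]]; first by [].
by have [-> /ltnW] := ab_slot.
Qed.

Lemma det_two_sided_swap n (z : 'I_n -> 'I_(npos V M) * 'I_(npos V M)) :
    injective z -> closed_index vtx blk z ->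
  \det (two_sided z (trans B' y B x) (trans B x B' y)) =
  u ^ degree z a * (- u^-1) ^ degree z b.
Proof.
move=> z_inj z_cl; have pT := (glueP le_ab le_bn _ _ _ _).1 swap_glue.
have pS := (glueP le_ab le_bn _ _ _ _).1 (glue_sym swap_glue).
rewrite (det_two_sided_rank (rho := fun i => (i == b) : nat) z_inj z_cl pS pT); first last.
- by move=> i j /swap_trans_nz[->|[-> ->]]; [left|right; rewrite eqxx nab].
- by rewrite (transM le_ab) (trans1 le_ab).
rewrite (prod_degree z (tau := fun i => trans B x B' y i i)) => [|i]; last first.
  rewrite swap_trans_diag; case: ifP => // _; case: ifP => _; last exact: oner_neq0.
  by rewrite oppr_eq0 invr_eq0.
rewrite (bigD1 a) // (bigD1 b) /=; last by rewrite eq_sym nab.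
rewrite !swap_trans_diag eqxx [b == a]eq_sym nab eqxx big1 ?mulr1 // => i /andP[ia ib].
by rewrite swap_trans_diag (negbTE ia) (negbTE ib) exp1rz.
Qed.

End SwapTransition.

(** * Crepancy makes the discrepancy constant at each vertex *)

Section Crepancy.
Variables (K : numClosedFieldType) (V : nat -> vectType K) (m : nat).
Variables d r p q : nat -> nat.
Local Notation M := m.*2.
Local Notation alpha := (flag_rank1 r q).
Local Notation beta := (flag_rank2 d r p).
Hypothesis le_ab : forall v, (0 < v <= M)%N -> (alpha v <= beta v)%N.
Hypothesis le_bn : forall v, (0 < v <= M)%N -> (beta v <= \dim {:V v})%N.
Local Notation N := (dimF V M alpha beta).
Local Notation npos := (npos V M).
Local Notation vtx := (@vtx K V M).
Local Notation zpos := (@slot_pos K V M alpha beta).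
Local Notation wpos := (@support_pos K V m alpha beta).
Local Notation blk := (@blk K V M alpha beta).

(** The exponent of [tau i] in the quotient of the two transition functions. *)
Definition discrepancy (i : 'I_npos) : int := degree wpos i - degree zpos i.

Let z_inj : injective zpos := @slot_pos_inj K V M alpha beta.
Let w_inj : injective wpos := @support_pos_inj K V m alpha beta.
Let z_cl : closed_index vtx blk zpos := slot_pos_closed le_ab.
Let w_cl : closed_index vtx blk wpos := @support_closed K V m alpha beta.

Let B0 : bases V := Bases (fun v => vbasisP {:V v}).

(** The fibres of [W] at a common point coincide, since membership reads only flags at glued
    vertices; the coefficients then come from the basis property. *)
Lemma frame_change k
    (e : bases V -> 'rV[K]_N -> 'I_k -> rep V) B x B' y :
    (forall x, is_basis_of m (in_W m (cell B x)) (e B x)) ->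
    (forall y, is_basis_of m (in_W m (cell B' y)) (e B' y)) ->
    glueF B x B' y ->
  exists A : 'M[K]_k, forall a, lin_comb m (row a A) (e B x) (e B' y a).
Proof.
move=> eB eB' gl.
have W_same phi : in_W m (cell B' y) phi -> in_W m (cell B x) phi.
  move=> W' i ib; have [h1 h2 h3 h4] := W' i ib.
  have flE v : (0 < v <= M)%N -> cell B x v = cell B' y v by exact: gl.
  rewrite (flE i.*2); last by lia.
  rewrite (flE i.*2.-1); last by lia.
  by split=> // im; rewrite flE; [exact: h4|lia].
have /fin_all_exists[c cE] a : exists c : 'rV[K]_k, lin_comb m c (e B x) (e B' y a).
  by have [c [cE _]] := (eB x).2 _ (W_same _ ((eB' y).1 a)); exists c.
by exists (\matrix_a c a) => a; rewrite rowK.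
Qed.

Lemma crepant_discrepancy : crepant V m d r p q ->
  forall s t : 'I_npos, vtx s = vtx t -> (blk s < blk t)%N ->
  discrepancy s = discrepancy t.
Proof.
move=> [k [e [e_frame [h [h_reg h_nz h_iso]]]]] s t st lt.
have /codomP[a0 za] : (s, t) \in codom zpos.
  by rewrite (mem_codom_slot_pos le_ab) st eqxx.
have [sE tE] : s = (zpos a0).1 /\ t = (zpos a0).2 by rewrite -za.
have nst : s != t by apply: contraTneq lt => ->; rewrite ltnn.
have [B' gE] := swapped_basis B0 st nst.
have kE : k = #|w_index V m alpha beta|.
  have [g [eg ge]] := frame_mx_inv le_ab le_bn ((e_frame B0).1 0).
  by apply/eqP; rewrite eqn_leq (mulmx1_min eg) (mulmx1_min ge).
subst k.
pose G B x := \det (frame_mx B x (e B x)).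
have G_nz B x : G B x != 0.
  have [g [eg _]] := frame_mx_inv le_ab le_bn ((e_frame B).1 x).
  by have [] := mulmx1_unit eg; rewrite unitmxE unitfE.
have G_cst B x : G B x = G B 0.
  apply: regular_nonzero_cst => //; apply: regular_det => a b.
  apply: (regular_ext _ (regular_rep_mx B ((e_frame B).2 a)
    (wpos b).1 (wpos b).2)) => x'.
  by rewrite [RHS]mxE.
have h_cst B x : h B x = h B 0 by exact: regular_nonzero_cst.
(* The right-hand side is free of [u]: the frame determinants [G] and the functions [h] are constant
   on each chart. *)
have key u : u != 0 -> u ^ discrepancy s * (- u^-1) ^ discrepancy t =
    h B' 0 * G B0 0 / (G B' 0 * h B0 0).
  move=> u0; rewrite sE tE in gE *.
  have gl := swap_glue le_ab le_bn u0 gE.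
  have det_swap := det_two_sided_swap le_ab le_bn u0 gE.
  move: (u *: _) (u^-1 *: _) gl det_swap => x y gl det_swap.
  have [J jacJ] := jacobian_exists le_ab le_bn gl.
  have [A AE] := frame_change (e_frame B0).1 (e_frame B').1 gl.
  have eW := ((e_frame B0).1 x).1; have e'W := ((e_frame B').1 y).1.
  have detA := frame_mx_change le_ab le_bn eW e'W AE.
  have := h_iso _ _ _ _ _ _ gl (ex_intro2 _ _ A AE (erefl _))
    (ex_intro2 _ _ J jacJ (erefl _)).
  have {detA} := congr1 determinant detA; rewrite !det_mulmx.
  rewrite (det_jacobian le_ab le_bn gl jacJ) !det_swap //.
  rewrite -/(G B0 x) -/(G B' y) !G_cst !h_cst => eA eJ.
  have v0 : - u^-1 != 0 by rewrite oppr_eq0 invr_eq0.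
  have expB c n n' : c != 0 -> c ^ (n - n') = c ^ n / c ^ n' :> K.
    by move=> c0; rewrite expfzDr // -invr_expz.
  rewrite /discrepancy; move: eA eJ.
  move: (degree wpos _) (degree zpos _) (degree wpos _) (degree zpos _).
  move=> w1 s1 w2 s2 eA eJ; rewrite !expB // mulf_div.
  apply/eqP; rewrite eqr_div ?mulf_neq0 ?expfz_neq0 ?G_nz ?h_nz //; apply/eqP.
  transitivity (\det A * G B0 0 * h B0 0); first by rewrite eA; ring.
  by rewrite mulrAC -eJ; ring.
(* Comparing [u = 2] with [u = 1] eliminates the unknown constant and the sign
   [(-1) ^ discrepancy t], leaving a power of 2 equal to 1. *)
have k1 := key 1 (oner_neq0 _); have := key 2%:R; rewrite pnatr_eq0 -k1 => /(_ isT).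
rewrite invr1 exp1rz mul1r -mulN1r expfzMl exprz_inv mulrCA -[RHS]mulr1.
move/mulfI; rewrite expfz_neq0 ?oppr_eq0 ?oner_neq0 // => /(_ isT).
rewrite -expfzDr ?pnatr_eq0 // => /exp2z_eq1/eqP.
by rewrite subr_eq0 => /eqP.
Qed.

End Crepancy.

Lemma degree_cls p (vtx blk : 'I_p -> nat) n (z : 'I_n -> 'I_p * 'I_p) i j :
    closed_index vtx blk z -> vtx i = vtx j -> blk i = blk j ->
  degree z i = degree z j.
Proof.
move=> z_cl e eb; rewrite /degree; congr (_%:Z - _%:Z); apply: eq_card => s; rewrite !inE.
  by apply/idP/idP => st; apply: z_cl st _ _ _ _; rewrite // ?e ?eb.
by apply/idP/idP => st; apply: z_cl st _ _ _ _; rewrite // ?e ?eb.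
Qed.

(** * Determinants of the changes of chart at a single vertex *)

Section VertexDeterminants.
Variables (K : fieldType) (V : nat -> vectType K) (M : nat).
Variables alpha beta : nat -> nat.
Hypothesis le_ab : forall v, (0 < v <= M)%N -> (alpha v <= beta v)%N.
Local Notation N := (dimF V M alpha beta).
Local Notation npos := (npos V M).
Local Notation vtx := (@vtx K V M).

(** The dummy component in [unit] turns the block of a vertex into an instance of [one_sided], to
    which the family [tau] of [det_two_sided] applies. *)
Definition at_vertex w (a : 'I_#|[set i | vtx i == w]|) : unit * 'I_npos :=
  (tt, enum_val a).

Definition vertex_det w (A : 'M[K]_npos) := \det (one_sided (@at_vertex w) A).

Lemma at_vertex_inj w : injective (@at_vertex w).
Proof. by move=> a b [] /enum_val_inj. Qed.

Lemma mem_at_vertex w u i : ((u, i) \in codom (@at_vertex w)) = (vtx i == w).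
Proof.
case: u; apply/codomP/idP => [[a [->]]|iw]; first by have := enum_valP a; rewrite inE.
have iA : i \in [set i | vtx i == w] by rewrite inE.
by exists (enum_rank_in iA i); rewrite /at_vertex enum_rankK_in.
Qed.

Lemma vertex_det1 w : vertex_det w 1%:M = 1.
Proof. by rewrite /vertex_det one_sided1 ?det1 //; exact: at_vertex_inj. Qed.

Lemma vertex_detM w (A1 A2 : 'M[K]_npos) :
    (forall i j, A2 i j != 0 -> vtx i = vtx j) ->
  vertex_det w (A1 *m A2) = vertex_det w A1 * vertex_det w A2.
Proof.
move=> vA; rewrite /vertex_det one_sidedM ?det_mulmx 1?mulrC //.
  exact: at_vertex_inj.
by move=> u i j; rewrite !mem_at_vertex => iw /vA->.
Qed.

Lemma vertex_det_wmx w (x : 'rV[K]_N) : vertex_det w (wmx x) = 1.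
Proof.
rewrite /vertex_det.
rewrite (det_one_sided_rank (rho := fun t => (2 - blk alpha beta t)%N) (@at_vertex_inj w)).
  by rewrite big1 // => a _; exact: (wmx_diag le_ab).
move=> t t' /(wmx_nz le_ab)[->|[_ lt]]; [by left|right].
by have := blk_le2 alpha beta t; lia.
Qed.

(** The factors [mmx] and [wmx] are unipotent, so only the two fixed bases matter and not the point.
    This is why the trivialising functions can be taken constant on each chart. *)
Lemma vertex_det_trans w (B : bases V) (x : 'rV[K]_N) (B' : bases V) (y : 'rV[K]_N) :
  vertex_det w (trans B x B' y) = vertex_det w (gmx M B B').
Proof.
have vw := @wmx_vtx K V M alpha beta le_ab.
rewrite /trans !vertex_detM ?vertex_det_wmx ?mulr1; last first.
- exact: vw.
- exact: gmx_vtx.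
have := congr1 (vertex_det w) (mmxK le_ab x).
rewrite vertex_detM ?vertex_det_wmx ?vertex_det1 ?mulr1; last exact: vw.
by move=> ->; rewrite mul1r.
Qed.

End VertexDeterminants.

(** * An isomorphism built from the determinants at the vertices *)

Section CrepancyConverse.
Variables (K : numClosedFieldType) (V : nat -> vectType K) (m : nat).
Variables d r p q : nat -> nat.
Local Notation M := m.*2.
Local Notation alpha := (flag_rank1 r q).
Local Notation beta := (flag_rank2 d r p).
Hypothesis le_ab : forall v, (0 < v <= M)%N -> (alpha v <= beta v)%N.
Hypothesis le_bn : forall v, (0 < v <= M)%N -> (beta v <= \dim {:V v})%N.
Local Notation N := (dimF V M alpha beta).
Local Notation npos := (npos V M).
Local Notation vtx := (@vtx K V M).
Local Notation zpos := (@slot_pos K V M alpha beta).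
Local Notation wpos := (@support_pos K V m alpha beta).
Local Notation blk := (@blk K V M alpha beta).

Let z_cl : closed_index vtx blk zpos := slot_pos_closed le_ab.
Let w_cl : closed_index vtx blk wpos := @support_closed K V m alpha beta.

Let B0 : bases V := Bases (fun v => vbasisP {:V v}).

Local Notation disc := (@discrepancy K V m d r p q).

Lemma discrepancy_crepant :
    (forall s t : 'I_npos, vtx s = vtx t -> (blk s < blk t)%N ->
       disc s = disc t) ->
  crepant V m d r p q.
Proof.
move=> D_lt.
have D_vtx s t : vtx s = vtx t -> disc s = disc t.
  move=> st; have [lt|lt|eq] := ltngtP (blk s) (blk t).
  - exact: D_lt.
  - by apply/esym/D_lt.
  by rewrite /discrepancy (degree_cls w_cl st eq) (degree_cls z_cl st eq).
(* The common discrepancy at a vertex. The default 0 serves for vertices without positions, such as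
   the vertex 0 in the range [w < M.+2]. *)
pose E w := if [pick i | vtx i == w] is Some i then disc i else 0.
have DE i : disc i = E (vtx i).
  rewrite /E; case: pickP => [j /eqP ji|/(_ i)]; last by rewrite eqxx.
  exact: D_vtx.
pose delta w (B : bases V) := vertex_det w (gmx M B B0).
have delta_nz w B : delta w B != 0.
  have := congr1 (vertex_det w) (gmxM M B B0 B); rewrite gmx1 vertex_det1.
  rewrite vertex_detM => [e|i j /gmx_vtx //]; apply: contraTneq isT => z.
  by have := oner_neq0 K; rewrite -e -/(delta w B) z mul0r eqxx.
(* Determinants are taken relative to the fixed family [B0]. Between two charts [delta w] changes by
   the product of the [tau i] at [w], so the exponent [- E w] compensates the quotient of the
   transition functions. *)
pose h (B : bases V) (_ : 'rV[K]_N) := \prod_(w < M.+2) delta w B ^ (- E w).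
exists #|w_index V m alpha beta|, (fun B x => std_frame B x); split.
  by move=> B; split=> [x|b]; [exact: std_frame_basis|exact: std_frame_regular].
exists h; split=> [B|B x|B B' x y c c' gl [A AE cE] [J jacJ c'E]].
- exact: regular_cst.
- by apply/prodf_neq0 => w _; apply: expfz_neq0.
have std_mx (C : bases V) (z : 'rV[K]_N) : frame_mx C z (std_frame C z) = 1%:M.
  apply/matrixP => a b; rewrite [LHS]mxE (rep_mx_std_frame le_ab) [LHS]mxE [RHS]mxE.
  by rewrite -xpair_eqE -!surjective_pairing (inj_eq (@support_pos_inj K V m alpha beta)) eq_sym.
have AE' : A = two_sided wpos (trans B' y B x) (trans B x B' y).
  have := frame_mx_change le_ab le_bn (std_frame_basis le_ab le_bn B x).1
    (std_frame_basis le_ab le_bn B' y).1 AE.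
  by rewrite !std_mx mulmx1 mul1mx.
have pT := (glueP le_ab le_bn _ _ _ _).1 gl.
have pS := (glueP le_ab le_bn _ _ _ _).1 (glue_sym gl).
have ST : trans B' y B x *m trans B x B' y = 1%:M by rewrite (transM le_ab) (trans1 le_ab).
have [tau [tau_nz tau2 tau1]] := det_two_sided pS pT ST.
rewrite cE c'E (det_jacobian le_ab le_bn gl jacJ) AE'.
rewrite (tau2 _ _ (@support_pos_inj K V m alpha beta) w_cl).
rewrite (tau2 _ _ (@slot_pos_inj K V M alpha beta) z_cl) !prod_degree //.
have delta_tau (w : nat) : delta w B = (\prod_(i | vtx i == w) tau i) * delta w B'.
  rewrite /delta -(gmxM M B B' B0) vertex_detM => [|i j /gmx_vtx //].
  congr (_ * _); rewrite -(vertex_det_trans le_ab w B x B' y) /vertex_det tau1.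
  - rewrite (eq_bigl (fun u => vtx u.2 == w)) => [|[u i]]; last by rewrite mem_at_vertex.
    rewrite -(pair_big_dep xpredT (fun _ i => vtx i == w) (fun _ i => tau i)) /=.
    by rewrite (big_pred1 tt) // => -[].
  - exact: at_vertex_inj.
  by move=> u i j; rewrite !mem_at_vertex => /eqP <- ->.
have -> : \prod_i tau i ^ degree wpos i =
    (\prod_i tau i ^ degree zpos i) * \prod_i tau i ^ disc i.
  rewrite -big_split; apply: eq_bigr => i _ /=.
  by rewrite -expfzDr // /discrepancy addrC subrK.
rewrite mulrC -mulrA; congr (_ * _).
have -> : \prod_i tau i ^ disc i =
    \prod_(w < M.+2) (\prod_(i | vtx i == w) tau i) ^ E w.
  rewrite (partition_big (fun i => inord (vtx i) : 'I_(M.+2)) xpredT) //=.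
  apply: eq_bigr => w _.
  have eqw i : (inord (vtx i) == w :> 'I_(M.+2)) = (vtx i == w).
    by rewrite -val_eqE /= inordK // ltnS; case/andP: (vtx_bound i).
  rewrite (eq_bigl _ _ eqw) (eq_bigr (fun i => tau i ^ E w)) => [|i /eqP iw]; last first.
    by rewrite DE iw.
  by elim/big_rec2: _ => [|i u v _ ->]; rewrite ?exp1rz // expfzMl.
rewrite -big_split; apply: eq_bigr => w _ /=.
rewrite delta_tau expfzMl mulrA -expfzDr; last by apply/prodf_neq0 => i _.
by rewrite subrr expr0z mul1r.
Qed.

End CrepancyConverse.

(** * Numerical conditions *)

Section Counting.
Variables (K : fieldType) (V : nat -> vectType K) (M : nat).
Variables alpha beta : nat -> nat.
Hypothesis le_ab : forall v, (0 < v <= M)%N -> (alpha v <= beta v)%N.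
Hypothesis le_bn : forall v, (0 < v <= M)%N -> (beta v <= \dim {:V v})%N.
Local Notation npos := (npos V M).
Local Notation blk := (@blk K V M alpha beta).
Local Notation vtx := (@vtx K V M).

Definition below w b := #|[set i : 'I_npos | (vtx i == w) && (blk i < b)%N]|.
Definition above w b := #|[set i : 'I_npos | (vtx i == w) && (b < blk i)%N]|.

Lemma card_loc_lt w c : (0 < w <= M.+1)%N -> (c <= \dim {:V w})%N ->
  #|[set i : 'I_npos | (vtx i == w) && (loc i < c)%N]| = c.
Proof.
move=> w_le c_le; rewrite cardsE -sum1_card.
rewrite (big_pos (fun l => (l < c)%N) (fun=> 1%N)) //.
transitivity (\sum_(0 <= l < c) 1)%N; last by rewrite sum_nat_const_nat subn0 muln1.
by rewrite [RHS](big_nat_widen _ _ _ _ _ c_le).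
Qed.

Lemma card_loc_ge w c : (0 < w <= M.+1)%N -> (c <= \dim {:V w})%N ->
  #|[set i : 'I_npos | (vtx i == w) && (c <= loc i)%N]| = (\dim {:V w} - c)%N.
Proof.
move=> w_le c_le; have := card_loc_lt w_le (leqnn (\dim {:V w})).
rewrite -(cardsID [set i : 'I_npos | (loc i < c)%N]) => <-.
rewrite -[X in (_ - X)%N](card_loc_lt w_le c_le).
have -> : [set i : 'I_npos | (vtx i == w) && (loc i < c)%N] =
    [set i | (vtx i == w) && (loc i < \dim {:V w})%N] :&: [set i | (loc i < c)%N].
  apply/setP => i; rewrite !inE; case: eqP => //= <-.
  by rewrite loc_lt.
rewrite addKn; apply: eq_card => i; rewrite !inE -leqNgt.
by case: eqP => [<-|]; rewrite ?andbF //= loc_lt andbT.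
Qed.

Let up w : (0 < w <= M)%N -> (0 < w <= M.+1)%N.
Proof. by case/andP=> -> /leqW. Qed.

Lemma below0 w : below w 0 = 0%N.
Proof. by apply: eq_card0 => i; rewrite !inE ltn0 andbF. Qed.

Lemma below1 w : (0 < w <= M)%N -> below w 1 = alpha w.
Proof.
move=> wM; rewrite -[RHS](card_loc_lt (up wM) (leq_trans (le_ab wM) (le_bn wM))).
apply: eq_card => i; rewrite !inE; case: eqP => //= iw.
have := blk_spec le_ab (i := i); rewrite iw => /(_ wM)[e _].
by rewrite [RHS]ltnNge e; case: (blk i).
Qed.

Lemma below2 w : (0 < w <= M)%N -> below w 2 = beta w.
Proof.
move=> wM; rewrite -[RHS](card_loc_lt (up wM) (le_bn wM)).
apply: eq_card => i; rewrite !inE; case: eqP => //= iw.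
have := blk_spec le_ab (i := i); rewrite iw => /(_ wM)[_ e].
by rewrite [RHS]ltnNge e -leqNgt.
Qed.

Lemma below2_last : below M.+1 2 = \dim {:V M.+1}.
Proof.
have w_le : (0 < M.+1 <= M.+1)%N by rewrite leqnn.
rewrite -[RHS](card_loc_lt w_le (leqnn _)).
apply: eq_card => i; rewrite !inE; case: eqP => //= iw.
rewrite -[X in (_ < \dim {:V X})%N]iw loc_lt blk_last //.
by rewrite iw.
Qed.

Lemma above0 w : (0 < w <= M)%N -> above w 0 = (\dim {:V w} - alpha w)%N.
Proof.
move=> wM; rewrite -(card_loc_ge (up wM) (leq_trans (le_ab wM) (le_bn wM))).
apply: eq_card => i; rewrite !inE; case: eqP => //= iw.
by have := blk_spec le_ab (i := i); rewrite iw => /(_ wM)[-> _].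
Qed.

Lemma above1 w : (0 < w <= M)%N -> above w 1 = (\dim {:V w} - beta w)%N.
Proof.
move=> wM; rewrite -(card_loc_ge (up wM) (le_bn wM)).
apply: eq_card => i; rewrite !inE; case: eqP => //= iw.
by have := blk_spec le_ab (i := i); rewrite iw => /(_ wM)[_ ->].
Qed.

Lemma above2 w : above w 2 = 0%N.
Proof.
by apply: eq_card0 => i; rewrite !inE ltnNge blk_le2 andbF.
Qed.

(** The first vertex has no left neighbour, but the degree formula still reads the vertex
    [(vtx i).-1], which is then 0. *)
Lemma above_vtx0 b : above 0 b = 0%N.
Proof.
by apply: eq_card0 => i; rewrite !inE; have := vtx_bound i; case: (vtx i).
Qed.

Lemma degree_slots i :
  degree (@slot_pos K V M alpha beta) i =
  (below (vtx i) (blk i))%:Z - (above (vtx i) (blk i))%:Z.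
Proof.
rewrite /degree; congr (_%:Z - _%:Z); apply: eq_card => s;
by rewrite !inE (mem_codom_slot_pos le_ab) // eq_sym.
Qed.

(** The first index of a nonempty block is 0, [alpha w] or [beta w]. Strict inclusions in the flags
    thus provide the positions at which equalities of discrepancies are tested. *)
Lemma pos_blk w b : (0 < w <= M)%N -> (0 < alpha w)%N ->
    [|| b == 0%N, (b == 1%N) && (alpha w < beta w)%N |
        (b == 2%N) && (beta w < \dim {:V w})%N] ->
    (0 < \dim {:V w})%N ->
  exists2 i, vtx i = w & blk i = b.
Proof.
move=> wM a0 hb n0; have ab := le_ab wM; have bn := le_bn wM.
have [i iw il] : exists2 i : 'I_npos, vtx i = w &
    loc i = (if b == 0 then 0 else if b == 1 then alpha w else beta w)%N.
  apply: pos_ex; first exact: up.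
  by case/or3P: hb => [/eqP->|/andP[/eqP-> h]|/andP[/eqP-> h]] //=; lia.
exists i => //; rewrite blkE iw; last by case/andP: wM.
rewrite il.
by case/or3P: hb => [/eqP->|/andP[/eqP-> h]|/andP[/eqP-> h]] /=; lia.
Qed.

End Counting.

Lemma card_set_or (T : finType) (A B : pred T) : (forall x, ~~ (A x && B x)) ->
  #|[set x | A x || B x]| = (#|[set x | A x]| + #|[set x | B x]|)%N.
Proof.
move=> dis; have -> : [set x | A x || B x] = [set x | A x] :|: [set x | B x].
  by apply/setP => x; rewrite !inE.
rewrite cardsU (_ : _ :&: _ = set0) ?cards0 ?subn0 //.
by apply/setP => x; rewrite !inE; apply/negbTE.
Qed.

Section QuiverDegrees.
Variables (K : fieldType) (V : nat -> vectType K) (m : nat).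
Variables alpha beta : nat -> nat.
Local Notation npos := (npos V m.*2).
Local Notation blk := (@blk K V m.*2 alpha beta).
Local Notation vtx := (@vtx K V m.*2).
Local Notation below := (@below K V m.*2 alpha beta).
Local Notation above := (@above K V m.*2 alpha beta).

(** In a pair of the support the first member lies at a sink, which is odd, and the second at a
    source, which is even. Only one of the two counts survives at a given vertex, and it splits over
    the two neighbours. *)
Lemma degree_support i :
  degree (@support_pos K V m alpha beta) i =
  if odd (vtx i)
  then - (((blk i == 0) * above (vtx i).+1 0 + (blk i < 2) * above (vtx i).-1 1)%N%:Z)
  else ((0 < blk i) * below (vtx i).-1 1 + (blk i == 2) * below (vtx i).+1 2)%N%:Z.
Proof.
rewrite /degree.
have -> : [set s | (s, i) \in codom (@support_pos K V m alpha beta)] =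
  [set s | (~~ odd (vtx i) && (0 < blk i)%N && ((vtx s == (vtx i).-1) && (blk s < 1)%N)) ||
           (~~ odd (vtx i) && (blk i == 2) && ((vtx s == (vtx i).+1) && (blk s < 2)%N))].
  apply/setP => s; rewrite !inE mem_codom_support /in_support.
  by have := vtx_bound i; case: odd => //=; lia.
have -> : [set t | (i, t) \in codom (@support_pos K V m alpha beta)] =
  [set t | (odd (vtx i) && (blk i == 0) && ((vtx t == (vtx i).+1) && (0 < blk t)%N)) ||
           (odd (vtx i) && (blk i < 2)%N && ((vtx t == (vtx i).-1) && (1 < blk t)%N))].
  apply/setP => t; rewrite !inE mem_codom_support /in_support.
  have := vtx_bound i; have := vtx_bound t; have := blk_le2 alpha beta t.
  by lia.
rewrite !card_set_or; last first.
- by move=> s; have := vtx_bound i; lia.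
- by move=> s; have := vtx_bound i; lia.
have card_and (c : bool) (A : pred 'I_npos) : #|[set x | c && A x]| = (c * #|[set x | A x]|)%N.
  by case: c; rewrite ?mul1n ?mul0n // -(@cards0 'I_npos); apply: eq_card => x; rewrite !inE.
rewrite !card_and -!/(below _ _) -!/(above _ _).
by case: odd; rewrite /= ?mul0n ?sub0r ?subr0.
Qed.

End QuiverDegrees.

(** * From equal discrepancies to equations between dimensions and ranks *)

Section Numerics.
Variables (K : numClosedFieldType) (V : nat -> vectType K) (m : nat).
Variables d r p q : nat -> nat.
Hypothesis m_gt0 : (1 <= m)%N.
Hypothesis hd : forall i, (1 <= i <= m.*2.+1)%N -> \dim {:V i} = d i.
Hypothesis hF1 : (0 < r 1 < d 1)%N.
Hypothesis hFeven : forall i, (1 <= i <= m)%N ->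
  (0 < q i)%N /\ (q i < d i.*2 - r i.*2)%N /\ (d i.*2 - r i.*2 < d i.*2)%N.
Hypothesis hFodd : forall i, (1 <= i <= m.-1)%N ->
  (0 < r i.*2.+1)%N /\ (r i.*2.+1 < p i)%N /\ (p i < d i.*2.+1)%N.

Local Notation M := m.*2.
Local Notation alpha := (flag_rank1 r q).
Local Notation beta := (flag_rank2 d r p).
Local Notation vtx := (@vtx K V M).
Local Notation blk := (@blk K V M alpha beta).

(** The first vertex stands apart: its larger subspace is the whole space, so it has two blocks and
    yields one equation instead of two. *)
Variant vertex_spec : nat -> Prop :=
| FirstVertex : vertex_spec 1
| EvenVertex i of (1 <= i <= m)%N : vertex_spec i.*2
| OddVertex i of (1 <= i <= m.-1)%N : vertex_spec i.*2.+1.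

Lemma vertexP w : (0 < w <= M)%N -> vertex_spec w.
Proof.
move=> wM; have [wo|we] := boolP (odd w); last first.
  by rewrite -(even_halfK we); apply: EvenVertex; lia.
have [->|w1] := eqVneq w 1%N; first exact: FirstVertex.
rewrite -(odd_double_half w) wo add1n; apply: OddVertex; lia.
Qed.

Lemma alpha1 : alpha 1 = r 1. Proof. by []. Qed.
Lemma beta1 : beta 1 = d 1. Proof. by []. Qed.
Lemma alpha_even i : alpha i.*2 = q i.
Proof. by rewrite /flag_rank1 odd_double doubleK. Qed.
Lemma beta_even i : beta i.*2 = (d i.*2 - r i.*2)%N.
Proof. by rewrite /flag_rank2 odd_double. Qed.
Lemma alpha_odd i : alpha i.*2.+1 = r i.*2.+1.
Proof. by rewrite /flag_rank1 /= odd_double. Qed.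
Lemma beta_odd i : (0 < i)%N -> beta i.*2.+1 = p i.
Proof. by rewrite /flag_rank2 /= odd_double uphalf_double; case: i. Qed.

Lemma flag_ranks v : (0 < v <= M)%N ->
  [/\ (0 < alpha v)%N, (alpha v < beta v)%N, (beta v <= \dim {:V v})%N
    & v != 1%N -> (beta v < \dim {:V v})%N].
Proof.
move=> vM; rewrite hd; last by lia.
case: (vertexP vM) => [|i ib|i ib].
- by rewrite alpha1 beta1; case/andP: hF1.
- by rewrite alpha_even beta_even; have [h1 [h2 h3]] := hFeven ib; split=> //; lia.
by rewrite alpha_odd beta_odd; [have [h1 [h2 h3]] := hFodd ib; split=> //; lia|lia].
Qed.

Let le_ab v (vM : (0 < v <= M)%N) : (alpha v <= beta v)%N.
Proof. by have [_ /ltnW] := flag_ranks vM. Qed.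

Let le_bn v (vM : (0 < v <= M)%N) : (beta v <= \dim {:V v})%N.
Proof. by have [_ _] := flag_ranks vM. Qed.

Let bel := @below K V M alpha beta.
Let abv := @above K V M alpha beta.

Let disc (w b : nat) : int :=
  (if odd w then - (((b == 0) * abv w.+1 0 + (b < 2) * abv w.-1 1)%N%:Z)
   else ((0 < b) * bel w.-1 1 + (b == 2) * bel w.+1 2)%N%:Z)
  - ((bel w b)%:Z - (abv w b)%:Z).

Let discE i : @discrepancy K V m d r p q i = disc (vtx i) (blk i).
Proof. by rewrite /discrepancy degree_support degree_slots. Qed.

Let bel1 w (wM : (0 < w <= M)%N) : bel w 1 = alpha w := below1 le_ab le_bn wM.
Let bel2 w (wM : (0 < w <= M)%N) : bel w 2 = beta w := below2 le_ab le_bn wM.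
Let abv0 w (wM : (0 < w <= M)%N) : abv w 0 = (d w - alpha w)%N.
Proof. by rewrite /abv (above0 le_ab le_bn wM) hd //; lia. Qed.
Let abv1 w (wM : (0 < w <= M)%N) : abv w 1 = (d w - beta w)%N.
Proof. by rewrite /abv (above1 le_ab le_bn wM) hd //; lia. Qed.

Let disc_first : (disc 1 0 == disc 1 1) = (d 1 + q 1 == d 2)%N.
Proof.
have h1 : (0 < 1 <= M)%N by lia.
have h2 : (0 < 1.*2 <= M)%N by lia.
rewrite /disc /= /bel /abv below0 above_vtx0 -/bel -/abv !(abv0 h2, abv0 h1) abv1 // bel1 //.
rewrite (alpha_even 1) alpha1 beta1 /=.
have [h3 [h4 h5]] := hFeven (i := 1%N) m_gt0; have := hF1.
rewrite !mul0n !mul1n; move: h3 h4 h5; rewrite -[1.*2]/2%N; lia.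
Qed.

(** The rank of the bundle that receives the even arrow out of the vertex [2i]; for [i = m] it is
    the whole space at [2m+1]. *)
Let bb i := if (i < m)%N then p i else d i.*2.+1.

(** At the vertex [2i] the discrepancies in blocks 0, 1 and 2 are [d_2i - q_i],
    [r_(2i-1) + r_2i - q_i] and [r_(2i-1) + r_2i + bb_i - d_2i]. *)
Let disc_even01 i : (1 <= i <= m)%N ->
  (disc i.*2 0 == disc i.*2 1) = (r i.*2.-1 + r i.*2 == d i.*2)%N.
Proof.
move=> ib; have h0 : (0 < i.*2 <= M)%N by lia.
have h1 : (0 < i.*2.-1 <= M)%N by lia.
rewrite /disc odd_double /= /bel /abv below0 -/bel -/abv !bel1 // abv0 // abv1 //.
rewrite alpha_even beta_even (_ : alpha i.*2.-1 = r i.*2.-1).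
  by have [h3 [h4 h5]] := hFeven ib; lia.
by rewrite /flag_rank1 ifT //; lia.
Qed.

Let disc_even12 i : (1 <= i <= m)%N ->
  (disc i.*2 1 == disc i.*2 2) = (bb i + q i == d i.*2)%N.
Proof.
move=> ib; have h0 : (0 < i.*2 <= M)%N by lia.
have bE : bel i.*2.+1 2 = bb i.
  rewrite /bb; case: ltnP => im; first by rewrite bel2 ?beta_odd; lia.
  have -> : i = m by lia.
  by rewrite /bel below2_last hd //; lia.
rewrite /disc odd_double /= bE /bel /abv above2 -/bel -/abv (bel1 h0) bel2 // abv1 //.
rewrite alpha_even beta_even.
by have [h3 [h4 h5]] := hFeven ib; lia.
Qed.

(** At the vertex [2i+1] the discrepancies in blocks 0, 1 and 2 are [d_(2i+1) - r_2i - r_(2i+1) -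
    d_(2i+2) + q_(i+1)], [d_(2i+1) - r_2i - r_(2i+1) - p_i] and [- p_i]. *)
Let disc_odd01 i : (1 <= i <= m.-1)%N ->
  (disc i.*2.+1 0 == disc i.*2.+1 1) = (p i + q i.+1 == d i.*2.+2)%N.
Proof.
move=> ib; have h0 : (0 < i.*2.+1 <= M)%N by lia.
have h1 : (0 < i.+1.*2 <= M)%N by lia.
have i0 : (0 < i)%N by lia.
have ib' : (1 <= i.+1 <= m)%N by lia.
rewrite /disc /= odd_double /= /bel /abv below0 -/bel -/abv.
rewrite -[i.*2.+2]/(i.+1.*2) (abv0 h0) (abv0 h1) bel1 // (abv1 h0).
rewrite alpha_even alpha_odd beta_odd //.
by have [h3 [h4 h5]] := hFodd ib; have [h6 [h7 h8]] := hFeven ib'; lia.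
Qed.

Let disc_odd12 i : (1 <= i <= m.-1)%N ->
  (disc i.*2.+1 1 == disc i.*2.+1 2) = (r i.*2 + r i.*2.+1 == d i.*2.+1)%N.
Proof.
move=> ib; have h0 : (0 < i.*2.+1 <= M)%N by lia.
have h1 : (0 < i.*2 <= M)%N by lia.
have i0 : (0 < i)%N by lia.
have ib' : (1 <= i <= m)%N by lia.
rewrite /disc /= odd_double /= /bel /abv above2 -/bel -/abv.
rewrite (abv1 h0) (abv1 h1) bel1 // bel2 //.
rewrite beta_even alpha_odd beta_odd //.
by have [h3 [h4 h5]] := hFodd ib; have [h6 [h7 h8]] := hFeven ib'; lia.
Qed.

(** Consecutive blocks suffice, and none of the blocks involved is empty: each comparison is one of
    the listed equations, and each is forced. *)
Lemma discrepancy_numeric :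
  (forall s t : 'I_(npos V M), vtx s = vtx t -> (blk s < blk t)%N ->
     @discrepancy K V m d r p q s = @discrepancy K V m d r p q t) <->
  [/\ (d 1 + q 1 == d 2)%N,
      forall i, (1 <= i <= m)%N -> (r i.*2.-1 + r i.*2 == d i.*2)%N,
      forall i, (1 <= i <= m)%N -> (bb i + q i == d i.*2)%N,
      forall i, (1 <= i <= m.-1)%N -> (p i + q i.+1 == d i.*2.+2)%N
    & forall i, (1 <= i <= m.-1)%N -> (r i.*2 + r i.*2.+1 == d i.*2.+1)%N].
Proof.
split=> [bal|[e1 e2 e3 e4 e5] s t st lt].
  have adj w b : (0 < w <= M)%N -> (b == 0%N) || (b == 1%N) && (w != 1%N) ->
      disc w b == disc w b.+1.
    move=> wM hb; have [a0 ab bn bn'] := flag_ranks wM.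
    have n0 : (0 < \dim {:V w})%N by lia.
    have [s sw sb] : exists2 s, vtx s = w & blk s = b.
      apply: (pos_blk le_ab le_bn wM a0) => //.
      by case/orP: hb => [/eqP->|/andP[/eqP-> _]]; rewrite //= ab.
    have [t tw tb] : exists2 t, vtx t = w & blk t = b.+1.
      apply: (pos_blk le_ab le_bn wM a0) => //.
      by case/orP: hb => [/eqP->|/andP[/eqP-> /bn' h]]; rewrite //= ?ab ?h.
    have := bal s t; rewrite !discE sw tw sb tb => /(_ erefl (leqnn _)) ->.
    exact: eqxx.
  split=> [|i ib|i ib|i ib|i ib].
  - by rewrite -disc_first adj //; lia.
  - by rewrite -disc_even01 // adj //; lia.
  - by rewrite -disc_even12 // adj //; lia.
  - by rewrite -disc_odd01 // adj //; lia.
  by rewrite -disc_odd12 // adj //; lia.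
have [sM sl] := andP (etrans (esym (blk_ltE le_ab st)) lt).
have wM : (0 < vtx s <= M)%N by rewrite sM andbT; case/andP: (vtx_bound s).
rewrite !discE -st.
have c01 : disc (vtx s) 0 = disc (vtx s) 1.
  case: (vertexP wM) => [|i ib|i ib]; apply/eqP.
  - by rewrite disc_first.
  - by rewrite disc_even01 ?e2.
  by rewrite disc_odd01 ?e4.
have c12 : vtx s != 1%N -> disc (vtx s) 1 = disc (vtx s) 2.
  case: (vertexP wM) => [//|i ib _|i ib _]; apply/eqP.
    by rewrite disc_even12 ?e3.
  by rewrite disc_odd12 ?e5.
have [s1|s1] := eqVneq (vtx s) 1%N; last first.
  have b2 := blk_le2 alpha beta t.
  have : blk s \in [:: 0; 1]%N /\ blk t \in [:: 1; 2]%N by rewrite !inE; lia.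
  rewrite !inE => -[/orP[]/eqP-> /orP[]/eqP->]; rewrite ?c01 ?c12 //.
(* At the first vertex [beta 1] is the full dimension, so no position has block 2. *)
have tb : (blk t < 2)%N.
  have t1 : vtx t = 1%N by rewrite -st.
  have := blk_spec le_ab (i := t); rewrite -st => /(_ wM)[_ e].
  rewrite ltnNge -e -ltnNge s1 beta1 -hd; last by lia.
  by rewrite -t1 loc_lt.
have -> : blk s = 0%N by lia.
have -> : blk t = 1%N by lia.
exact: c01.
Qed.

Lemma crepant_numeric : crepant V m d r p q <->
  [/\ (d 1 + q 1 == d 2)%N,
      forall i, (1 <= i <= m)%N -> (r i.*2.-1 + r i.*2 == d i.*2)%N,
      forall i, (1 <= i <= m)%N -> (bb i + q i == d i.*2)%N,
      forall i, (1 <= i <= m.-1)%N -> (p i + q i.+1 == d i.*2.+2)%N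
    & forall i, (1 <= i <= m.-1)%N -> (r i.*2 + r i.*2.+1 == d i.*2.+1)%N].
Proof.
rewrite -discrepancy_numeric; split.
  exact: crepant_discrepancy.
exact: discrepancy_crepant.
Qed.

(** Consecutive equations share a [q_i] or a [p_i], so the value [d_1] is carried along the quiver
    through every [p_i] up to [d_(2m+1)], fixing each [q_i] on the way. The equations on [r] at even
    and at odd vertices are the two parities of a single one. *)
Lemma crepantP : crepant V m d r p q <->
  [/\ d 1%N = d m.*2.+1,
      forall i, (1 <= i <= m.-1)%N -> d 1%N = p i,
      forall i, (1 <= i <= m)%N -> (q i)%:Z = (d i.*2)%:Z - (d 1%N)%:Z
    & forall i, (1 <= i <= m.*2.-1)%N ->
        (r i)%:Z = (d i.+1)%:Z - (r i.+1)%:Z].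
Proof.
rewrite crepant_numeric; split=> [[e1 e2 e3 e4 e5]|[f1 f2 f3 f4]].
  have q_le i (ib : (1 <= i <= m)%N) : (d 1 + q i = d i.*2)%N.
    elim: i ib => [//|[|i] IH] ib; first by apply/eqP.
    have ib' : (1 <= i.+1 <= m)%N by lia.
    have ib2 : (1 <= i.+1 <= m.-1)%N by lia.
    have := IH ib'; have := e3 _ ib'; have := e4 _ ib2.
    by rewrite /bb ifT ?doubleS; lia.
  split=> [|i ib|i ib|i ib].
  - have ib : (1 <= m <= m)%N by lia.
    by have := q_le m ib; have := e3 m ib; rewrite /bb ltnn; lia.
  - have ib' : (1 <= i <= m)%N by lia.
    by have := q_le i ib'; have := e3 i ib'; rewrite /bb ifT; lia.
  - by have := q_le i ib; lia.
  have [io|ie] := boolP (odd i).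
    have ib' : (1 <= i.+1./2 <= m)%N by lia.
    have iE : i.+1 = i.+1./2.*2 by rewrite even_halfK //= io.
    by have := e2 _ ib'; rewrite -iE /=; lia.
  have ib' : (1 <= i./2 <= m.-1)%N by lia.
  have iE : i = i./2.*2 by rewrite even_halfK.
  by have := e5 _ ib'; rewrite -iE /=; lia.
split=> [|i ib|i ib|i ib|i ib].
- by have := f3 1%N m_gt0; rewrite -[1.*2]/2%N; lia.
- have ib' : (1 <= i.*2.-1 <= m.*2.-1)%N by lia.
  have := f4 _ ib'; rewrite prednK; last by lia.
  by lia.
- have := f3 i ib; rewrite /bb; case: ltnP => im.
    by rewrite -(f2 i); lia.
  have -> : i = m by lia.
  by rewrite -f1; lia.
- have ib' : (1 <= i.+1 <= m)%N by lia.
  by have := f3 _ ib'; rewrite -(f2 i ib) doubleS; lia.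
have ib' : (1 <= i.*2 <= m.*2.-1)%N by lia.
by have := f4 _ ib'; lia.
Qed.

End Numerics.

Theorem proposition3p20 (R : realType) (m : nat) (hm : (1 <= m)%N)
  (V : nat -> vectType R[i]) (d r p q : nat -> nat)
  (hd : forall i, (1 <= i <= m.*2.+1)%N -> \dim {:V i} = d i)
  (* the orbit is nonempty *)
  (hO : exists phi : rep V, in_O_rpq m r p q phi)
  (* nonzero proper subspaces, strict inclusions in the flags of F *)
  (hF1 : (0 < r 1 < d 1)%N)
  (hFeven : forall i, (1 <= i <= m)%N ->
     (0 < q i)%N /\ (q i < d i.*2 - r i.*2)%N /\ (d i.*2 - r i.*2 < d i.*2)%N)
  (hFodd : forall i, (1 <= i <= m.-1)%N ->
     (0 < r i.*2.+1)%N /\ (r i.*2.+1 < p i)%N /\ (p i < d i.*2.+1)%N)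
  (hp : forall i, (1 <= i <= m.-1)%N -> p i <> r i.*2.+1 /\ p i <> r i.*2)
  (hq : forall i, (1 <= i <= m)%N ->
     (q i)%:Z <> (d i.*2)%:Z - (r i.*2.-1)%:Z
     /\ (q i)%:Z <> (d i.*2)%:Z - (r i.*2)%:Z) :
  crepant V m d r p q <->
  [/\ d 1%N = d m.*2.+1,
      forall i, (1 <= i <= m.-1)%N -> d 1%N = p i,
      forall i, (1 <= i <= m)%N -> (q i)%:Z = (d i.*2)%:Z - (d 1%N)%:Z
    & forall i, (1 <= i <= m.*2.-1)%N ->
        (r i)%:Z = (d i.+1)%:Z - (r i.+1)%:Z].
Proof. exact: crepantP. Qed.
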